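(* Let $\mathbb{L}_1,\mathbb{L}_2,\ldots$ be a sequence of random profiles satisfying Assumptions A1–A4 listed in the context. Fix $r\in\mathbb{N}_0$ and a compact set $K\subset(\beta_-,\beta_+)$. Then, almost surely, as $n\to\infty$, $$ w_n^{\frac{r+1}2}\sup_{k\in\mathbb{Z}}\sup_{\beta\in K}\left|e^{\beta k-\varphi(\beta)w_n}\mathbb{L}_n(k)-\frac{W_\infty(\beta)e^{-\frac12x_n^2(k)}}{\sigma(\beta)\sqrt{2\pi w_n}}\sum_{j=0}^r\frac{G_j(x_n(k);\beta)}{w_n^{j/2}}\right|\longrightarrow0. $$ Here $x_n(k)=x_n(k;\beta)=\frac{k-\mu(\beta)w_n}{\sigma(\beta)\sqrt{w_n}}$, and $G_j(x)=G_j(x;\beta)$, $j\in\mathbb{N}_0$, is a polynomial in $x$ of degree at most $3j$ given by $$G_j(x)=\frac{(-1)^j}{j!}\,e^{\frac12x^2}B_j(D_1,\ldots,D_j)e^{-\frac12x^2},$$ where $B_j$ is the $j$-th complete Bell polynomial and $D_1,D_2,\ldots$ are the linear differential operators (with random coefficients) $$D_j=\frac{\varphi^{(j+2)}(\beta)}{(j+1)(j+2)}\left(\frac1{\sigma(\beta)}\frac{d}{dx}\right)^{j+2}+\chi_j(\beta)\left(\frac1{\sigma(\beta)}\frac{d}{dx}\right)^j.$$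
   Context: Random profiles: each $\mathbb{L}_n=(\mathbb{L}_n(k))_{k\in\mathbb{Z}}$ is a real-valued stochastic process indexed by $\mathbb{Z}$, all defined on a common probability space. Ingredients: an open non-empty interval $(\beta_-,\beta_+)\subset\mathbb{R}$ (possibly unbounded) containing $0$; a real sequence $(w_n)_{n\in\mathbb{N}}$ with $w_n\to+\infty$; an open connected set $\mathscr{D}\subset\{\beta\in\mathbb{C}:\beta_-<\operatorname{Re}\beta<\beta_+\}$ with $\mathscr{D}\cap\mathbb{R}=(\beta_-,\beta_+)$; a deterministic analytic function $\varphi:\mathscr{D}\to\mathbb{C}$ with $\varphi(\beta)\in\mathbb{R}$ and $\varphi''(\beta)>0$ for real $\beta\in(\beta_-,\beta_+)$. Assumption A1: for every $n\in\mathbb{N}$ and $\beta\in(\beta_-,\beta_+)$, $\sum_{k\in\mathbb{Z}}|\mathbb{L}_n(k)|e^{\beta k}<\infty$ a.s. Hence a.s. $W_n(\beta):=e^{-\varphi(\beta)w_n}\sum_{k\in\mathbb{Z}}\mathbb{L}_n(k)e^{\beta k}$, $\beta\in\mathscr{D}$, is a random analytic function. Assumption A2: with probability $1$, $W_n$ converges locally uniformly on $\mathscr{D}$ to some random analytic function $W_\infty$ with $\mathbb{P}[W_\infty(\beta)\ne0\text{ for all }\beta\in(\beta_-,\beta_+)]=1$. Assumption A3: for every compact $K\subset\mathscr{D}$ and $r\in\mathbb{N}$ there is an a.s. finite random variable $C_{K,r}$ such that for all $n\in\mathbb{N}$, $\sup_{\beta\in K}|W_n(\beta)-W_\infty(\beta)|<C_{K,r}w_n^{-r}$.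 Assumption A4: for every compact $K\subset(\beta_-,\beta_+)$, every $a>0$ and $r\in\mathbb{N}_0$, $$\sup_{\beta\in K}\Big[e^{-\varphi(\beta)w_n}\int_a^\pi\Big|\sum_{k\in\mathbb{Z}}\mathbb{L}_n(k)e^{k(\beta+iu)}\Big|\,du\Big]=o(w_n^{-r})\quad\text{a.s. as }n\to\infty.$$ Notation: $\mu(\beta)=\varphi'(\beta)$, $\sigma^2(\beta)=\varphi''(\beta)$ with $\sigma(\beta)>0$, and $\chi_j(\beta)=(\log W_\infty)^{(j)}(\beta)$ for $\beta\in(\beta_-,\beta_+)$. The complete Bell polynomials are defined by the formal identity $\exp\{\sum_{j\ge1}\frac{x^j}{j!}z_j\}=\sum_{j\ge0}\frac{x^j}{j!}B_j(z_1,\dots,z_j)$ (so $B_0=1$) and are applied to the commuting operators $D_1,D_2,\dots$. $\mathbb{N}_0=\{0,1,2,\dots\}$. *)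

(* Defs.v *)
From HB Require Import structures.
From mathcomp Require Import all_boot all_order all_algebra.
From mathcomp Require Import complex.
From mathcomp Require Import all_classical all_reals all_analysis.
From mathcomp Require Import measurable_realfun.
Set Implicit Arguments.
Unset Strict Implicit.
Unset Printing Implicit Defensive.
Import Order.TTheory GRing.Theory Num.Theory numFieldNormedType.Exports.

Local Open Scope classical_set_scope.
Local Open Scope ring_scope.
Local Open Scope complex_scope.

(* Throughout, R[i]^o is the field R[i] seen as a normed space over itself;
   this is where the topology of the complex plane comes from. *)

Definition ointerval (R : realType) (bm bp : \bar R) : set R :=
  [set b : R | (bm < b%:E < bp)%E].

Section complex_functions.
Variable R : realType.

Definition cexp (z : R[i]) : R[i] :=
  (expR (complex.Re z) * cos (complex.Im z)) +i*
  (expR (complex.Re z) * sin (complex.Im z)).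

Definition analytic_at (f : R[i] -> R[i]) (z : R[i]) : Prop :=
  exists a : nat -> R[i], exists2 rho : R, 0 < rho &
    forall h : R[i], Normc.normc h < rho ->
      (series (fun n => a n * h ^+ n) : nat -> R[i]^o) @ \oo
        --> (f (z + h) : R[i]^o).

Definition analytic_on (D : set R[i]^o) (f : R[i] -> R[i]) : Prop :=
  forall z, D z -> analytic_at f z.

Definition locally_uniform_cvg (D : set R[i]^o)
    (f : nat -> R[i] -> R[i]) (g : R[i] -> R[i]) : Prop :=
  forall z : R[i]^o, D z -> exists2 U : set R[i]^o, nbhs z U &
    {uniform U `&` D, (f : nat -> R[i]^o -> R[i]^o) @ \oo
                        --> (g : R[i]^o -> R[i]^o)}.

(* The sum of an absolutely convergent bilateral series; symmetric partial sums
   are only a choice of enumeration of the integers. *)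
Definition zsum (f : int -> R[i]) : R[i] :=
  lim ((\sum_(i < N.*2.+1) f (i%:Z - N%:Z) : R[i]^o) @[N --> \oo]).

Definition zlaplace (l : int -> R) (z : R[i]) : R[i] :=
  zsum (fun k => (l k)%:C * cexp (z * k%:~R)).

Definition Wnorm (phi : R[i] -> R[i]) (w : R) (l : int -> R) (z : R[i]) :
    R[i] :=
  cexp (- (phi z * w%:C)) * zlaplace l z.

(* Used for functions that are real-valued on the real points of their domain:
   their derivatives at real points are taken along the real line. *)
Definition on_real (f : R[i] -> R[i]) (b : R) : R := complex.Re (f b%:C).

End complex_functions.

(* Supremum in [0, +oo], hence 0 (and not -oo) over the empty set. *)
Definition nnsup {R : realType} {I : Type} (A : set I) (f : I -> \bar R) :
    \bar R :=
  ereal_sup ([set 0%E] `|` f @` A).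

(* Bell's j-th complete polynomial is j! times the coefficient of X^j in
   exp (\sum_(i >= 1) z i X^i / i!); the terms with i > j and the powers of
   order m > j in the exponential series do not contribute to it. *)
Definition complete_bell (K : fieldType) (A : comAlgType K) (j : nat)
    (z : nat -> A) : A :=
  j`!%:R *: \sum_(m < j.+1) m`!%:R^-1 *:
    ((\sum_(1 <= i < j.+1) (i`!%:R^-1 *: z i)%:P * 'X^i) ^+ m)`_j.

Section expansion.
Variable R : realType.

(* The constant-coefficient differential operator obtained from the polynomial
   p by substituting d/dx for 'X. *)
Definition diffop (p : {poly R}) (f : R -> R) (x : R) : R :=
  \sum_(i < size p) p`_i * derive1n i f x.

Variables (phi W : R[i] -> R[i]).

Definition mu (b : R) : R := derive1 (on_real phi) b.

Definition sigma (b : R) : R := Num.sqrt (derive1n 2 (on_real phi) b).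

(* W does not vanish on the interval under consideration, but it may be
   negative there, in which case a branch of log W differs from ln |W| by a
   constant; only the derivatives of order j >= 1 are used. *)
Definition chi (j : nat) (b : R) : R :=
  derive1n j (fun t => ln `|on_real W t|) b.

Definition Dop (b : R) (j : nat) : {poly R} :=
  (derive1n j.+2 (on_real phi) b / (j.+1 * j.+2)%:R) *:
    ((sigma b)^-1 *: 'X) ^+ j.+2
  + chi j b *: ((sigma b)^-1 *: 'X) ^+ j.

Definition Gpoly (j : nat) (b x : R) : R :=
  (-1) ^+ j / j`!%:R * expR (x ^+ 2 / 2) *
  diffop (complete_bell j (Dop b)) (fun y => expR (- (y ^+ 2 / 2))) x.

Definition xnorm (w : R) (k : int) (b : R) : R :=
  (k%:~R - mu b * w) / (sigma b * Num.sqrt w).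

End expansion.

(* Main.v *)
Require Import Defs.
From HB Require Import structures.
From mathcomp Require Import all_boot all_order all_algebra.
From mathcomp Require Import complex all_classical all_reals all_analysis.
From mathcomp Require Import measurable_realfun.
From mathcomp Require Import ring lra zify.

(** The k-th term of a two-sided series is a Fourier coefficient of its Laplace
    transform Z on the vertical line through b: as the profile l is real,
      pi * l(k) * e^(bk) = int_0^pi Re (Z(b + iu) e^(-iku)) du
    ([fourier_inversion]). After multiplication by e^(-phi(b) w), the part of
    this integral over [a, pi] is bounded by the tail that is assumed to be
    negligible, for every fixed a > 0. On [0, a] the integrand is the real part
    of W_n(b + iu) exp (w (phi(b + iu) - phi(b)) - iku).

    There, put e = w^(-1/2) and u = s e / sigma. The quadratic Taylor term of phi
    becomes the Gaussian e^(-s^2/2), the linear one merges with -iku into -isx,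
    where x is the normalised position of k, and the Taylor terms of order at
    least 3, together with those of log W, give the factor
      W(b) exp (sum_(i >= 1) (-e)^i / i! D_i(-is)),
    in which D_i(-is) is the symbol of the differential operator D_i
    ([symbol_sum]). By the definition of the Bell polynomials, the expansion of
    this exponential in powers of e is sum_j (-e)^j / j! B_j(D)(-is)
    ([evalc_edgeworth], [key_estimate]). Multiplying the Fourier integral of
    e^(-s^2/2) by a polynomial in -is amounts to applying this polynomial in d/dx
    to e^(-x^2/2) ([diffop_gexp]), and the claimed approximation comes out.

    The error in the integrand is at most C e^(r+1) e^(-s), and du = (e / sigma) ds
    provides one more power of e, so that the total error is O(e^(r+2)) plus the
    tail ([profile_error]). The constant depends only on bounds for W, for finitely
    many derivatives of phi and log |W|, and for the remainders of the Taylor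
    expansions of phi and W, and on a lower bound for sigma. All of these hold
    locally uniformly in b ([analytic_taylor]), hence uniformly on K
    ([compact_uniform]). The Taylor coefficients of W enter through those of
    log |W|: both satisfy the recurrence that characterises a formal exponential
    ([lnabs_recurrence], [exppoly_unique]).

    Countably many almost sure events suffice: summability at two points that
    enclose K ([esum_laplace_itv]), the rate of convergence of W_n on one compact
    rectangle, and the decay of the tails that start at a = 1 / (m + 1). *)

Set Implicit Arguments.
Unset Strict Implicit.
Unset Printing Implicit Defensive.
Import Order.TTheory GRing.Theory Num.Theory numFieldNormedType.Exports.

Local Open Scope classical_set_scope.
Local Open Scope ring_scope.
Local Open Scope complex_scope.

Local Notation nc := Normc.normc.

(** * Complex numbers and the complex exponential *)

Section complex_norm.
Variable R : realType.
Implicit Types (x y z : R[i]) (a b : R).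

Lemma normc_ge0 z : 0 <= nc z.
Proof. by case: z => a b; apply: sqrtr_ge0. Qed.

Lemma le_Re_normc z : `|complex.Re z| <= nc z.
Proof. by have := normc_ge_Re z; rewrite normc_def lecR; case: z. Qed.

Lemma le_Im_normc z : `|complex.Im z| <= nc z.
Proof.
by case: z => a b /=; rewrite -[leLHS]sqrtr_sqr ler_wsqrtr// lerDr sqr_ge0.
Qed.

Lemma normc_le_ReIm z : nc z <= `|complex.Re z| + `|complex.Im z|.
Proof.
case: z => a b /=; rewrite -[leRHS]ger0_norm ?addr_ge0// -sqrtr_sqr ler_wsqrtr//.
rewrite sqrrD -!normrX !(ger0_norm (sqr_ge0 _)).
by rewrite -addrA lerD2l lerDr mulrn_wge0// mulr_ge0.
Qed.

Lemma normcR a : nc a%:C = `|a|.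
Proof. by rewrite /= expr0n/= addr0 sqrtr_sqr. Qed.

Lemma normcX z n : nc (z ^+ n) = nc z ^+ n.
Proof.
elim: n => [|n IH]; first by rewrite !expr0 Normc.normc1.
by rewrite !exprS Normc.normcM IH.
Qed.

Lemma normc_sum (I : Type) (s : seq I) (Q : pred I) (f : I -> R[i]) :
  nc (\sum_(i <- s | Q i) f i) <= \sum_(i <- s | Q i) nc (f i).
Proof.
elim/big_ind2: _ => [|x a y b xa yb|//]; first by rewrite Normc.normc0.
by apply: le_trans (le_normcD _ _) _; apply: lerD.
Qed.

Lemma cReD x y : complex.Re (x + y) = complex.Re x + complex.Re y.
Proof. by case: x y => [? ?] [? ?]. Qed.

Lemma cImD x y : complex.Im (x + y) = complex.Im x + complex.Im y.
Proof. by case: x y => [? ?] [? ?]. Qed.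

Lemma cReN x : complex.Re (- x) = - complex.Re x.
Proof. by case: x. Qed.

Lemma cImN x : complex.Im (- x) = - complex.Im x.
Proof. by case: x. Qed.

Lemma cReM x y : complex.Re (x * y) =
  complex.Re x * complex.Re y - complex.Im x * complex.Im y.
Proof. by case: x y => [? ?] [? ?]. Qed.

Lemma cImM x y : complex.Im (x * y) =
  complex.Re x * complex.Im y + complex.Im x * complex.Re y.
Proof. by case: x y => [? ?] [? ?]. Qed.

Lemma cReMr a z : complex.Re (a%:C * z) = a * complex.Re z.
Proof. by rewrite cReM /= mul0r subr0. Qed.

Lemma cImMr a z : complex.Im (a%:C * z) = a * complex.Im z.
Proof. by rewrite cImM /= mul0r addr0. Qed.

Lemma cRe_sum (I : Type) (s : seq I) (Q : pred I) (f : I -> R[i]) :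
  complex.Re (\sum_(i <- s | Q i) f i) = \sum_(i <- s | Q i) complex.Re (f i).
Proof. by elim/big_ind2: _ => [|x a y b <- <-|//]; rewrite ?cReD. Qed.

Lemma cIm_sum (I : Type) (s : seq I) (Q : pred I) (f : I -> R[i]) :
  complex.Im (\sum_(i <- s | Q i) f i) = \sum_(i <- s | Q i) complex.Im (f i).
Proof. by elim/big_ind2: _ => [|x a y b <- <-|//]; rewrite ?cImD. Qed.

Lemma eq_complexP x y : complex.Re x = complex.Re y ->
  complex.Im x = complex.Im y -> x = y.
Proof. by case: x y => [? ?] [? ?] /= -> ->. Qed.

Lemma natcE n : (n%:R : R[i]) = (n%:R)%:C.
Proof. by rewrite rmorph_nat. Qed.

Lemma normc_nat n : nc (n%:R : R[i]) = n%:R.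
Proof. by rewrite natcE normcR ger0_norm. Qed.

Lemma cexpD x y : cexp (x + y) = cexp x * cexp y.
Proof.
apply: eq_complexP; rewrite ?cReM ?cImM /= ?cReD ?cImD expRD ?cosD ?sinD; ring.
Qed.

Lemma cexp0 : cexp 0 = 1 :> R[i].
Proof. by rewrite /cexp /= expR0 cos0 sin0 mulr1 mulr0. Qed.

Lemma normc_cexp z : nc (cexp z) = expR (complex.Re z).
Proof.
case: z => a b; rewrite /= !exprMn -mulrDr cos2Dsin2 mulr1.
by rewrite sqrtr_sqr ger0_norm// expR_ge0.
Qed.

Lemma normc_cexp_le z : nc (cexp z) <= expR (nc z).
Proof. by rewrite normc_cexp ler_expR (le_trans _ (le_Re_normc z))// ler_norm. Qed.

Lemma cexpR a : cexp a%:C = (expR a)%:C.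
Proof. by rewrite /cexp /= cos0 sin0 mulr1 mulr0. Qed.

End complex_norm.

Section exponential_remainder.
Variable R : realType.

(** There is no mean value theorem for complex-valued functions; applying it to
    the real and imaginary parts costs the factor 2. *)
Lemma complex_MVT (g g' : R -> R[i]) (B t : R) : 0 <= t ->
  (forall s : R, is_derive s 1 (fun x => complex.Re (g x)) (complex.Re (g' s))) ->
  (forall s : R, is_derive s 1 (fun x => complex.Im (g x)) (complex.Im (g' s))) ->
  (forall s, 0 <= s <= t -> nc (g' s) <= B) ->
  nc (g t - g 0) <= 2 * t * B.
Proof.
move=> t0 dRe dIm gB.
have mvt (f f' : R -> R) : (forall s : R, is_derive s 1 f (f' s)) ->
    (forall s, 0 <= s <= t -> `|f' s| <= B) -> `|f t - f 0| <= t * B.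
  move=> df fB.
  have [c ct ->] : exists2 c, c \in `[0, t]%R & f t - f 0 = f' c * (t - 0).
    apply: (@MVT_segment R f f') => //.
    apply: continuous_subspaceT => x; apply: differentiable_continuous.
    by apply/derivable1_diffP; have := df x => ?; exact: ex_derive.
  rewrite subr0 normrM (ger0_norm t0) mulrC ler_wpM2l// fB//.
apply: le_trans (normc_le_ReIm _) _.
rewrite cReD cImD cReN cImN -mulrA mulr_natl mulr2n lerD//.
- apply: (mvt (fun x => complex.Re (g x)) (fun x => complex.Re (g' x))) => // s st.
  exact: le_trans (le_Re_normc _) (gB _ st).
- apply: (mvt (fun x => complex.Im (g x)) (fun x => complex.Im (g' x))) => // s st.
  exact: le_trans (le_Im_normc _) (gB _ st).
Qed.

Definition texp (N : nat) (z : R[i]) : R[i] := \sum_(m < N) (m`!%:R)^-1 * z ^+ m.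

Lemma texp0S N : texp N.+1 0 = 1.
Proof.
rewrite /texp big_ord_recl big1 ?addr0 ?fact0 ?expr0 ?invr1 ?mulr1// => i _.
by rewrite /= expr0n/= mulr0.
Qed.

Lemma is_derive_Re_cexp (z : R[i]) (s : R) :
  is_derive s 1 (fun s : R => complex.Re (cexp (s%:C * z)))
                (complex.Re (z * cexp (s%:C * z))).
Proof.
rewrite (_ : (fun _ => _) = fun s => expR (s * complex.Re z) * cos (s * complex.Im z)).
  apply: is_derive_eq.
  rewrite !cReM /= !cReMr !cImMr /GRing.scale /=; ring.
by apply/funext => u; rewrite /= cReMr cImMr.
Qed.

Lemma is_derive_Im_cexp (z : R[i]) (s : R) :
  is_derive s 1 (fun s : R => complex.Im (cexp (s%:C * z)))
                (complex.Im (z * cexp (s%:C * z))).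
Proof.
rewrite (_ : (fun _ => _) = fun s => expR (s * complex.Re z) * sin (s * complex.Im z)).
  apply: is_derive_eq.
  rewrite !cImM /= !cReMr !cImMr /GRing.scale /=; ring.
by apply/funext => u; rewrite /= cReMr cImMr.
Qed.

Lemma texp_ray N (s : R) z :
  texp N (s%:C * z) = \sum_(m < N) (s ^+ m)%:C * ((m`!%:R)^-1 * z ^+ m).
Proof. by apply: eq_bigr => i _; rewrite exprMn rmorphXn /= mulrCA. Qed.

Lemma is_derive_power_sum (h : nat -> R) N (s : R) :
  is_derive s 1 (fun s : R => \sum_(m < N.+1) s ^+ m * (h m))
                (\sum_(m < N) s ^+ m * (m.+1%:R * h m.+1)).
Proof.
elim: N => [|N IH].
  rewrite big_ord0 (_ : (fun _ => _) = cst (h 0%N)); last first.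
    by apply/funext => x; rewrite big_ord1 expr0 mul1r.
  exact: is_derive_cst.
rewrite (_ : (fun _ => _) =
  (fun s : R => \sum_(m < N.+1) s ^+ m * h m) + (fun s : R => s ^+ N.+1 * h N.+1)).
  rewrite [X in is_derive _ _ _ X]big_ord_recr; apply: is_deriveD => /=.
  rewrite (_ : (fun _ => _) = horner (h N.+1 *: 'X^(N.+1))); last first.
    by apply/funext => x; rewrite hornerZ hornerXn mulrC.
  apply: is_derive_eq.
  by rewrite derivZ derivXn hornerZ hornerMn hornerXn -mulr_natl mulrC -mulrA mulrCA.
by apply/funext => x; rewrite big_ord_recr.
Qed.

Lemma fact_recl (n : nat) : n.+1%:R * (n.+1`!%:R)^-1 = (n`!%:R)^-1 :> R[i].
Proof.
by rewrite factS natrM invfM mulrA divff ?mul1r.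
Qed.

Lemma texp_coef_shift m z :
  (m.+1%:R)%:C * ((m.+1`!%:R)^-1 * z ^+ m.+1) = z * ((m`!%:R)^-1 * z ^+ m) :> R[i].
Proof.
rewrite [LHS]mulrA; have -> : (m.+1%:R)%:C * (m.+1`!%:R)^-1 = (m`!%:R)^-1 :> R[i].
  by rewrite -natcE; exact: fact_recl.
by rewrite exprS mulrCA.
Qed.

Lemma is_derive_Re_texp N z (s : R) :
  is_derive s 1 (fun s : R => complex.Re (texp N.+1 (s%:C * z)))
                (complex.Re (z * texp N (s%:C * z))).
Proof.
rewrite (_ : (fun _ => _) = (fun s : R =>
    \sum_(m < N.+1) s ^+ m * complex.Re ((m`!%:R)^-1 * z ^+ m))); last first.
  by apply/funext => x; rewrite texp_ray cRe_sum; apply: eq_bigr => i _; rewrite cReMr.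
rewrite (_ : complex.Re _ = \sum_(m < N)
    s ^+ m * (m.+1%:R * complex.Re ((m.+1`!%:R)^-1 * z ^+ m.+1))).
  exact: (@is_derive_power_sum (fun m => complex.Re ((m`!%:R)^-1 * z ^+ m))).
rewrite texp_ray mulr_sumr cRe_sum; apply: eq_bigr => i _.
by rewrite -cReMr texp_coef_shift mulrCA cReMr.
Qed.

Lemma is_derive_Im_texp N z (s : R) :
  is_derive s 1 (fun s : R => complex.Im (texp N.+1 (s%:C * z)))
                (complex.Im (z * texp N (s%:C * z))).
Proof.
rewrite (_ : (fun _ => _) = (fun s : R =>
    \sum_(m < N.+1) s ^+ m * complex.Im ((m`!%:R)^-1 * z ^+ m))); last first.
  by apply/funext => x; rewrite texp_ray cIm_sum; apply: eq_bigr => i _; rewrite cImMr.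
rewrite (_ : complex.Im _ = \sum_(m < N)
    s ^+ m * (m.+1%:R * complex.Im ((m.+1`!%:R)^-1 * z ^+ m.+1))).
  exact: (@is_derive_power_sum (fun m => complex.Im ((m`!%:R)^-1 * z ^+ m))).
rewrite texp_ray mulr_sumr cIm_sum; apply: eq_bigr => i _.
by rewrite -cImMr texp_coef_shift mulrCA cImMr.
Qed.

(** On the ray s z, the remainder of order N + 1 has for derivative z times the
    remainder of order N, so that [complex_MVT] gives the induction step; its
    factor 2 accumulates to 2 ^ N. *)
Lemma normc_cexp_sub_texp N z : nc (cexp z - texp N z) <= (2 * nc z) ^+ N * expR (nc z).
Proof.
have key (t : R) : 0 <= t -> forall s, 0 <= s <= t ->
    nc (cexp (s%:C * z) - texp N (s%:C * z)) <= (2 * s * nc z) ^+ N * expR (t * nc z).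
  move=> t0; elim: N => [|N IH] s /andP[s0 st].
    rewrite /texp big_ord0 subr0 expr0 mul1r (le_trans (normc_cexp_le _))//.
    by rewrite ler_expR Normc.normcM normcR ger0_norm// ler_wpM2r// normc_ge0.
  have := @complex_MVT (fun s : R => cexp (s%:C * z) - texp N.+1 (s%:C * z))
    (fun s : R => z * (cexp (s%:C * z) - texp N (s%:C * z)))
    (nc z * ((2 * s * nc z) ^+ N * expR (t * nc z))) s s0.
  rewrite mul0r cexp0 texp0S subrr subr0 => mvt.
  apply: le_trans (mvt _ _ _) _.
  - move=> u; rewrite (_ : (fun _ => _) = (fun s : R => complex.Re (cexp (s%:C * z)))
       - (fun s : R => complex.Re (texp N.+1 (s%:C * z)))); last first.
      by apply/funext => x; rewrite cReD cReN.
    rewrite mulrBr cReD cReN; apply: is_deriveB.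
      exact: is_derive_Re_cexp.
    exact: is_derive_Re_texp.
  - move=> u; rewrite (_ : (fun _ => _) = (fun s : R => complex.Im (cexp (s%:C * z)))
       - (fun s : R => complex.Im (texp N.+1 (s%:C * z)))); last first.
      by apply/funext => x; rewrite cImD cImN.
    rewrite mulrBr cImD cImN; apply: is_deriveB.
      exact: is_derive_Im_cexp.
    exact: is_derive_Im_texp.
  - move=> u /andP[u0 us]; rewrite Normc.normcM ler_wpM2l ?normc_ge0//.
    apply: le_trans (IH _ _) _; first by rewrite u0 (le_trans us).
    rewrite ler_wpM2r ?expR_ge0// lerXn2r ?nnegrE ?mulr_ge0 ?normc_ge0//.
    by rewrite ler_wpM2r ?normc_ge0// ler_wpM2l.
  - by rewrite exprS !mulrA.
have := key 1 ler01 1 _; rewrite ler01 lexx => /(_ isT).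
by rewrite !mul1r mulr1.
Qed.

Lemma texp1 z : texp 1 z = 1.
Proof. by rewrite /texp big_ord1 expr0 fact0 invr1 mulr1. Qed.

End exponential_remainder.

(** * Truncated exponentials of polynomials *)

Section formal_exponential.

Section coefficients.
Variable C : comNzRingType.
Implicit Types (z : nat -> C) (N m j : nat).

Definition lowpoly z N : {poly C} := \sum_(1 <= i < N.+1) (z i)%:P * 'X^i.

Lemma lowpoly_split z j N : (j <= N)%N ->
  exists q, lowpoly z N = lowpoly z j + 'X^(j.+1) * q.
Proof.
move=> jN; exists (\sum_(j.+1 <= i < N.+1) (z i)%:P * 'X^(i - j.+1)).
rewrite /lowpoly (@big_cat_nat _ _ _ j.+1)//=; congr (_ + _).
rewrite mulr_sumr; apply: eq_big_nat => i /andP[ji _].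
by rewrite mulrCA -exprD subnKC.
Qed.

(** The two polynomials agree modulo 'X^(j + 1), and so do their powers. *)
Lemma lowpolyX_coef z j N m : (j <= N)%N ->
  (lowpoly z N ^+ m)`_j = (lowpoly z j ^+ m)`_j.
Proof.
move=> jN; have [q ->] := lowpoly_split z jN.
have -> : (lowpoly z j + 'X^(j.+1) * q) ^+ m =
    lowpoly z j ^+ m + 'X^(j.+1) * (q * \sum_(i < m)
      (lowpoly z j + 'X^(j.+1) * q) ^+ (m.-1 - i) * lowpoly z j ^+ i).
  rewrite -[LHS](subrK (lowpoly z j ^+ m)) subrXX.
  by rewrite addrC [_ + _ - _]addrAC subrr add0r mulrA.
by rewrite coefD coefXnM ltnSn addr0.
Qed.

Lemma lowpolyX_coef0 z j N m : (j < m)%N -> (lowpoly z N ^+ m)`_j = 0.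
Proof.
move=> jm; have -> : lowpoly z N = 'X * \sum_(1 <= i < N.+1) (z i)%:P * 'X^(i.-1).
  rewrite mulr_sumr; apply: eq_big_nat => i /andP[i1 _].
  by rewrite mulrCA -exprS prednK.
by rewrite exprMn coefXnM jm.
Qed.

Lemma horner_lowpoly z N t : (lowpoly z N).[t] = \sum_(1 <= i < N.+1) z i * t ^+ i.
Proof.
by rewrite /lowpoly horner_sum; apply: eq_bigr => i _; rewrite hornerM hornerC hornerXn.
Qed.

End coefficients.

(** Stands for exp (sum_(i >= 1) z i 'X^i), with which it agrees in degrees at
    most N ([exppoly_coef]). *)
Definition exppoly (C : fieldType) (z : nat -> C) N : {poly C} :=
  \sum_(m < N.+1) (m`!%:R)^-1 *: lowpoly z N ^+ m.

Lemma exppoly_coef (C : fieldType) (z : nat -> C) j N : (j <= N)%N ->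
  (exppoly z N)`_j = (exppoly z j)`_j.
Proof.
move=> jN; rewrite !coef_sum.
rewrite -(big_mkord xpredT (fun m => ((m`!%:R)^-1 *: lowpoly z N ^+ m)`_j)).
rewrite -(big_mkord xpredT (fun m => ((m`!%:R)^-1 *: lowpoly z j ^+ m)`_j)).
rewrite (@big_cat_nat _ _ _ j.+1)//= [X in _ + X]big_nat_cond [X in _ + X]big1 ?addr0.
  by apply: eq_big_nat => m _; rewrite !coefZ lowpolyX_coef.
by move=> m /andP[/andP[jm _] _]; rewrite coefZ lowpolyX_coef0// mulr0.
Qed.

End formal_exponential.

Section domination.
Variable R : realType.
Implicit Types (p q : {poly R[i]}) (P Q : {poly R}).

(** Majorants reduce estimates of complex power sums to the evaluation of a real
    polynomial at 1. *)
Definition dominated p P := forall i, nc p`_i <= P`_i.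

Lemma dominatedD p q P Q : dominated p P -> dominated q Q -> dominated (p + q) (P + Q).
Proof.
by move=> pP qQ i; rewrite !coefD (le_trans (le_normcD _ _))// lerD.
Qed.

Lemma dominatedM p q P Q : dominated p P -> dominated q Q -> dominated (p * q) (P * Q).
Proof.
move=> pP qQ i; rewrite !coefM (le_trans (normc_sum _ _ _))// ler_sum// => k _.
by rewrite Normc.normcM ler_pM ?normc_ge0.
Qed.

Lemma dominated1 : dominated 1 1.
Proof. by move=> i; rewrite !coef1; case: eqP; rewrite ?Normc.normc1 ?Normc.normc0. Qed.

Lemma dominatedX p P n : dominated p P -> dominated (p ^+ n) (P ^+ n).
Proof.
move=> pP; elim: n => [|n IH]; first by rewrite !expr0; exact: dominated1.
by rewrite !exprS; exact: dominatedM.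
Qed.

Lemma dominatedZ p P z a : nc z <= a -> dominated p P -> dominated (z *: p) (a *: P).
Proof.
by move=> za pP i; rewrite !coefZ Normc.normcM ler_pM ?normc_ge0.
Qed.

Lemma dominated_sum (I : Type) (s : seq I) (A : pred I) (p : I -> {poly R[i]}) (P : I -> {poly R}) :
  (forall i, A i -> dominated (p i) (P i)) ->
  dominated (\sum_(i <- s | A i) p i) (\sum_(i <- s | A i) P i).
Proof.
move=> pP; elim/big_ind2: _ => [i|? ? ? ?|//]; last exact: dominatedD.
by rewrite !coef0 Normc.normc0.
Qed.

Lemma dominated_monom z a i : nc z <= a -> dominated (z%:P * 'X^i) (a%:P * 'X^i).
Proof.
move=> za k; rewrite !mul_polyC !coefZ !coefXn Normc.normcM.
by case: eqP => _; rewrite ?Normc.normc1 ?Normc.normc0 ?mulr1// !mulr0.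
Qed.

Lemma horner_coef_le p (t : R[i]) n : nc t <= 1 -> forall P, dominated p P ->
  nc (\sum_(j < n) p`_j * t ^+ j) <= P.[1].
Proof.
move=> t1 P pP; apply: le_trans (normc_sum _ _ _) _.
have P0 i : 0 <= P`_i by apply: le_trans (pP i); exact: normc_ge0.
rewrite (@horner_coef_wide _ (maxn n (size P))) ?leq_maxr//.
rewrite -(big_mkord xpredT (fun j => nc (p`_j * t ^+ j))).
rewrite -(big_mkord xpredT (fun j => P`_j * 1 ^+ j)).
rewrite [leRHS](@big_cat_nat _ _ _ n) ?leq_maxl//= ler_wpDr//.
  by apply: sumr_ge0 => i _; rewrite expr1n mulr1.
apply: ler_sum => i _; rewrite Normc.normcM normcX expr1n mulr1.
rewrite -[leRHS]mulr1; apply: ler_pM; rewrite ?exprn_ge0 ?normc_ge0 ?pP//.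
by rewrite exprn_ile1 ?normc_ge0.
Qed.

(** Every omitted monomial has degree at least n, and nc t <= 1. *)
Lemma horner_trunc_le p P (t : R[i]) n : nc t <= 1 -> dominated p P ->
  nc (p.[t] - \sum_(j < n) p`_j * t ^+ j) <= nc t ^+ n * P.[1].
Proof.
move=> t1 pP.
have P0 i : 0 <= P`_i by apply: le_trans (pP i); exact: normc_ge0.
set k := maxn n (maxn (size p) (size P)).
have nk : (n <= k)%N by rewrite leq_maxl.
rewrite (@horner_coef_wide _ k p); last by rewrite !leq_max leqnn orbT.
rewrite (@horner_coef_wide _ k P); last by rewrite !leq_max leqnn !orbT.
rewrite -(big_mkord xpredT (fun j => p`_j * t ^+ j)).
rewrite -(big_mkord xpredT (fun j => p`_j * t ^+ j)).
rewrite -(big_mkord xpredT (fun j => P`_j * 1 ^+ j)).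
rewrite (@big_cat_nat _ _ _ n)//= [_ + _ - _]addrAC subrr add0r.
apply: le_trans (normc_sum _ _ _) _.
rewrite [X in _ <= _ * X](@big_cat_nat _ _ _ n)//= mulrDr ler_wpDl//.
  by rewrite mulr_ge0 ?exprn_ge0 ?normc_ge0// sumr_ge0// => i _; rewrite expr1n mulr1.
rewrite mulr_sumr; apply: ler_sum_nat => i /andP[ni _].
rewrite Normc.normcM normcX expr1n mulr1 mulrC ler_pM ?exprn_ge0 ?normc_ge0 ?pP//.
by rewrite ler_wiXn2l ?normc_ge0.
Qed.

End domination.

Section truncated_exponential.
Variable R : realType.
Implicit Types (z : nat -> R[i]) (t : R[i]) (B : R).

Definition trunc_const (N : nat) : R := \sum_(m < N.+1) N%:R ^+ m.

(** The argument of the exponential is dominated by B ('X + ... + 'X^N), whose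
    value at 1 is N B. *)
Lemma dominated_exppoly z N B : 1 <= B ->
  (forall i, (1 <= i <= N)%N -> nc (z i) <= B) ->
  exists2 P, dominated (exppoly z N) P & P.[1] <= trunc_const N * B ^+ N.
Proof.
move=> B1 zB; have B0 : 0 <= B by rewrite (le_trans _ B1).
pose S : {poly R} := \sum_(1 <= i < N.+1) B%:P * 'X^i.
have dS : dominated (lowpoly z N) S.
  rewrite /S /lowpoly big_nat_cond [X in dominated _ X]big_nat_cond.
  apply: dominated_sum => i /andP[iN _].
  exact/dominated_monom/zB.
have S1 : S.[1] = N%:R * B.
  rewrite horner_sum (eq_bigr (fun=> B)); last first.
    by move=> i _; rewrite hornerM hornerC hornerXn expr1n mulr1.
  by rewrite big_const_nat iter_addr_0 subn1 /= mulr_natl.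
exists (\sum_(m < N.+1) 1 *: S ^+ m).
  apply: dominated_sum => m _; apply: dominatedZ; last exact: dominatedX.
  rewrite Normc.normcV normc_nat invf_le1 ?ler1n ?fact_gt0//.
rewrite horner_sum mulr_suml ler_sum// => m _.
rewrite scale1r horner_exp S1 exprMn ler_wpM2l ?exprn_ge0//.
by rewrite ler_weXn2l// -ltnS.
Qed.

Lemma trunc_const_ge0 N : 0 <= trunc_const N.
Proof. by apply: sumr_ge0 => i _; rewrite exprn_ge0. Qed.

Lemma normc_exppoly_trunc_le z N B t : 1 <= B -> nc t <= 1 ->
  (forall i, (1 <= i <= N)%N -> nc (z i) <= B) ->
  nc (\sum_(j < N.+1) (exppoly z N)`_j * t ^+ j) <= trunc_const N * B ^+ N.
Proof.
move=> B1 t1 zB; have [P dP P1] := dominated_exppoly B1 zB.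
exact: le_trans (horner_coef_le _ t1 dP) P1.
Qed.

Definition expansion_const (N : nat) : R := (2 * N%:R) ^+ N.+1 + trunc_const N.

(** The exponential is first replaced by its Taylor polynomial of degree N, in
    which the monomials of degree more than N in t are then dropped. The bound is
    polynomial in B because the coefficients will grow like a power of the
    integration variable, to be absorbed by a Gaussian. *)
Lemma cexp_trunc z N B t : 1 <= B -> nc t <= 1 ->
  (forall i, (1 <= i <= N)%N -> nc (z i) <= B) ->
  nc (cexp (\sum_(1 <= i < N.+1) z i * t ^+ i)
      - \sum_(j < N.+1) (exppoly z N)`_j * t ^+ j)
  <= expansion_const N * B ^+ N.+1 * nc t ^+ N.+1
     * expR (nc (\sum_(1 <= i < N.+1) z i * t ^+ i)).
Proof.
move=> B1 t1 zB; have B0 : 0 <= B by rewrite (le_trans _ B1).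
set Z := \sum_(1 <= i < N.+1) _.
have [P dP P1] := dominated_exppoly B1 zB.
have EZ : (exppoly z N).[t] = texp N.+1 Z.
  rewrite horner_sum; apply: eq_bigr => m _.
  by rewrite hornerZ horner_exp horner_lowpoly.
have Zle : nc Z <= N%:R * B * nc t.
  apply: le_trans (normc_sum _ _ _) _.
  rewrite (_ : N%:R * B * nc t = \sum_(1 <= i < N.+1) B * nc t); last first.
    by rewrite big_const_nat iter_addr_0 subn1 /= -mulrA mulr_natl.
  apply: ler_sum_nat => i /andP[i0 iN].
  rewrite Normc.normcM normcX ler_pM ?exprn_ge0 ?normc_ge0 ?zB ?i0//.
  by rewrite -[leRHS]expr1 ler_wiXn2l ?normc_ge0.
rewrite -(subrK (texp N.+1 Z) (cexp Z)) -addrA.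
apply: le_trans (le_normcD _ _) _.
rewrite /expansion_const -!mulrA [leRHS]mulrDl !mulrA; apply: lerD.
- apply: le_trans (normc_cexp_sub_texp _ _) _.
  rewrite ler_wpM2r ?expR_ge0// -!exprMn lerXn2r ?nnegrE ?mulr_ge0 ?normc_ge0//.
  by rewrite -!mulrA ler_wpM2l// mulrA.
- rewrite -EZ; apply: le_trans (horner_trunc_le _ t1 dP) _.
  rewrite mulrC -[leLHS]mulr1; apply: ler_pM => //.
  + by rewrite mulr_ge0 ?exprn_ge0 ?normc_ge0// (le_trans _ (horner_coef_le 0 t1 dP)) ?normc_ge0.
  + rewrite ler_wpM2r ?exprn_ge0 ?normc_ge0// (le_trans P1)// ler_wpM2l ?trunc_const_ge0//.
    by rewrite ler_weXn2l.
  + by rewrite -expR0 ler_expR normc_ge0.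
Qed.

End truncated_exponential.

Section bell_evaluation.
Variable R : realType.

(** At z = -is this is the symbol of the differential operator p(d/dx). *)
Definition evalc (z : R[i]) : {poly R} -> R[i] :=
  horner_eval z \o map_poly (real_complex R).

HB.instance Definition _ z := GRing.RMorphism.copy (evalc z)
  (horner_eval z \o map_poly (real_complex R)).

Lemma evalcZ z a p : evalc z (a *: p) = a%:C * evalc z p.
Proof. by rewrite /evalc /= map_polyZ /horner_eval hornerZ. Qed.

Lemma evalcD z p q : evalc z (p + q) = evalc z p + evalc z q.
Proof. exact: rmorphD. Qed.

Lemma evalcM z p q : evalc z (p * q) = evalc z p * evalc z q.
Proof. exact: rmorphM. Qed.

Lemma evalc1 z : evalc z 1 = 1.
Proof. exact: rmorph1. Qed.

Lemma evalcX z : evalc z 'X = z.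
Proof. by rewrite /evalc /= map_polyX /horner_eval hornerX. Qed.

Lemma evalcE z p : evalc z p = \sum_(i < size p) (p`_i)%:C * z ^+ i.
Proof.
rewrite /evalc /= /horner_eval horner_coef size_map_poly.
by apply: eq_bigr => i _; rewrite coef_map.
Qed.

(** Bell polynomials commute with ring morphisms, and those of complex numbers
    are coefficients of a formal exponential. *)
Lemma evalc_complete_bell z (D : nat -> {poly R}) j :
  evalc z (complete_bell j D) =
  j`!%:R * (exppoly (fun i => (i`!%:R)^-1 * evalc z (D i)) j)`_j.
Proof.
rewrite /complete_bell evalcZ rmorph_nat; congr (_ * _).
rewrite rmorph_sum coef_sum; apply: eq_bigr => m _.
rewrite /= evalcZ coefZ fmorphV rmorph_nat; congr (_ * _).
rewrite -(coef_map (evalc z)) rmorphXn rmorph_sum.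
congr (polyseq (_ ^+ _))`_ _.
apply: eq_bigr => i _; rewrite rmorphM /= map_polyXn map_polyC /= evalcZ.
by rewrite fmorphV rmorph_nat.
Qed.

End bell_evaluation.

(** * The Gaussian and its Fourier transform *)

Section complex_continuity.
Variable R : realType.

Definition ccontinuous (f : R -> R[i]) :=
  continuous (fun u => complex.Re (f u)) /\ continuous (fun u => complex.Im (f u)).

Lemma ccontinuous_cst z : ccontinuous (fun=> z).
Proof. by split=> u; exact: cvg_cst. Qed.

Lemma ccontinuousD f g : ccontinuous f -> ccontinuous g ->
  ccontinuous (fun u => f u + g u).
Proof.
move=> [f1 f2] [g1 g2]; split=> u.
- by under eq_fun do rewrite cReD; apply: cvgD; [exact: f1|exact: g1].
- by under eq_fun do rewrite cImD; apply: cvgD; [exact: f2|exact: g2].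
Qed.

Lemma ccontinuousM f g : ccontinuous f -> ccontinuous g ->
  ccontinuous (fun u => f u * g u).
Proof.
move=> [f1 f2] [g1 g2]; split=> u.
- under eq_fun do rewrite cReM.
  by apply: cvgB; apply: cvgM; [exact: f1|exact: g1|exact: f2|exact: g2].
- under eq_fun do rewrite cImM.
  by apply: cvgD; apply: cvgM; [exact: f1|exact: g2|exact: f2|exact: g1].
Qed.

Lemma ccontinuousX f n : ccontinuous f -> ccontinuous (fun u => f u ^+ n).
Proof.
move=> cf; elim: n => [|n IH]; first exact: ccontinuous_cst.
rewrite (_ : (fun _ => _) = fun u => f u * f u ^+ n); first exact: ccontinuousM.
by apply/funext => u; rewrite exprS.
Qed.

Lemma ccontinuous_sum (I : Type) (s : seq I) (Q : pred I) (f : I -> R -> R[i]) :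
  (forall i, ccontinuous (f i)) -> ccontinuous (fun u => \sum_(i <- s | Q i) f i u).
Proof.
move=> cf; elim: s => [|i s IH].
  rewrite (_ : (fun _ => _) = fun=> 0); first exact: ccontinuous_cst.
  by apply/funext => u; rewrite big_nil.
case: (boolP (Q i)) => Qi.
  rewrite (_ : (fun _ => _) = fun u => f i u + \sum_(j <- s | Q j) f j u).
    exact: ccontinuousD.
  by apply/funext => u; rewrite big_cons Qi.
rewrite (_ : (fun _ => _) = fun u => \sum_(j <- s | Q j) f j u)//.
by apply/funext => u; rewrite big_cons (negbTE Qi).
Qed.

Lemma ccontinuous_cexp f : ccontinuous f -> ccontinuous (fun u => cexp (f u)).
Proof.
move=> [f1 f2]; split=> u /=.
- apply: cvgM; first by apply: continuous_comp; [exact: f1|exact: continuous_expR].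
  by apply: continuous_comp; [exact: f2|exact: continuous_cos].
- apply: cvgM; first by apply: continuous_comp; [exact: f1|exact: continuous_expR].
  by apply: continuous_comp; [exact: f2|exact: continuous_sin].
Qed.

Lemma ccontinuous_Complex (f g : R -> R) : continuous f -> continuous g ->
  ccontinuous (fun u => f u +i* g u).
Proof. by split. Qed.

End complex_continuity.

Section exponential_tails.
Variable R : realType.
Local Notation leb := (@lebesgue_measure R).

Lemma exprn_fact_le (x : R) n : 0 <= x -> x ^+ n <= n`!%:R * expR x.
Proof.
move=> x0; case: n => [|n].
  by rewrite expr0 fact0 mul1r -expR0 ler_expR.
rewrite mulrC -ler_pdivrMr ?ltr0n ?fact_gt0//.
by apply: le_trans (expR_ge1Dxn n x0); rewrite lerDr.
Qed.

(** Completing the square, 1 + s - s^2/4 <= 5 - s. The rate s^2/4 instead of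
    s^2/2 leaves room for a factor e^(s^2/16) in the integrands. *)
Lemma gauss_moment_le (s : R) n : 0 <= s ->
  (1 + s) ^+ n * expR (- (s ^+ 2 / 4)) <= n`!%:R * expR 5 * expR (- s).
Proof.
move=> s0; apply: le_trans (_ : n`!%:R * expR (1 + s) * expR (- (s ^+ 2 / 4)) <= _).
  by rewrite ler_wpM2r ?expR_ge0// exprn_fact_le// addr_ge0.
rewrite -!mulrA ler_wpM2l// -!expRD ler_expR.
have := sqr_ge0 (s / 2 - 2); nra.
Qed.

Lemma continuous_expRN : continuous (fun s : R => expR (- s)).
Proof.
move=> s; apply: (@continuous_comp _ _ _ (fun s : R => - s) expR).
  exact: opp_continuous.
exact: continuous_expR.
Qed.

Lemma integral_expRN (a : R) :
  (\int[leb]_(s in `[a, +oo[) (expR (- s))%:E = (expR (- a))%:E)%E.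
Proof.
have dF (s : R) : is_derive s 1 (fun s : R => - expR (- s)) (expR (- s)).
  by apply: is_derive_eq; rewrite /GRing.scale /=; ring.
rewrite (@ge0_continuous_FTC2y R (fun s => expR (- s)) (fun s => - expR (- s)) a 0).
- by rewrite sub0e -EFinN opprK.
- by move=> x _; exact: expR_ge0.
- by apply: continuous_subspaceT; exact: continuous_expRN.
- by rewrite -oppr0; apply: cvgN; exact: cvgr_expR.
- by move=> x _; exact: ex_derive.
- apply: cvg_at_right_filter; apply: cvgN; exact: continuous_expRN.
- by move=> x _; rewrite derive1E; exact: derive_val.
Qed.

Lemma integrable_expRN (a : R) :
  leb.-integrable `[a, +oo[ (EFin \o (fun s : R => expR (- s))).
Proof.
apply/integrableP; split.
  apply/measurable_EFinP; apply: measurable_funTS.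
  by apply: continuous_measurable_fun; exact: continuous_expRN.
rewrite (_ : (fun _ => _) = fun s => (expR (- s))%:E).
  by rewrite integral_expRN ltry.
by apply/funext => s /=; rewrite ger0_norm ?expR_ge0.
Qed.

Variables (h : R -> R) (C : R).
Hypothesis mh : measurable_fun [set: R] h.
Hypothesis hC : forall s, 0 <= s -> `|h s| <= C * expR (- s).

Lemma integrable_expdom : leb.-integrable `[0, +oo[ (EFin \o h).
Proof.
have C0 : 0 <= C.
  by have := le_trans (normr_ge0 _) (hC (lexx 0)); rewrite oppr0 expR0 mulr1.
have ig : leb.-integrable `[0, +oo[ (EFin \o (fun s : R => C * expR (- s))).
  rewrite (_ : _ \o _ = fun s => C%:E * (expR (- s))%:E)%E//.
  by apply: integrableZl => //; exact: integrable_expRN.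
apply: (le_integrable _ _ _ ig) => //.
- by apply/measurable_EFinP; exact: measurable_funTS.
- move=> s; rewrite /= in_itv/= andbT => s0.
  by rewrite lee_fin (le_trans (hC s0))// ler_norm.
Qed.

Lemma Rintegral_expdom_tail (A : R) : 0 <= A ->
  `|\int[leb]_(s in `[0, +oo[) h s - \int[leb]_(s in `[0, A]) h s| <= C * expR (- A).
Proof.
move=> A0.
have iA : leb.-integrable `]A, +oo[ (EFin \o h).
  apply: integrableS integrable_expdom => // s.
  by rewrite /= !in_itv /= !andbT => /ltW; exact: le_trans.
have eA : leb.-integrable `]A, +oo[ (EFin \o (fun s : R => expR (- s))).
  apply: integrableS (integrable_expRN A) => // s.
  by rewrite /= !in_itv /= !andbT => /ltW.
rewrite Rintegral_itvB ?integrable_expdom ?bnd_simp//.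
apply: le_trans (le_normr_Rintegral _ iA) _ => //.
apply: le_trans (_ : \int[leb]_(s in `]A, +oo[) (C * expR (- s)) <= _).
  apply: le_Rintegral => //.
  - exact: integrable_norm.
  - rewrite (_ : _ \o _ = fun s => C%:E * (expR (- s))%:E)%E//.
    exact: integrableZl.
  - by move=> s; rewrite /= in_itv /= andbT => /ltW As; apply: hC; exact: le_trans As.
rewrite RintegralZl// Rintegral_itv_obnd_cbnd//.
by rewrite /Rintegral integral_expRN.
Qed.

Lemma Rintegral_expdom_le : `|\int[leb]_(s in `[0, +oo[) h s| <= C.
Proof.
have := Rintegral_expdom_tail (lexx 0).
by rewrite set_itv1 Rintegral_set1 subr0 oppr0 expR0 mulr1.
Qed.

End exponential_tails.

Section gaussian_transform.
Variable R : realType.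
Local Notation leb := (@lebesgue_measure R).
Implicit Types (x s : R) (m : nat).

Definition gexp s : R := expR (- (s ^+ 2 / 2)).

(** The point -is at which symbols are evaluated. *)
Definition freq s : R[i] := 0 -i* s.

(** Its integral over s >= 0 is, up to a constant, p(d/dx) e^(-x^2/2): taking real
    parts accounts for the frequencies s < 0. *)
Definition gkernel (p : {poly R}) x s : R :=
  complex.Re (evalc (freq s) p * cexp (x%:C * freq s)) * gexp s.

Lemma normc_freq s : nc (freq s) = `|s|.
Proof. by rewrite /= expr0n/= add0r sqrrN sqrtr_sqr. Qed.

Lemma normc_cexp_freq x s : nc (cexp (x%:C * freq s)) = 1.
Proof. by rewrite normc_cexp cReMr /= mulr0 expR0. Qed.

Lemma continuous_gexp : continuous gexp.
Proof.
move=> s; apply: (@continuous_comp _ _ _ (fun s : R => - (s ^+ 2 / 2)) expR).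
  apply: cvgN; apply: cvgMl; exact: exprn_continuous.
exact: continuous_expR.
Qed.

Lemma ccontinuous_freq : ccontinuous freq.
Proof.
split => s /=; first exact: cvg_cst.
exact: opp_continuous.
Qed.

Lemma ccontinuous_evalc_freq p : ccontinuous (fun s => evalc (freq s) p).
Proof.
rewrite (_ : (fun _ => _) = fun s => \sum_(i < size p) (p`_i)%:C * freq s ^+ i).
  apply: ccontinuous_sum => i; apply: ccontinuousM; first exact: ccontinuous_cst.
  exact/ccontinuousX/ccontinuous_freq.
by apply/funext => s; rewrite evalcE.
Qed.

Lemma ccontinuous_cexp_freq x : ccontinuous (fun s => cexp (x%:C * freq s)).
Proof.
apply: ccontinuous_cexp; apply: ccontinuousM; first exact: ccontinuous_cst.
exact: ccontinuous_freq.
Qed.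

Lemma continuous_gkernel p x : continuous (gkernel p x).
Proof.
move=> s; apply: cvgM; last exact: continuous_gexp.
have [+ _] := ccontinuousM (ccontinuous_evalc_freq p) (ccontinuous_cexp_freq x).
exact.
Qed.

Definition poly_bound (p : {poly R}) : R := \sum_(i < size p) `|p`_i|.

Lemma poly_bound_ge0 p : 0 <= poly_bound p.
Proof. exact: sumr_ge0. Qed.

Lemma normc_evalc_freq p s : 0 <= s ->
  nc (evalc (freq s) p) <= poly_bound p * (1 + s) ^+ size p.
Proof.
move=> s0; rewrite evalcE (le_trans (normc_sum _ _ _))// mulr_suml ler_sum// => i _.
rewrite Normc.normcM normcR normcX normc_freq (ger0_norm s0) ler_wpM2l//.
apply: le_trans (_ : (1 + s) ^+ i <= _).
  by rewrite lerXn2r ?nnegrE ?addr_ge0// lerDr.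
by rewrite ler_weXn2l ?lerDl// ltnW.
Qed.

Lemma gexp_le s n : 0 <= s ->
  (1 + s) ^+ n * gexp s <= n`!%:R * expR 5 * expR (- s).
Proof.
move=> s0; apply: le_trans (gauss_moment_le n s0).
rewrite ler_wpM2l ?exprn_ge0 ?addr_ge0// ler_expR lerN2.
have := sqr_ge0 s; lra.
Qed.

Definition gkernel_const p : R := poly_bound p * ((size p)`!%:R * expR 5).

Lemma gkernel_le p x s : 0 <= s -> `|gkernel p x s| <= gkernel_const p * expR (- s).
Proof.
move=> s0; rewrite normrM (ger0_norm (expR_ge0 _)).
apply: le_trans (_ : poly_bound p * (1 + s) ^+ size p * gexp s <= _).
  rewrite ler_wpM2r ?expR_ge0// (le_trans (le_Re_normc _))// Normc.normcM.
  by rewrite normc_cexp_freq mulr1 normc_evalc_freq.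
by rewrite -!mulrA ler_wpM2l ?poly_bound_ge0// mulrA gexp_le.
Qed.

Lemma measurable_gkernel p x : measurable_fun [set: R] (gkernel p x).
Proof. by apply: continuous_measurable_fun; exact: continuous_gkernel. Qed.

Lemma integrable_gkernel p x : leb.-integrable `[0, +oo[ (EFin \o gkernel p x).
Proof.
apply: (@integrable_expdom _ _ (gkernel_const p)).
  exact: measurable_gkernel.
exact: gkernel_le.
Qed.

Definition gtransform p x : R := \int[leb]_(s in `[0, +oo[) gkernel p x s.

(** Differentiating e^(-isx) in x produces the factor -is, the value of 'X. *)
Lemma is_derive_gkernel p x s :
  is_derive x 1 (fun x => gkernel p x s) (gkernel ('X * p) x s).
Proof.
set q := evalc (freq s) p.
rewrite (_ : (fun _ => _) =
    (fun x => complex.Re q * gexp s * complex.Re (cexp (x%:C * freq s))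
            - complex.Im q * gexp s * complex.Im (cexp (x%:C * freq s)))); last first.
  by apply/funext => y; rewrite /gkernel cReM -/q; ring.
have dR := is_derive_Re_cexp (freq s) x.
have dI := is_derive_Im_cexp (freq s) x.
rewrite (_ : gkernel _ _ _ =
  (complex.Re q * gexp s) *: complex.Re (freq s * cexp (x%:C * freq s)) -
  (complex.Im q * gexp s) *: complex.Im (freq s * cexp (x%:C * freq s))).
  by apply: is_deriveB; apply: is_deriveZ.
rewrite /gkernel evalcM evalcX -/q {dR dI}.
move: (cexp _) => [a b]; move: q => [c d]; rewrite /GRing.scale /=; ring.
Qed.

Lemma is_derive_gtransform p x :
  is_derive x 1 (gtransform p) (gtransform ('X * p) x).
Proof.
have Ix : `]x - 1, x + 1[%classic x by rewrite /= in_itv /= ltrBlDr ltrDl ltr01.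
have H1 (y : R) : `]x - 1, x + 1[%classic y ->
  leb.-integrable `[0, +oo[ (EFin \o gkernel p y) by move=> _; exact: integrable_gkernel.
have H2 (y s : R) : `]x - 1, x + 1[%classic y -> `[0, +oo[%classic s ->
  derivable (fun x => gkernel p x s) y 1.
  by move=> _ _; have := is_derive_gkernel p y s => ?; exact: ex_derive.
have d1E (y s : R) : partial1of2 (gkernel p) y s = gkernel ('X * p) y s.
  by rewrite partial1of2E; have := is_derive_gkernel p y s => ?; exact: derive_val.
pose C := gkernel_const ('X * p).
have C0 : 0 <= C by rewrite !mulr_ge0 ?poly_bound_ge0 ?expR_ge0.
pose G s := C * expR (- s).
have G0 (s : R) : 0 <= G s by rewrite mulr_ge0 ?expR_ge0.
have iG : leb.-integrable `[0, +oo[ (EFin \o G).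
  apply: (@integrable_expdom _ _ C) => [|s s0]; last by rewrite ger0_norm ?G0.
  by apply: measurable_funM => //; apply: continuous_measurable_fun; exact: continuous_expRN.
have H3 (y s : R) : `]x - 1, x + 1[%classic y -> `[0, +oo[%classic s ->
    `|partial1of2 (gkernel p) y s| <= G s.
  by move=> _; rewrite /= in_itv /= andbT d1E => s0; exact: gkernel_le.
apply: DeriveDef.
  exact: (derivable_under_integral _ Ix H1 H2 G0 iG H3).
rewrite -derive1E (differentiation_under_integral _ Ix H1 H2 G0 iG H3)//.
by apply: eq_Rintegral => s _; rewrite d1E.
Qed.

Lemma gkernelD p q x s : gkernel (p + q) x s = gkernel p x s + gkernel q x s.
Proof. by rewrite /gkernel evalcD mulrDl cReD mulrDl. Qed.

Lemma gkernelZ a p x s : gkernel (a *: p) x s = a * gkernel p x s.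
Proof. by rewrite /gkernel evalcZ -mulrA cReMr mulrA. Qed.

Lemma gtransformD p q x : gtransform (p + q) x = gtransform p x + gtransform q x.
Proof.
rewrite /gtransform -RintegralD//; try exact: integrable_gkernel.
by apply: eq_Rintegral => s _; rewrite gkernelD.
Qed.

Lemma gtransformZ a p x : gtransform (a *: p) x = a * gtransform p x.
Proof.
rewrite /gtransform -RintegralZl//; last exact: integrable_gkernel.
by apply: eq_Rintegral => s _; rewrite gkernelZ.
Qed.

Lemma is_derive_expR_horner (p : {poly R}) (y : R) :
  is_derive y 1 (fun z : R => expR p.[z]) (p^`().[y] * expR p.[y]).
Proof. by rewrite mulrC; apply: is_derive1_comp. Qed.

Lemma is_derive_gexp s : is_derive s 1 gexp (- s * gexp s).
Proof.
rewrite (_ : gexp = fun z : R => expR (- 2^-1 *: 'X^2).[z]); last first.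
  by apply/funext => z; rewrite /gexp hornerZ hornerXn mulNr mulrC.
rewrite (_ : - s = (- 2^-1 *: 'X^2 : {poly R})^`().[s]).
  exact: is_derive_expR_horner.
rewrite derivZ derivXn hornerZ hornerMn hornerXn /= expr1.
by rewrite mulr2n; field.
Qed.

Lemma cexp_freq x s : cexp (x%:C * freq s) = cos (x * s) -i* sin (x * s).
Proof.
by rewrite /cexp cReMr cImMr /= mulr0 expR0 mulrN cosN sinN !mul1r.
Qed.

(** The kernel of 'X + x is the derivative in s of sin (x s) e^(-s^2/2), which
    vanishes at 0 and at infinity. *)
Lemma gtransform_ode x : gtransform ('X + x%:P) x = 0.
Proof.
pose C := gkernel_const ('X + x%:P).
have C0 : 0 <= C by rewrite !mulr_ge0 ?poly_bound_ge0 ?expR_ge0.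
have dH s : is_derive s 1 (fun s => sin (x * s) * gexp s) (gkernel ('X + x%:P) x s).
  have dG := is_derive_gexp s.
  have dS : is_derive s 1 (fun s : R => sin (x * s)) (x * cos (x * s)).
    by apply: is_derive_eq; rewrite /GRing.scale /=; ring.
  rewrite (_ : gkernel _ _ _ = sin (x * s) *: (- s * gexp s)
      + gexp s *: (x * cos (x * s))); first exact: is_deriveM.
  rewrite /gkernel evalcD evalcX /evalc /= map_polyC /= /horner_eval hornerC.
  rewrite -/(cexp _) cexp_freq /GRing.scale /=; ring.
have small n : `|gtransform ('X + x%:P) x| <= (C + expR 1) * expR (- n%:R).
  have [->|n0] := posnP n.
    rewrite oppr0 expR0 mulr1 (le_trans (_ : _ <= C)) ?lerDl ?expR_ge0//.
    by apply: Rintegral_expdom_le; [exact: measurable_gkernel|exact: gkernel_le].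
  have n0R : 0 < n%:R :> R by rewrite ltr0n.
  have := @Rintegral_expdom_tail R (gkernel ('X + x%:P) x) C
    (@measurable_gkernel _ _) (@gkernel_le _ _) _ (ltW n0R).
  have -> : \int[leb]_(s in `[0, n%:R]) gkernel ('X + x%:P) x s
      = sin (x * n%:R) * gexp n%:R.
    rewrite /Rintegral (@continuous_FTC2 _ _ (fun s => sin (x * s) * gexp s)) //.
    - by rewrite mulr0 sin0 mul0r sube0.
    - by apply: continuous_subspaceT; exact: continuous_gkernel.
    - have cH : continuous (fun s => sin (x * s) * gexp s).
        move=> s; apply: differentiable_continuous; apply/derivable1_diffP.
        by have := dH s => ?; exact: ex_derive.
      split.
      + by move=> s _; have := dH s => ?; exact: ex_derive.
      + by apply: cvg_at_right_filter; exact: cH.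
      + by apply: cvg_at_left_filter; exact: cH.
    - by move=> s _; rewrite derive1E; have := dH s => ?; exact: derive_val.
  rewrite -/(gtransform _ _) mulrDl => tail.
  rewrite -(subrK (sin (x * n%:R) * gexp n%:R) (gtransform _ _)).
  apply: le_trans (ler_normD _ _) _; apply: lerD => //.
  rewrite normrM (ger0_norm (expR_ge0 _)) -expRD.
  apply: le_trans (_ : 1 * gexp n%:R <= _).
    by rewrite ler_wpM2r ?expR_ge0// ler_norml sin_geN1 sin_le1.
  rewrite mul1r ler_expR; have := sqr_ge0 (n%:R - 1 : R); nra.
apply/eqP; rewrite -normr_le0.
have cv : (C + expR 1) * expR (- n%:R) @[n --> \oo] --> (C + expR 1) * 0.
  apply: cvgM; first exact: cvg_cst.
  exact: (cvg_comp _ _ (@cvgr_idn R) (@cvgr_expR R)).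
rewrite mulr0 in cv.
apply: (ler_cvg_to (cvg_cst _) cv); apply: nearW => n; exact: small.
Qed.

Definition half_gauss : R := Num.sqrt (2 * pi) / 2.

Lemma half_gauss_gt0 : 0 < half_gauss.
Proof. by rewrite divr_gt0// sqrtr_gt0 mulr_gt0 ?pi_gt0. Qed.

Lemma gexp_normal s : gexp s = Num.sqrt (2 * pi) * normal_pdf 0 1 s.
Proof.
rewrite normal_pdfE ?oner_eq0// /normal_peak /normal_fun subr0 !expr1n mul1r.
rewrite -(mulr_natl pi) mulrA divff ?mul1r /gexp ?mulNr//.
by rewrite gt_eqF// sqrtr_gt0 mulr_gt0 ?pi_gt0.
Qed.

(** Half of the Gaussian integral, known from the normalisation of the normal
    density. *)
Lemma gtransform1_0 : gtransform 1 0 = half_gauss.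
Proof.
have kE s : gkernel 1 0 s = gexp s.
  by rewrite /gkernel evalc1 cexp_freq mul0r cos0 sin0 mul1r /= mul1r.
have iT : (\int[leb]_s (gexp s)%:E = (Num.sqrt (2 * pi))%:E)%E.
  under eq_integral do rewrite gexp_normal EFinM.
  rewrite integralZl//; last exact: integrable_normal_pdf.
  by rewrite integral_normal_pdf mule1.
have := @ge0_symfun_integralT R gexp (fun=> expR_ge0 _) continuous_gexp.
rewrite iT => /(_ _)/esym H.
have -> : gtransform 1 0 = fine (\int[leb]_(s in [set x : R | (0 <= x)%R]) (gexp s)%:E)%E.
  rewrite /gtransform /Rintegral; congr fine.
  rewrite (_ : `[0, +oo[%classic = [set x : R | 0 <= x]).
    by apply: eq_integral => s _; rewrite kE.
  by apply/seteqP; split => s /=; rewrite in_itv /= andbT.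
have {H} : (2%:E * (\int[leb]_(s in [set x : R | (0 <= x)%R]) (gexp s)%:E) = (Num.sqrt (2 * pi))%:E)%E.
  by apply: H => s; rewrite /gexp /= sqrrN.
have : (0 <= \int[leb]_(s in [set x : R | (0 <= x)%R]) (gexp s)%:E)%E.
  by apply: integral_ge0 => s _; rewrite lee_fin expR_ge0.
rewrite /half_gauss; case: (\int[leb]_(s in _) _)%E => [v _ [<-]|_|//] /=.
  by rewrite mulrAC divff// mul1r.
by rewrite mulry gtr0_sg// mul1e.
Qed.

(** By [gtransform_ode] it solves y' = - x y. *)
Lemma gtransform1 x : gtransform 1 x = half_gauss * gexp x.
Proof.
have dF (y : R) : is_derive y 1 (gtransform 1) (- y * gtransform 1 y).
  have -> : - y * gtransform 1 y = gtransform ('X * 1) y.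
    have := gtransform_ode y; rewrite gtransformD mulr1 -[y%:P]mulr1 mul_polyC gtransformZ.
    by move/eqP; rewrite addr_eq0 => /eqP ->; rewrite mulNr.
  exact: is_derive_gtransform.
have dE (y : R) : is_derive y 1 (fun y : R => expR (y ^+ 2 / 2)) (y * expR (y ^+ 2 / 2)).
  rewrite (_ : (fun _ => _) = fun z : R => expR (2^-1 *: 'X^2).[z]); last first.
    by apply/funext => z; rewrite hornerZ hornerXn mulrC.
  rewrite [X in is_derive _ _ _ X](_ : _ = (2^-1 *: 'X^2)^`().[y] * expR (2^-1 *: 'X^2).[y]).
    exact: is_derive_expR_horner.
  rewrite derivZ derivXn !hornerZ hornerMn !hornerXn /= expr1.
  by rewrite [2^-1 * _ ^+ _]mulrC mulr2n; field.
have : gtransform 1 x * expR (x ^+ 2 / 2) = gtransform 1 0 * expR (0 ^+ 2 / 2).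
  apply: (@is_derive_0_is_cst _ (fun y => gtransform 1 y * expR (y ^+ 2 / 2))) => y.
  have dFy := dF y; have dEy := dE y.
  rewrite (_ : 0 = gtransform 1 y *: (y * expR (y ^+ 2 / 2)) +
     expR (y ^+ 2 / 2) *: (- y * gtransform 1 y)); first exact: is_deriveM.
  by rewrite /GRing.scale /=; ring.
rewrite gtransform1_0 expr0n /= mul0r expR0 mulr1 => <-.
by rewrite -mulrA -expRD subrr expR0 mulr1.
Qed.

Lemma derive1n_gexp m x : derive1n m gexp x = half_gauss^-1 * gtransform 'X^m x.
Proof.
elim: m x => [|m IH] x.
  by rewrite derive1n0 expr0 gtransform1 mulrA mulVf ?mul1r// gt_eqF// half_gauss_gt0.
rewrite derive1nS (_ : derive1n m gexp = half_gauss^-1 *: gtransform 'X^m); last first.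
  by apply/funext => y; rewrite IH.
rewrite derive1E; have := is_derive_gtransform 'X^m x => dG.
by rewrite deriveZ//= derive_val exprS.
Qed.

(** In the Fourier representation of the Gaussian, constant coefficient
    differential operators act by multiplication by their symbol. *)
Lemma diffop_gexp p x : diffop p gexp x = half_gauss^-1 * gtransform p x.
Proof.
have H n (a : nat -> R) : \sum_(i < n) a i * derive1n i gexp x =
    half_gauss^-1 * gtransform (\sum_(i < n) a i *: 'X^i) x.
  elim: n => [|n IH].
    by rewrite !big_ord0 -(scale0r (0 : {poly R})) gtransformZ mul0r mulr0.
  by rewrite !big_ord_recr /= gtransformD mulrDr gtransformZ IH derive1n_gexp; ring.
by rewrite /diffop H -poly_def coefK.
Qed.

End gaussian_transform.

(** * Taylor expansions of analytic functions at real points *)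

Section complex_limits.
Variables (R : realType) (I : Type) (F : set_system I).
Hypothesis F_filter : Filter F.
Implicit Types (u : I -> R[i]) (l : R[i]).

Lemma cvg_complexP u l : (u : I -> R[i]^o) @ F --> (l : R[i]^o) <->
  (fun n => complex.Re (u n)) @ F --> complex.Re l /\
  (fun n => complex.Im (u n)) @ F --> complex.Im l.
Proof.
split.
- move=> /(@cvgrPdist_lt _ R[i]^o) ul; split; apply/(@cvgrPdist_lt _ R^o) => e e0.
  + have eC : 0 < e%:C by rewrite ltcR.
    apply: filterS (ul _ eC) => n; rewrite normc_def ltcR -cReN -cReD.
    by apply: le_lt_trans; have := le_Re_normc (l - u n); case: (l - u n).
  + have eC : 0 < e%:C by rewrite ltcR.
    apply: filterS (ul _ eC) => n; rewrite normc_def ltcR -cImN -cImD.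
    by apply: le_lt_trans; have := le_Im_normc (l - u n); case: (l - u n).
- move=> [/(@cvgrPdist_lt _ R^o) ur /(@cvgrPdist_lt _ R^o) ui].
  apply/(@cvgrPdist_lt _ R[i]^o) => e e0.
  have [e' e'0 ->] : exists2 e' : R, 0 < e' & e = e'%:C.
    move: e0; case: e => e e1; rewrite ltcE /= => /andP[/eqP -> e0].
    by exists e.
  have h0 : 0 < e' / 2 by rewrite divr_gt0.
  near=> n; rewrite normc_def ltcR.
  apply: le_lt_trans (_ : nc (l - u n) < _); first by case: (l - u n).
  apply: le_lt_trans (normc_le_ReIm _) _.
  rewrite [e'](splitr e') cReD cReN cImD cImN ltrD//.
  + by near: n; exact: ur.
  + by near: n; exact: ui.
Unshelve. all: end_near. Qed.

End complex_limits.

Section geometric_series.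
Variable R : realType.
Implicit Types (a b : nat -> R[i]) (M : R).

(** Componentwise, so that the theory of real series applies. *)
Definition csum a : R[i] :=
  limn (series (fun n => complex.Re (a n))) +i*
  limn (series (fun n => complex.Im (a n))).

Definition geodom a M := forall n, nc (a n) <= M * 2^-1 ^+ n.

Let geo_cvg (v : R ^nat) M : (forall n, `|v n| <= M * 2^-1 ^+ n) ->
  cvgn (series v) /\ `|limn (series v)| <= 2 * M.
Proof.
move=> vM.
have q1 : `|2^-1| < 1 :> R by rewrite ger0_norm ?invf_lt1// ltr1n.
have gc : series (geometric M 2^-1) @ \oo --> M * (1 - 2^-1)^-1.
  exact: cvg_geometric_series.
have nc : cvgn [normed series v].
  apply: (@series_le_cvg _ _ (geometric M 2^-1)) => [n|n|n|] //=.
  - by rewrite (le_trans _ (vM n)).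
  - by apply/cvg_ex; eexists; exact: gc.
split; first exact: normed_cvg.
apply: le_trans (lim_series_norm nc) _.
have -> : 2 * M = limn (series (geometric M 2^-1)).
  by rewrite (cvg_lim _ gc)//; field.
apply: lim_series_le => //; by apply/cvg_ex; eexists; exact: gc.
Qed.

Lemma geodom_cvg a M : geodom a M ->
  cvgn (series (fun n => complex.Re (a n))) /\
  cvgn (series (fun n => complex.Im (a n))).
Proof.
move=> aM; split.
- by apply: (proj1 (@geo_cvg _ M _)) => n; exact: le_trans (le_Re_normc _) (aM n).
- by apply: (proj1 (@geo_cvg _ M _)) => n; exact: le_trans (le_Im_normc _) (aM n).
Qed.

Lemma normc_csum_le a M : geodom a M -> nc (csum a) <= 4 * M.
Proof.
move=> aM; apply: le_trans (normc_le_ReIm _) _.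
have -> : 4 * M = 2 * M + 2 * M by ring.
apply: lerD.
- by apply: (proj2 (@geo_cvg _ M _)) => n; exact: le_trans (le_Re_normc _) (aM n).
- by apply: (proj2 (@geo_cvg _ M _)) => n; exact: le_trans (le_Im_normc _) (aM n).
Qed.

Lemma csum_cvg a M : geodom a M ->
  (series a : nat -> R[i]^o) @ \oo --> (csum a : R[i]^o).
Proof.
move=> /geodom_cvg[ar ai]; apply/cvg_complexP; split.
- rewrite (_ : (fun _ => _) = series (fun n => complex.Re (a n)))//.
  by apply/funext => n; rewrite /series /= cRe_sum.
- rewrite (_ : (fun _ => _) = series (fun n => complex.Im (a n)))//.
  by apply/funext => n; rewrite /series /= cIm_sum.
Qed.

Lemma csum_unique a M l : geodom a M ->
  (series a : nat -> R[i]^o) @ \oo --> (l : R[i]^o) -> l = csum a.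
Proof.
move=> aM al; have := csum_cvg aM => ac.
exact: (cvg_unique _ al ac).
Qed.

Lemma csumD a b M N : geodom a M -> geodom b N ->
  csum (fun n => a n + b n) = csum a + csum b.
Proof.
move=> aM bN.
have dab : geodom (fun n => a n + b n) (M + N).
  by move=> n; rewrite mulrDl (le_trans (le_normcD _ _))// lerD.
apply/esym/(csum_unique dab).
rewrite (_ : series _ = (fun n => series a n + series b n)); last first.
  by apply/funext => n; rewrite /series /= big_split.
by apply: (@cvgD _ R[i]^o); [exact: csum_cvg aM|exact: csum_cvg bN].
Qed.

Lemma geodomZ a M z : geodom a M -> geodom (fun n => z * a n) (nc z * M).
Proof. by move=> aM n; rewrite Normc.normcM -mulrA ler_wpM2l ?normc_ge0. Qed.

Lemma csumZ a M z : geodom a M -> csum (fun n => z * a n) = z * csum a.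
Proof.
move=> aM; apply/esym/(csum_unique (geodomZ z aM)).
rewrite (_ : series _ = (fun n => z * series a n)); last first.
  by apply/funext => n; rewrite /series /= mulr_sumr.
by apply: (@cvgM R[i]); [exact: cvg_cst|exact: csum_cvg aM].
Qed.

Lemma csum_sum (I : Type) (s : seq I) (a : I -> nat -> R[i]) (M : I -> R) :
  (forall i, geodom (a i) (M i)) ->
  csum (fun n => \sum_(i <- s) a i n) = \sum_(i <- s) csum (a i) /\
  geodom (fun n => \sum_(i <- s) a i n) (\sum_(i <- s) M i).
Proof.
move=> aM; elim: s => [|i s [IH1 IH2]].
  have d0 : geodom (fun n => \sum_(i <- [::]) a i n) (\sum_(i <- [::]) M i).
    by move=> n; rewrite !big_nil Normc.normc0 mul0r.
  split=> //; apply/esym/(csum_unique d0); rewrite big_nil.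
  rewrite (_ : series _ = fun=> 0); first exact: (@cvg_cst R[i]^o).
  by apply/funext => n; rewrite /series /= big1// => k _; rewrite big_nil.
split.
  rewrite big_cons -IH1 -(csumD (aM i) IH2); congr csum.
  by apply/funext => n; rewrite big_cons.
move=> n; rewrite !big_cons mulrDl (le_trans (le_normcD _ _))//.
by apply: lerD; [exact: aM|exact: IH2].
Qed.

End geometric_series.

Section binomial_tail.
Variable R : realType.

(** An omitted term 'C(n, j) t^(n - j) h^j is at most 'C(n, j) r^n (nc h / r)^N,
    and the binomial coefficients add up to 2^n. *)
Lemma binomial_tail (t h : R[i]) (r : R) n N : 0 < r -> nc t <= r -> nc h <= r ->
  nc ((t + h) ^+ n - \sum_(j < N) ('C(n, j)%:R * t ^+ (n - j) * h ^+ j))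
  <= (nc h / r) ^+ N * (2 * r) ^+ n.
Proof.
move=> r0 tr hr; set k := maxn N n.+1.
pose F j := 'C(n, j)%:R * t ^+ (n - j) * h ^+ j.
have F0 j : (n < j)%N -> F j = 0 by move=> nj; rewrite /F bin_small// !mul0r.
have hr1 : nc h / r <= 1 by rewrite ler_pdivrMr// mul1r.
have hr0 : 0 <= nc h / r by rewrite divr_ge0 ?normc_ge0// ltW.
have Fle j : (N <= j)%N -> nc (F j) <= 'C(n, j)%:R * r ^+ n * (nc h / r) ^+ N.
  move=> Nj; have [nj|jn] := ltnP n j.
    by rewrite F0// Normc.normc0 !mulr_ge0 ?exprn_ge0// ltW.
  rewrite /F !Normc.normcM !normcX normc_nat -!mulrA ler_wpM2l//.
  apply: le_trans (_ : r ^+ (n - j) * nc h ^+ j <= _).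
    by rewrite ler_wpM2r ?exprn_ge0 ?normc_ge0// lerXn2r ?nnegrE ?normc_ge0// ltW.
  have -> : r ^+ (n - j) * nc h ^+ j = r ^+ n * (nc h / r) ^+ j.
    rewrite expr_div_n -{2}(subnK jn) exprD; field.
    by rewrite expf_neq0 ?gt_eqF.
  by rewrite ler_wpM2l ?exprn_ge0 ?(ltW r0)// ler_wiXn2l.
have -> : (t + h) ^+ n = \sum_(0 <= j < k) F j.
  rewrite (@big_cat_nat _ _ _ n.+1) ?leq_maxr//=.
  rewrite [X in _ = _ + X]big_nat_cond [X in _ = _ + X]big1 ?addr0; last first.
    by move=> j /andP[/andP[nj _] _]; exact: F0.
  rewrite big_mkord exprDn; apply: eq_bigr => j _.
  by rewrite /F -mulr_natl mulrA.
rewrite -(big_mkord xpredT F) (@big_cat_nat _ _ _ N) ?leq_maxl//=.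
rewrite [_ + _ - _]addrAC subrr add0r.
apply: le_trans (normc_sum _ _ _) _.
apply: le_trans (_ : \sum_(N <= j < k) 'C(n, j)%:R * r ^+ n * (nc h / r) ^+ N <= _).
  by apply: ler_sum_nat => j /andP[Nj _]; exact: Fle.
rewrite -!mulr_suml mulrC ler_wpM2l ?exprn_ge0//.
rewrite exprMn ler_wpM2r ?exprn_ge0 ?(ltW r0)//.
apply: le_trans (_ : \sum_(0 <= j < k) 'C(n, j)%:R <= _).
  by rewrite [leRHS](@big_cat_nat _ _ _ N) ?leq_maxl//= lerDr sumr_ge0.
rewrite (@big_cat_nat _ _ _ n.+1) ?leq_maxr//=.
rewrite [X in _ + X]big_nat_cond [X in _ + X]big1 ?addr0; last first.
  by move=> j /andP[/andP[nj _] _]; rewrite bin_small.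
rewrite big_mkord -natr_sum -natrX ler_nat.
have := Pascal 1 1 n; rewrite addn1 => ->.
by apply: leq_sum => j _; rewrite !exp1n !mul1n muln1.
Qed.

End binomial_tail.

Section differentiation_criterion.
Variable R : realType.

(** Estimates for power series yield the derivative with a quadratic error
    directly, without a limit of difference quotients. *)
Lemma is_derive_quadratic (g : R -> R) (x l C r : R) : 0 < r ->
  (forall h, `|h| <= r -> `|g (x + h) - g x - l * h| <= C * h ^+ 2) ->
  is_derive x 1 g l.
Proof.
move=> r0 gC.
have C0 : 0 <= C.
  have := le_trans (normr_ge0 _) (gC r _); rewrite ger0_norm ?(ltW r0)// lexx => /(_ isT).
  by rewrite pmulr_lge0// exprn_gt0.
have cv : h^-1 *: (g (h + x) - g x) @[h --> 0^'] --> l.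
  apply/(@cvgrPdist_lt _ R^o) => e e0.
  near=> h.
  have h0 : h != 0 by near: h; exact: nbhs_dnbhs_neq.
  have hr : `|h| <= r.
    by near: h; exact: dnbhs0_le.
  have hC : (C + 1) * `|h| < e.
    rewrite -ltr_pdivlMl ?ltr_pwDr//.
    by near: h; apply: dnbhs0_lt; rewrite mulr_gt0// invr_gt0 ltr_pwDr.
  have := gC h hr; rewrite (addrC x) => gh.
  rewrite (_ : l - _ = - (h^-1 * (g (h + x) - g x - l * h))); last first.
    by rewrite /GRing.scale /=; field.
  rewrite normrN normrM normfV.
  apply: le_lt_trans (_ : `|h|^-1 * (C * h ^+ 2) < _).
    by rewrite ler_wpM2l// invr_ge0.
  rewrite -real_normK ?num_real// (_ : `|h|^-1 * (C * `|h| ^+ 2) = C * `|h|); last first.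
    by field; rewrite normr_eq0.
  by apply: le_lt_trans hC; rewrite ler_wpM2r// lerDl.
apply: DeriveDef.
  by apply/cvg_ex; exists l; under eq_fun do rewrite scaler1.
rewrite /derive; apply/cvg_lim => //.
by under eq_fun do rewrite scaler1.
Unshelve. all: end_near. Qed.

Lemma near_dist_lt (x0 r x : R) : `|x - x0| < r -> \forall y \near x, `|y - x0| < r.
Proof.
move=> xr; apply/nbhs_ballP; exists (r - `|x - x0|) => [|y] /=; first by rewrite subr_gt0.
rewrite -ball_normE /= ltrBrDr => h; apply: le_lt_trans h.
rewrite (_ : y - x0 = - (x - y) + (x - x0)); last by ring.
by rewrite (le_trans (ler_normD _ _))// normrN.
Qed.

(** F j is the j-th derivative divided by j!. The hypotheses hold on a ball
    because an iterated derivative depends on a neighbourhood. *)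
Lemma derive1n_chain (F : nat -> R -> R) (g : R -> R) (x0 r : R) :
  (forall j x, `|x - x0| < r -> is_derive x 1 (F j) (j.+1%:R * F j.+1 x)) ->
  (forall x, `|x - x0| < r -> g x = F 0%N x) ->
  forall j x, `|x - x0| < r -> derive1n j g x = j`!%:R * F j x.
Proof.
move=> dF gF; elim=> [|j IH] x xr; first by rewrite derive1n0 fact0 mul1r gF.
rewrite derive1nS derive1E.
have dFj := dF j x xr.
have H : is_derive x 1 (j`!%:R *: F j) (j`!%:R *: (j.+1%:R * F j.+1 x)) by apply: is_deriveZ.
have : is_derive x 1 (derive1n j g) (j`!%:R *: (j.+1%:R * F j.+1 x)).
  apply: near_eq_is_derive H; have := near_dist_lt xr.
  by apply: filterS => y yr; rewrite IH.
by move=> ?; rewrite derive_val factS natrM /GRing.scale /=; ring.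
Qed.

End differentiation_criterion.

Section analytic_taylor.
Variable R : realType.
Variables (a : nat -> R[i]) (r M : R).
Hypothesis r0 : 0 < r.
(* Recentring at t and evaluating at t + h, with nc t, nc h <= r, stays within the
   radius 2 r, and a binomial coefficient costs 2 ^ n: decay at the radius 8 r = 2 * 2 * 2 r
   leaves the summable factor 2 ^- n. *)
Hypothesis aM : forall n, nc (a n) <= M / (8 * r) ^+ n.

Let M0 : 0 <= M.
Proof.
by have := le_trans (normc_ge0 _) (aM 0); rewrite expr0 divr1.
Qed.

Definition taylor_term j (t : R[i]) n : R[i] := a n * 'C(n, j)%:R * t ^+ (n - j).
(** The j-th derivative at t, divided by j!, of the power series with
    coefficients a. *)
Definition taylor_coef j t := csum (taylor_term j t).

Lemma binR_le n j : 'C(n, j)%:R <= 2 ^+ n :> R.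
Proof.
rewrite -natrX ler_nat; have [nj|jn] := ltnP n j; first by rewrite bin_small.
have := Pascal 1 1 n; rewrite addn1 => ->.
rewrite (bigD1 (Ordinal (jn : (j < n.+1)%N)))//= !exp1n !muln1.
exact: leq_addr.
Qed.

Lemma geodom_taylor_term j t : nc t <= 2 * r ->
  geodom (taylor_term j t) (M / (2 * r) ^+ j).
Proof.
move=> tr n; rewrite /taylor_term !Normc.normcM normcX normc_nat.
have r2 : 0 < 2 * r by rewrite mulr_gt0.
have [nj|jn] := ltnP n j.
  by rewrite bin_small// mulr0 mul0r !mulr_ge0 ?invr_ge0 ?exprn_ge0 ?(ltW r2)// ltW.
apply: le_trans (_ : M / (8 * r) ^+ n * 2 ^+ n * (2 * r) ^+ (n - j) <= _).
  rewrite ler_pM ?mulr_ge0 ?exprn_ge0 ?normc_ge0//.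
    by rewrite ler_pM ?normc_ge0// binR_le.
  by rewrite lerXn2r ?nnegrE ?normc_ge0// ltW.
rewrite le_eqVlt; apply/orP; left; apply/eqP.
have -> : 8 * r = 2 * 2 * (2 * r) by ring.
have -> : n = ((n - j) + j)%N by rewrite subnK.
rewrite addnK ?exprVn !exprMn !exprD; field.
by rewrite !expf_neq0 ?gt_eqF// pnatr_eq0.
Qed.

Let hsum_le (b : nat -> R[i]) (K : R) (h : R[i]) N : geodom b (K * (nc h / r) ^+ N) ->
  nc (csum b) <= 4 * K / r ^+ N * nc h ^+ N.
Proof.
move=> /normc_csum_le; rewrite expr_div_n => /le_trans; apply.
by rewrite le_eqVlt; apply/orP; left; apply/eqP; ring.
Qed.

(** Termwise, this is [binomial_tail] for (t + h)^n. *)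
Lemma taylor_remainder t h N : nc t <= r -> nc h <= r ->
  nc (taylor_coef 0 (t + h) - \sum_(j < N) taylor_coef j t * h ^+ j)
  <= 4 * M / r ^+ N * nc h ^+ N.
Proof.
move=> tr hr.
have tr2 : nc t <= 2 * r by apply: le_trans tr _; rewrite mulr_natl mulr2n lerDr ltW.
have thr : nc (t + h) <= 2 * r.
  by apply: le_trans (le_normcD _ _) _; rewrite mulr_natl mulr2n lerD.
have [sE sD] := @csum_sum R 'I_N (index_enum 'I_N) (fun j n => h ^+ j * taylor_term j t n)
  _ (fun j => geodomZ (h ^+ j) (geodom_taylor_term j tr2)).
have -> : \sum_(j < N) taylor_coef j t * h ^+ j =
    csum (fun n => \sum_(j < N) h ^+ j * taylor_term j t n).
  rewrite sE; apply: eq_bigr => j _.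
  by rewrite (csumZ _ (geodom_taylor_term j tr2)) mulrC.
rewrite -mulN1r -(csumZ _ sD) -(csumD (geodom_taylor_term 0 thr) (geodomZ (-1) sD)).
apply: hsum_le => n.
have -> : taylor_term 0 (t + h) n + -1 * \sum_(j < N) h ^+ j * taylor_term j t n =
   a n * ((t + h) ^+ n - \sum_(j < N) ('C(n, j)%:R * t ^+ (n - j) * h ^+ j)).
  rewrite /taylor_term bin0 mulr1 subn0 mulN1r mulrBr mulr_sumr; congr (_ - _).
  by apply: eq_bigr => j _; ring.
rewrite Normc.normcM.
apply: le_trans (_ : M / (8 * r) ^+ n * ((nc h / r) ^+ N * (2 * r) ^+ n) <= _).
  by apply: ler_pM; rewrite ?normc_ge0//; exact: binomial_tail.
have -> : 8 * r = 4 * (2 * r) by ring.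
rewrite exprMn; have -> : M / (4 ^+ n * (2 * r) ^+ n) * ((nc h / r) ^+ N * (2 * r) ^+ n)
   = M * (nc h / r) ^+ N * 4^-1 ^+ n.
  by rewrite exprVn; field; rewrite !expf_neq0 ?mulf_neq0 ?gt_eqF// ?pnatr_eq0.
have p1 : 0 <= (nc h / r) ^+ N by rewrite exprn_ge0// divr_ge0 ?normc_ge0// ltW.
rewrite ler_wpM2l ?mulr_ge0// lerXn2r ?nnegrE ?invr_ge0//.
by rewrite lef_pV2 ?posrE// ler_nat.
Qed.

(** Termwise, this is [binomial_tail] for (t + h)^(n - j), keeping two terms. It
    shows that the derivative of the j-th coefficient is j + 1 times the next one. *)
Lemma taylor_coef_quadratic j t h : nc t <= r -> nc h <= r ->
  nc (taylor_coef j (t + h) - taylor_coef j t - j.+1%:R * taylor_coef j.+1 t * h)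
  <= 4 * (M / (2 * r) ^+ j) / r ^+ 2 * nc h ^+ 2.
Proof.
move=> tr hr.
have tr2 : nc t <= 2 * r by apply: le_trans tr _; rewrite mulr_natl mulr2n lerDr ltW.
have thr : nc (t + h) <= 2 * r.
  by apply: le_trans (le_normcD _ _) _; rewrite mulr_natl mulr2n lerD.
have d0 := geodom_taylor_term j thr.
have d1 := geodomZ (-1) (geodom_taylor_term j tr2).
have d2 := geodomZ (- (j.+1%:R * h)) (geodom_taylor_term j.+1 tr2).
have -> : taylor_coef j (t + h) - taylor_coef j t - j.+1%:R * taylor_coef j.+1 t * h =
  csum (fun n => taylor_term j (t + h) n + -1 * taylor_term j t n +
                 - (j.+1%:R * h) * taylor_term j.+1 t n).
  have d01 : geodom (fun n => taylor_term j (t + h) n + -1 * taylor_term j t n)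
      (M / (2 * r) ^+ j + nc (-1) * (M / (2 * r) ^+ j)).
    move=> n; rewrite mulrDl (le_trans (le_normcD _ _))//.
    by apply: lerD; [exact: d0|exact: d1].
  rewrite (csumD d01 d2).
  rewrite (csumD d0 d1) (csumZ _ (geodom_taylor_term j tr2)).
  rewrite (csumZ _ (geodom_taylor_term j.+1 tr2)) /taylor_coef.
  move: (csum _) (csum _) (csum _) => x y z; ring.
apply: hsum_le => n.
have [nj|jn] := ltnP n j.
  rewrite /taylor_term (bin_small nj) (bin_small (leqW nj)).
  rewrite !(mulr0, mul0r, addr0) Normc.normc0.
  by rewrite !mulr_ge0 ?invr_ge0 ?exprn_ge0 ?divr_ge0 ?normc_ge0 ?mulr_ge0 ?(ltW r0).
have -> : taylor_term j (t + h) n + -1 * taylor_term j t n +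
    - (j.+1%:R * h) * taylor_term j.+1 t n =
   a n * 'C(n, j)%:R * ((t + h) ^+ (n - j) -
     \sum_(i < 2) ('C(n - j, i)%:R * t ^+ (n - j - i) * h ^+ i)).
  rewrite !big_ord_recl big_ord0 /= bin0 bin1 subn0 addr0 expr0 expr1 !mulr1 mul1r.
  have : j.+1%:R * 'C(n, j.+1)%:R = (n - j)%:R * 'C(n, j)%:R :> R[i].
    by rewrite -!natrM mul_bin_left.
  rewrite /taylor_term subnS subn1 => E.
  have -> : - (j.+1%:R * h) * (a n * 'C(n, j.+1)%:R * t ^+ (n - j).-1) =
     - (j.+1%:R * 'C(n, j.+1)%:R) * (h * a n * t ^+ (n - j).-1) by ring.
  rewrite E; ring.
rewrite !Normc.normcM normc_nat.
apply: le_trans (_ : M / (8 * r) ^+ n * 2 ^+ n * ((nc h / r) ^+ 2 * (2 * r) ^+ (n - j)) <= _).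
  apply: ler_pM; rewrite ?mulr_ge0 ?normc_ge0//; last exact: binomial_tail.
  by rewrite ler_pM ?normc_ge0// binR_le.
rewrite le_eqVlt; apply/orP; left; apply/eqP.
have -> : 8 * r = 2 * 2 * (2 * r) by ring.
have -> : n = ((n - j) + j)%N by rewrite subnK.
rewrite addnK ?exprVn !exprMn !exprD; field.
by rewrite !expf_neq0 ?gt_eqF// pnatr_eq0.
Qed.

End analytic_taylor.

Section analytic_at_real_points.
Variable R : realType.

(** The terms of a convergent series are bounded, so the coefficients decay
    geometrically inside the disc of convergence. *)
Lemma analytic_at_coef (f : R[i] -> R[i]) z : analytic_at f z ->
  exists a : nat -> R[i], exists r M, [/\ 0 < r,
    forall n, nc (a n) <= M / (8 * r) ^+ n &
    forall h, nc h <= 2 * r -> f (z + h) = taylor_coef a 0 h].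
Proof.
move=> [a [rho rho0 fa]]; pose r := rho / 16.
have r0 : 0 < r by rewrite divr_gt0.
have [M aM] : exists M, forall n, nc (a n) <= M / (8 * r) ^+ n.
  have /fa/cvg_complexP[/= cr ci] : nc ((8 * r)%:C) < rho.
    by rewrite normcR ger0_norm ?mulr_ge0 ?(ltW r0)// /r; lra.
  have bnd (g : R[i] -> R) : {morph g : x y / x + y} -> g 0 = 0 ->
      (fun n => g (series (fun n => a n * (8 * r)%:C ^+ n) n)) @ \oo
        --> g (f (z + (8 * r)%:C)) ->
      exists M, forall n, `|g (a n * (8 * r)%:C ^+ n)| <= M.
    move=> gD g0 cv.
    have cs : cvgn (series (fun n => g (a n * (8 * r)%:C ^+ n))).
      apply/cvg_ex; eexists; apply: cvg_trans cv; apply: near_eq_cvg.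
      by apply: nearW => n; rewrite /series /= (big_morph g gD g0).
    have /cvgP/cvg_seq_bounded[M [_ bM]] := cvg_series_cvg_0 cs.
    by exists (M + 1) => n; apply: (bM (M + 1)); rewrite ?ltrDl.
  have [M1 b1] := bnd _ (@cReD R) erefl cr.
  have [M2 b2] := bnd _ (@cImD R) erefl ci.
  exists (M1 + M2) => n; rewrite ler_pdivlMr ?exprn_gt0 ?mulr_gt0//.
  have -> : (8 * r) ^+ n = nc ((8 * r)%:C ^+ n).
    by rewrite normcX normcR ger0_norm// mulr_ge0// ltW.
  by rewrite -Normc.normcM (le_trans (normc_le_ReIm _))// lerD.
exists a, r, M; split => // h hr.
apply: csum_unique.
  exact: (geodom_taylor_term r0 aM 0 hr).
have : nc h < rho by apply: le_lt_trans hr _; rewrite /r; lra.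
move=> /fa; rewrite (_ : (fun n => a n * h ^+ n) = taylor_term a 0 h)//.
by apply/funext => n; rewrite /taylor_term bin0 mulr1 subn0.
Qed.

Lemma cRe_natM n z : complex.Re (n%:R * z : R[i]) = n%:R * complex.Re z.
Proof. by rewrite natcE cReMr. Qed.

Lemma cIm_natM n z : complex.Im (n%:R * z : R[i]) = n%:R * complex.Im z.
Proof. by rewrite natcE cImMr. Qed.

(** Recentring the power series of f at the real points near b0 gives Taylor
    expansions with a remainder that is uniform in b. Their coefficients are real,
    as f is real on the real line; hence they are the derivatives of [on_real f]. *)
Lemma analytic_taylor (f : R[i] -> R[i]) (b0 : R) : analytic_at f b0%:C ->
  (\forall b \near b0, complex.Im (f b%:C) = 0) ->
  exists2 r, 0 < r &
    (forall j (b : R), `|b - b0| < r ->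
       is_derive b 1 (derive1n j (on_real f)) (derive1n j.+1 (on_real f) b)) /\
    (forall N, exists M, forall b, `|b - b0| < r ->
       (forall j, (j <= N)%N -> `|derive1n j (on_real f) b| <= M) /\
       (forall h, nc h <= r ->
          nc (f (b%:C + h) - \sum_(j < N) (derive1n j (on_real f) b / j`!%:R)%:C * h ^+ j)
          <= M * nc h ^+ N)).
Proof.
move=> /analytic_at_coef[a [r1 [M [r10 aM fE]]]] fR.
have M0 : 0 <= M by have := le_trans (normc_ge0 _) (aM 0%N); rewrite expr0 divr1.
have [r2 r20 fR2] : exists2 r2, 0 < r2 & forall b, `|b - b0| < r2 -> complex.Im (f b%:C) = 0.
  move/nbhs_ballP : fR => [r2 /= r20 fR2]; exists r2 => // b br.
  by apply: fR2; rewrite -ball_normE /= distrC.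
pose r := Num.min r1 r2.
have r0 : 0 < r by rewrite lt_min r10.
have rr1 : r <= r1 by rewrite ge_min lexx.
have rr2 : r <= r2 by rewrite ge_min lexx orbT.
pose c j b := taylor_coef a j (b - b0)%:C.
have cdiff j b : `|b - b0| < r -> forall h, `|h| <= r1 ->
    nc (c j (b + h) - c j b - j.+1%:R * c j.+1 b * h%:C)
      <= 4 * (M / (2 * r1) ^+ j) / r1 ^+ 2 * h ^+ 2.
  move=> br h hr; have bn : nc (b - b0)%:C <= r1.
    by rewrite normcR ltW// (lt_le_trans br).
  have hn : nc h%:C <= r1 by rewrite normcR.
  have := taylor_coef_quadratic r10 aM j bn hn.
  have -> : nc h%:C ^+ 2 = h ^+ 2 by rewrite normcR real_normK ?num_real.
  by have -> : (b - b0)%:C + h%:C = (b + h - b0)%:C by rewrite -rmorphD addrAC.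
have dRe j (b : R) : `|b - b0| < r ->
    is_derive b 1 (fun b => complex.Re (c j b)) (j.+1%:R * complex.Re (c j.+1 b)).
  move=> br; apply: (is_derive_quadratic r10) => h /(cdiff j b br).
  apply: le_trans; apply: le_trans (le_Re_normc _).
  by rewrite !cReD !cReN [_ * h%:C]mulrC cReMr cRe_natM [h * _]mulrC.
have dIm j (b : R) : `|b - b0| < r ->
    is_derive b 1 (fun b => complex.Im (c j b)) (j.+1%:R * complex.Im (c j.+1 b)).
  move=> br; apply: (is_derive_quadratic r10) => h /(cdiff j b br).
  apply: le_trans; apply: le_trans (le_Im_normc _).
  by rewrite !cImD !cImN [_ * h%:C]mulrC cImMr cIm_natM [h * _]mulrC.
have fc b : `|b - b0| < r -> f b%:C = c 0%N b.
  move=> br; rewrite /c -fE; first by rewrite -rmorphD addrC subrK.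
  rewrite normcR; apply: le_trans (ltW br) _; rewrite (le_trans rr1)//.
  by rewrite mulr_natl mulr2n lerDr ltW.
have reE j b : `|b - b0| < r -> derive1n j (on_real f) b = j`!%:R * complex.Re (c j b).
  apply: (@derive1n_chain _ (fun j b => complex.Re (c j b)) _ b0 r) => //.
  by move=> x xr; rewrite /on_real fc.
have imE j b : `|b - b0| < r -> complex.Im (c j b) = 0.
  elim: j b => [|j IH] b br; first by rewrite -fc// fR2// (lt_le_trans br).
  have H := dIm j b br.
  have : is_derive b 1 (fun b => complex.Im (c j b)) 0.
    have H0 : is_derive b 1 (cst (0 : R) : R -> R) 0 by exact: is_derive_cst.
    apply: near_eq_is_derive H0.
    by have := near_dist_lt br; apply: filterS => y yr; rewrite IH.
  move=> H0; have := @derive_val _ _ _ _ _ _ _ H; rewrite (@derive_val _ _ _ _ _ _ _ H0).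
  by move/esym/eqP; rewrite mulf_eq0 pnatr_eq0 => /eqP.
exists r; first exact: r0.
split.
  move=> j b br; rewrite reE//.
  have H : is_derive b 1 (j`!%:R *: (fun b => complex.Re (c j b)))
      (j`!%:R *: (j.+1%:R * complex.Re (c j.+1 b))).
    by have := dRe j b br => ?; apply: is_deriveZ.
  rewrite factS natrM [_ * j`!%:R]mulrC -mulrA.
  apply: near_eq_is_derive H; have := near_dist_lt br.
  by apply: filterS => y yr; rewrite reE.
move=> N; pose K := 4 * M / r1 ^+ N + \sum_(j < N.+1) j`!%:R * (4 * (M / (2 * r1) ^+ j)).
have K1 : 0 <= 4 * M / r1 ^+ N.
  by rewrite !mulr_ge0 ?invr_ge0 ?exprn_ge0// ltW.
have K2 (j : nat) : 0 <= j`!%:R * (4 * (M / (2 * r1) ^+ j)).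
  by rewrite !mulr_ge0 ?invr_ge0 ?exprn_ge0// mulr_ge0// ltW.
exists K => b br.
have br1 : nc (b - b0)%:C <= r1 by rewrite normcR ltW// (lt_le_trans br).
have br2 : nc (b - b0)%:C <= 2 * r1.
  by apply: le_trans br1 _; rewrite mulr_natl mulr2n lerDr ltW.
split => [j jN|h hr].
  rewrite reE// normrM ger0_norm//.
  apply: le_trans (_ : j`!%:R * (4 * (M / (2 * r1) ^+ j)) <= _).
    rewrite ler_wpM2l// (le_trans (le_Re_normc _))//.
    exact: normc_csum_le (geodom_taylor_term r10 aM j br2).
  rewrite /K (bigD1 (Ordinal (jN : (j < N.+1)%N)))//=.
  by rewrite addrCA lerDl addr_ge0// sumr_ge0.
have -> : f (b%:C + h) = taylor_coef a 0 ((b - b0)%:C + h).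
  have -> : b%:C = b0%:C + (b - b0)%:C by rewrite -rmorphD addrC subrK.
  rewrite -addrA fE//.
  apply: le_trans (le_normcD _ _) _; rewrite mulr_natl mulr2n lerD//.
  exact: le_trans rr1.
have -> : \sum_(j < N) (derive1n j (on_real f) b / j`!%:R)%:C * h ^+ j =
    \sum_(j < N) taylor_coef a j (b - b0)%:C * h ^+ j.
  apply: eq_bigr => j _; congr (_ * _); rewrite reE// -/(c j b).
  have := imE j b br; case: (c j b) => x y /= ->.
  by congr (_ +i* _); field; rewrite pnatr_eq0 -lt0n fact_gt0.
apply: le_trans (taylor_remainder r10 aM N br1 (le_trans hr rr1)) _.
by rewrite ler_wpM2r ?exprn_ge0 ?normc_ge0// /K lerDl sumr_ge0.
Qed.

End analytic_at_real_points.

(** * Logarithmic derivatives *)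

Section smooth_functions.
Variable R : realType.
Variables (x0 r : R).
Implicit Types (f g : R -> R).

Definition deriv_on f f' := forall x : R, `|x - x0| < r -> is_derive x 1 f (f' x).

(** The derivative is an existential witness and not [derive1], so that stability
    under products and inverses is a plain induction. *)
Fixpoint smooth n f := if n is n'.+1 then
  exists2 f', deriv_on f f' & smooth n' f' else True.

Lemma smooth_le n f : smooth n.+1 f -> smooth n f.
Proof.
elim: n f => [//|n IH] f [f' df sf]; exists f' => //.
exact: IH.
Qed.

Lemma smoothZ n f c : smooth n f -> smooth n (c *: f).
Proof.
elim: n f => [//|n IH] f [f' df sf]; exists (c *: f'); last exact: IH.
by move=> x xr; have := df x xr => ?; exact: is_deriveZ.
Qed.

Lemma smoothD n f g : smooth n f -> smooth n g -> smooth n (f + g).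
Proof.
elim: n f g => [//|n IH] f g [f' df sf] [g' dg sg]; exists (f' + g'); last exact: IH.
by move=> x xr; have := df x xr => ?; have := dg x xr => ?; exact: is_deriveD.
Qed.

Lemma smoothM n f g : smooth n f -> smooth n g -> smooth n (f * g).
Proof.
elim: n f g => [//|n IH] f g sf sg.
have sf1 := smooth_le sf; have sg1 := smooth_le sg.
case: sf => f' df sf; case: sg => g' dg sg.
exists (f * g' + g * f'); last by apply: smoothD; apply: IH.
by move=> x xr; have := df x xr => ?; have := dg x xr => ?; exact: is_deriveM.
Qed.

Lemma smoothV n f : (forall x, `|x - x0| < r -> f x != 0) ->
  smooth n f -> smooth n (fun x => (f x)^-1).
Proof.
move=> f0; elim: n => [//|n IH] sf; have sf1 := smooth_le sf.
case: sf => f' df sf.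
exists (-1 *: ((fun x => (f x)^-1) * ((fun x => (f x)^-1) * f'))).
  move=> x xr; have dfx := df x xr.
  have := is_deriveV (f0 x xr) dfx.
  have -> : (-1 *: ((fun x => (f x)^-1) * ((fun x => (f x)^-1) * f'))) x
     = - f x ^- 2 *: f' x.
    by rewrite !fctE /GRing.scale /=; field; exact: f0.
  exact.
by apply: smoothZ; apply: smoothM; [exact: IH|apply: smoothM; [exact: IH|]].
Qed.

Lemma derive1n_local f g : (forall x, `|x - x0| < r -> f x = g x) ->
  forall j x, `|x - x0| < r -> derive1n j f x = derive1n j g x.
Proof.
move=> fg; elim=> [|j IH] x xr; first exact: fg.
rewrite !derive1nS !derive1E; apply: near_eq_derive.
by have := near_dist_lt xr; apply: filterS => y yr; exact: IH.
Qed.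

Lemma smooth_derive1n j f : smooth j.+1 f -> deriv_on (derive1n j f) (derive1n j.+1 f).
Proof.
elim: j f => [|j IH] f [f' df sf] x xr.
  have dfx := df x xr.
  by rewrite derive1n1 derive1E derive_val.
have f'E y : `|y - x0| < r -> derive1 f y = f' y.
  by move=> yr; rewrite derive1E; have dfy := df y yr; exact: derive_val.
rewrite [derive1n j.+2 f]derive1Sn (derive1n_local f'E)// derive1Sn.
have := IH f' sf x xr; apply: near_eq_is_derive.
by have := near_dist_lt xr; apply: filterS => y yr; rewrite (derive1n_local f'E).
Qed.

Lemma smoothP f : (forall j, deriv_on (derive1n j f) (derive1n j.+1 f)) ->
  forall n j, smooth n (derive1n j f).
Proof. by move=> df; elim=> [//|n IH] j; exists (derive1n j.+1 f). Qed.

Section logarithm.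
Variable V : R -> R.
Hypothesis dV : forall j, deriv_on (derive1n j V) (derive1n j.+1 V).
Hypothesis V0 : forall x, `|x - x0| < r -> V x != 0.

Let l t := ln `|V t|.

(** Writing ln |V| as ln (V^2) / 2 avoids a case distinction on the sign of V. *)
Lemma is_derive_lnabs : deriv_on l (derive1n 1 V * (fun x => (V x)^-1)).
Proof.
move=> x xr; have dVx : is_derive x 1 V (derive1n 1 V x) := dV 0 xr.
have V2 : 0 < V x * V x by rewrite -expr2 exprn_even_gt0// V0.
have dL := is_derive1_ln V2.
have dVV : is_derive x 1 (V * V) (V x *: derive1n 1 V x + V x *: derive1n 1 V x).
  exact: is_deriveM.
have H : is_derive x 1 (@ln R \o (V * V))
    ((V x * V x)^-1 * (V x *: derive1n 1 V x + V x *: derive1n 1 V x)).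
  exact: (@is_derive1_comp _ (@ln R) (V * V) x _ _ dL dVV).
have H2 : is_derive x 1 (2^-1 *: (@ln R \o (V * V)))
    (2^-1 *: ((V x * V x)^-1 * (V x *: derive1n 1 V x + V x *: derive1n 1 V x))).
  exact: is_deriveZ.
rewrite (_ : (_ * _) x = 2^-1 *: ((V x * V x)^-1 *
    (V x *: derive1n 1 V x + V x *: derive1n 1 V x))); last first.
  by rewrite !fctE /GRing.scale /=; field; exact: V0.
apply: near_eq_is_derive H2; have := near_dist_lt xr.
apply: filterS => y yr; rewrite /l !fctE /GRing.scale /=.
have Vy : 0 < `|V y| by rewrite normr_gt0 V0.
have -> : V y * V y = `|V y| ^+ 2 by rewrite real_normK ?num_real// expr2.
by rewrite lnXn// mulr2n; field.
Qed.

Lemma smooth_lnabs n : smooth n l.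
Proof.
apply: (@smooth_le n); exists (derive1n 1 V * (fun x => (V x)^-1)).
  exact: is_derive_lnabs.
apply: smoothM; first exact: smoothP.
by apply: smoothV => //; exact: (smoothP dV n 0).
Qed.

Lemma deriv_lnabs j : deriv_on (derive1n j l) (derive1n j.+1 l).
Proof. exact/smooth_derive1n/smooth_lnabs. Qed.

(** Leibniz' rule for V' = V (ln |V|)', all derivatives being divided by
    factorials. *)
Lemma lnabs_recurrence j x : `|x - x0| < r ->
  derive1n j.+1 V x / j`!%:R =
  \sum_(i < j.+1) (derive1n i V x / i`!%:R) * (derive1n (j - i).+1 l x / (j - i)`!%:R).
Proof.
move=> xr.
pose F i := (i`!%:R)^-1 *: derive1n i V.
pose G i := (i`!%:R)^-1 *: derive1n i.+1 l.
have fact0R (i : nat) : i`!%:R != 0 :> R by rewrite pnatr_eq0 -lt0n fact_gt0.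
have dF i : deriv_on (F i) (i.+1%:R *: F i.+1).
  move=> y yr; have dVy := dV i yr.
  rewrite (_ : (_ *: _) y = (i`!%:R)^-1 *: derive1n i.+1 V y); first exact: is_deriveZ.
  rewrite /F /GRing.scale /= /GRing.scale /= factS natrM; field.
  by rewrite fact0R addrC natr1 pnatr_eq0.
have dG i : deriv_on (G i) (i.+1%:R *: G i.+1).
  move=> y yr; have dly := @deriv_lnabs i.+1 y yr.
  rewrite (_ : (_ *: _) y = (i`!%:R)^-1 *: derive1n i.+2 l y); first exact: is_deriveZ.
  rewrite /G /GRing.scale /= /GRing.scale /= factS natrM; field.
  by rewrite fact0R addrC natr1 pnatr_eq0.
pose H i : R -> R := \sum_(k < i.+1) F k * G (i - k)%N.
have dH i (y : R) : `|y - x0| < r -> is_derive y 1 (H i) (i.+1%:R * H i.+1 y).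
  move=> yr.
  have D (k : 'I_i.+1) : is_derive y 1 (F k * G (i - k)%N)
     (F k y *: ((i - k).+1%:R * G (i - k).+1 y) + G (i - k)%N y *: (k.+1%:R * F k.+1 y)).
    by have dFk := dF k y yr; have dGk := dG (i - k)%N y yr; exact: is_deriveM.
  have := @is_derive_sum _ _ _ _ (fun k : 'I_i.+1 => F k * G (i - k)%N) y 1 _ D.
  rewrite (_ : \sum_(k < i.+1) (_ + _) = i.+1%:R * H i.+1 y)//.
  rewrite /H fct_sumE big_split /= mulr_sumr.
  pose P (k : nat) := F k y * G (i.+1 - k)%N y.
  have -> : \sum_(k < i.+1) F k y *: ((i - k).+1%:R * G (i - k).+1 y) =
      \sum_(k < i.+2) (i.+1 - k)%:R * P k.
    rewrite [RHS]big_ord_recr /= subnn mul0r addr0; apply: eq_bigr => k _.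
    rewrite /P subSn; last by rewrite -ltnS.
    by rewrite /GRing.scale /=; ring.
  have -> : \sum_(k < i.+1) G (i - k)%N y *: (k.+1%:R * F k.+1 y) =
      \sum_(k < i.+2) k%:R * P k.
    rewrite [RHS]big_ord_recl /= mul0r add0r; apply: eq_bigr => k _.
    by rewrite /P /bump /= add1n subSS /GRing.scale /=; ring.
  rewrite -big_split /=; apply: eq_bigr => k _.
  rewrite -mulrDl -natrD subnK; last by rewrite -ltnS.
  by rewrite /P fctE.
have H0 y : `|y - x0| < r -> (derive1n 1 V) y = H 0%N y.
  move=> yr; rewrite /H big_ord1 /F /G subnn fact0 invr1 !scale1r derive1n0.
  have dl := is_derive_lnabs yr.
  have E : derive1n 1 l y = (derive1n 1 V * (fun x => (V x)^-1)) y.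
    by rewrite derive1n1 derive1E derive_val.
  by rewrite [RHS](_ : _ = V y * derive1n 1 l y)// E fctE mulrC divfK// V0.
have -> : derive1n j.+1 V = derive1n j (derive1n 1 V) by rewrite derive1Sn derive1n1.
rewrite (derive1n_chain dH H0 j xr).
rewrite mulrAC mulfV// mul1r /H fct_sumE; apply: eq_bigr => k _.
rewrite [LHS](_ : _ = ((k`!%:R)^-1 * derive1n k V x) *
  (((j - k)`!%:R)^-1 * derive1n (j - k).+1 l x))//.
by rewrite [X in X * _]mulrC [X in _ * X = _]mulrC.
Qed.

End logarithm.
End smooth_functions.

Section exponential_recurrence.
Variable F : numFieldType.

Lemma lowpoly_coef (z : nat -> F) N i : (lowpoly z N)`_i =
  if (1 <= i <= N)%N then z i else 0.
Proof.
rewrite /lowpoly coef_sum (eq_bigr (fun k => if k == i then z k else 0)).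
  by rewrite -big_mkcond big_nat1_eq ltnS.
by move=> k _; rewrite mul_polyC coefZ coefXn mulr_natr mulrb eq_sym.
Qed.

(** Comparison of coefficients in E' = E S' for E = exp S; truncating E affects
    this identity only in degrees at least N. *)
Lemma exppoly_recurrence (z : nat -> F) N j : (j < N)%N ->
  j.+1%:R * (exppoly z N)`_j.+1 =
  \sum_(i < j.+1) (exppoly z N)`_i * ((j - i).+1%:R * z (j - i).+1).
Proof.
move=> jN; set S := lowpoly z N; set E := exppoly z N.
have dE : E^`() = (E - (N`!%:R)^-1 *: S ^+ N) * S^`().
  have -> : E - (N`!%:R)^-1 *: S ^+ N = \sum_(m < N) (m`!%:R)^-1 *: S ^+ m.
    by rewrite /E /exppoly big_ord_recr /= addrK.
  have d0 := @deriv0 F.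
  rewrite /E /exppoly (big_morph _ (@derivD F) d0) big_ord_recl /= expr0.
  rewrite derivZ derivC scaler0 add0r mulr_suml; apply: eq_bigr => m _.
  rewrite derivZ deriv_exp /bump /= add1n -/S factS natrM invfM.
  rewrite -scalerAl [S ^+ m * _]mulrC; apply/polyP => k.
  rewrite add0n !coefZ coefMn -(mulr_natl (_`_k)) mulrA; congr (_ * _).
  by rewrite mulrAC mulVf ?mul1r// pnatr_eq0.
have := congr1 (fun p : {poly F} => p`_j) dE; rewrite coef_deriv mulr_natl => ->.
rewrite coefM; apply: eq_bigr => i _.
have iN : (i < N)%N by apply: leq_ltn_trans jN; rewrite -ltnS.
rewrite coefB coefZ lowpolyX_coef0// mulr0 subr0; congr (_ * _).
rewrite coef_deriv lowpoly_coef /= (_ : (j - i < N)%N); first by rewrite mulr_natl.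
by apply: leq_ltn_trans jN; exact: leq_subr.
Qed.

Lemma exppoly_coef0 (z : nat -> F) N : (exppoly z N)`_0 = 1.
Proof.
rewrite (@exppoly_coef _ _ 0)// /exppoly big_ord1 fact0 invr1 scale1r expr0.
by rewrite coef1.
Qed.

(** The recurrence determines the coefficients. Together with
    [lnabs_recurrence], this turns Taylor coefficients of V into those of a formal
    exponential of derivatives of ln |V|. *)
Lemma exppoly_unique (v z : nat -> F) N :
  (forall j, (j < N)%N -> j.+1%:R * v j.+1 =
     \sum_(i < j.+1) v i * ((j - i).+1%:R * z (j - i).+1)) ->
  forall j, (j <= N)%N -> v j = v 0%N * (exppoly z N)`_j.
Proof.
move=> vE; elim/ltn_ind=> -[|j] IH jN; first by rewrite exppoly_coef0 mulr1.
have j0 : j.+1%:R != 0 :> F by rewrite pnatr_eq0.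
apply: (mulfI j0); rewrite vE// mulrCA exppoly_recurrence// mulr_sumr.
apply: eq_bigr => i _; rewrite IH ?mulrA//.
by apply: leq_trans (ltnW jN); rewrite -ltnS.
Qed.

End exponential_recurrence.

(** * The integrand near the origin *)

Section expansion_symbol.
Variable R : realType.
Implicit Types (ph ch : nat -> R) (sg e s : R).

(** [Dop] with arbitrary numbers in place of the derivatives of phi and log W. *)
Definition Dpoly ph ch sg (j : nat) : {poly R} :=
  (ph j.+2 / (j.+1 * j.+2)%:R) *: (sg^-1 *: 'X) ^+ j.+2
  + ch j *: (sg^-1 *: 'X) ^+ j.

(** The polynomial whose operator, applied to e^(-x^2/2), gives e^(-x^2/2) times
    the sum of the G_j(x) e^j. *)
Definition edgeworth_poly ph ch sg r e : {poly R} :=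
  \sum_(j < r.+1) ((- e) ^+ j / j`!%:R) *: complete_bell j (Dpoly ph ch sg).

Definition symbol_coef ph ch sg s i : R[i] :=
  (i`!%:R)^-1 * evalc (freq s) (Dpoly ph ch sg i).

(** The symbol of the expansion is a truncated exponential in the variable - e,
    to which [cexp_trunc] applies. *)
Lemma evalc_edgeworth ph ch sg r e s :
  evalc (freq s) (edgeworth_poly ph ch sg r e) =
  \sum_(j < r.+1) (exppoly (symbol_coef ph ch sg s) r)`_j * (- e%:C) ^+ j.
Proof.
rewrite /edgeworth_poly rmorph_sum /=; apply: eq_bigr => j _.
have jr : (j <= r)%N by rewrite -ltnS.
rewrite -/(evalc _ _) evalcZ evalc_complete_bell (exppoly_coef _ jr).
rewrite [RHS]mulrC mulrA; congr (_ * _).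
by rewrite rmorphM rmorphXn rmorphN fmorphV rmorph_nat mulfVK.
Qed.

Lemma symbol_coef_freq ph ch sg s i : symbol_coef ph ch sg s i =
  (ph i.+2 / i.+2`!%:R)%:C * ((s / sg)%:C * freq 1) ^+ i.+2
  + (ch i / i`!%:R)%:C * ((s / sg)%:C * freq 1) ^+ i.
Proof.
have fE : freq s = s%:C * freq 1.
  by apply: eq_complexP; rewrite ?cReMr ?cImMr /= ?mulr0// mulrN mulr1.
rewrite /symbol_coef /Dpoly evalcD !evalcZ.
have eE k : evalc (freq s) ((sg^-1 *: 'X) ^+ k) = ((s / sg)%:C * freq 1) ^+ k.
  by rewrite rmorphXn /= -/(evalc _ _) evalcZ evalcX fE mulrA -rmorphM [sg^-1 * s]mulrC.
have fV : (i`!%:R)^-1 = ((i`!%:R)^-1)%:C :> R[i] by rewrite fmorphV rmorph_nat.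
have E1 : (i`!%:R)^-1 * (ph i.+2 / (i.+1 * i.+2)%:R)%:C = (ph i.+2 / i.+2`!%:R)%:C :> R[i].
  rewrite fV -rmorphM !factS !natrM; apply: (congr1 (real_complex R)); field.
  by rewrite addrC natr1 -natrD add2n !pnatr_eq0 -lt0n fact_gt0.
have E2 : (i`!%:R)^-1 * (ch i)%:C = (ch i / i`!%:R)%:C :> R[i].
  by rewrite fV -rmorphM mulrC.
by rewrite !eE mulrDr [X in X + _ = _]mulrA [X in _ + X = _]mulrA E1 E2.
Qed.

(** With h = i s e / sg = - e (-is / sg), the Taylor terms of phi of order at
    least 3, divided by e^2, and the Taylor terms of log W add up to the argument
    of the formal exponential. The division by e^2 is the reason for the shift by
    two between the two summands of [Dop]. *)
Lemma symbol_sum ph ch sg s e r : e != 0 ->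
  \sum_(1 <= i < r.+1) symbol_coef ph ch sg s i * (- e%:C) ^+ i =
  ((e ^+ 2)^-1)%:C * (\sum_(3 <= j < r.+3) (ph j / j`!%:R)%:C * (0 +i* (s * e / sg)) ^+ j)
  + \sum_(1 <= i < r.+1) (ch i / i`!%:R)%:C * (0 +i* (s * e / sg)) ^+ i.
Proof.
move=> e0.
have hE : 0 +i* (s * e / sg) = - e%:C * ((s / sg)%:C * freq 1).
  apply: eq_complexP; rewrite mulNr ?cReN ?cImN !(cReMr, cImMr) /= ?mulr0 ?oppr0//.
  by rewrite mulrN1 mulrN opprK; ring.
rewrite hE [X in _ = _ * X + _]big_add1 /= [X in _ = _ * X + _]big_add1 /=.
rewrite mulr_sumr -big_split /=.
apply: eq_big_nat => i _.
have H : (e ^- 2)%:C * (- e%:C) ^+ i.+2 = (- e%:C) ^+ i :> R[i].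
  have -> : (- e%:C) ^+ i.+2 = (- e%:C) ^+ i * (e ^+ 2)%:C :> R[i].
    by rewrite -[i.+2]addn2 exprD sqrrN rmorphXn.
  by rewrite mulrCA -rmorphM /= mulVf ?expf_neq0// mulr1.
rewrite symbol_coef_freq; move: (_ * freq 1) => z.
rewrite mulrDl !(exprMn _ (- e%:C)); congr (_ + _).
  by rewrite -{1}H; ring.
by rewrite -mulrA [_ ^+ i * _ ^+ i]mulrC.
Qed.

End expansion_symbol.

Section pointwise_estimate.
Variables (R : realType) (r : nat) (M s0 : R).
Hypotheses (M1 : 1 <= M) (s00 : 0 < s0).
Variables (ph ch : nat -> R) (sg W0 : R).
Hypotheses (sgs0 : s0 <= sg).
Hypotheses (phM : forall j, (j <= r.+2)%N -> `|ph j| <= M).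
Hypotheses (chM : forall j, (j <= r)%N -> `|ch j| <= M).
Hypothesis W0M : `|W0| <= M.

Let M0 : 0 <= M. Proof. exact: le_trans M1. Qed.
Let sg0 : 0 < sg. Proof. exact: lt_le_trans sgs0. Qed.

Definition scale1 : R := 1 + s0^-1.

Let scale1_ge1 : 1 <= scale1.
Proof. by rewrite /scale1 lerDl invr_ge0 ltW. Qed.

Let scale1_ge0 : 0 <= scale1. Proof. exact: le_trans scale1_ge1. Qed.

Lemma div_sg_le s : 0 <= s -> s / sg <= scale1 * (1 + s).
Proof.
move=> s0'; apply: le_trans (_ : s / s0 <= _).
  by rewrite ler_wpM2l// lef_pV2.
rewrite /scale1 mulrC ler_pM ?invr_ge0 ?(ltW s00)//.
  by rewrite lerDr.
by rewrite lerDr.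
Qed.

Lemma fact_ge1 (j : nat) : 1 <= j`!%:R :> R.
Proof. by rewrite ler1n fact_gt0. Qed.

Lemma div_fact_le (x : R) (j : nat) : `|x| <= M -> `|x / j`!%:R| <= M.
Proof.
move=> xM; rewrite normrM normfV (ger0_norm (ler0n _ _)).
rewrite ler_pdivrMr ?ltr0n ?fact_gt0// (le_trans xM)// ler_peMr// fact_ge1//.
Qed.

Definition coef_bound s : R := 2 * M * (scale1 * (1 + s)) ^+ r.+2.

Lemma coef_bound_ge1 s : 0 <= s -> 1 <= coef_bound s.
Proof.
move=> s0'; have S1 : 1 <= scale1 * (1 + s) by rewrite mulr_ege1// lerDl.
rewrite /coef_bound mulr_ege1 ?exprn_ege1// (le_trans M1)// ler_peMl//.
by rewrite ler1n.
Qed.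

Lemma normc_freq1M s k : 0 <= s -> nc (((s / sg)%:C * freq 1) ^+ k) = (s / sg) ^+ k.
Proof.
move=> s0'; rewrite normcX Normc.normcM normcR normc_freq normr1 mulr1.
by rewrite ger0_norm// divr_ge0// ltW.
Qed.

Lemma symbol_coef_le s i : 0 <= s -> (i <= r)%N ->
  nc (symbol_coef ph ch sg s i) <= coef_bound s.
Proof.
move=> s0' ir; have S1 : 1 <= scale1 * (1 + s) by rewrite mulr_ege1// lerDl.
have pw k : (k <= r.+2)%N -> (s / sg) ^+ k <= (scale1 * (1 + s)) ^+ r.+2.
  move=> kr; apply: le_trans (_ : (scale1 * (1 + s)) ^+ k <= _).
    have a1 : 0 <= s / sg by rewrite divr_ge0// ltW.
    have a2 : 0 <= scale1 * (1 + s) := le_trans ler01 S1.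
    by rewrite lerXn2r ?nnegrE// div_sg_le.
  by rewrite ler_weXn2l.
rewrite symbol_coef_freq /coef_bound (mulr_natl M) mulr2n mulrDl.
apply: le_trans (le_normcD _ _) _; rewrite !(Normc.normcM (_%:C)) !normcR !normc_freq1M//.
apply: lerD; apply: ler_pM => //; rewrite ?exprn_ge0 ?divr_ge0 ?(ltW sg0)//.
- by apply: div_fact_le; exact: phM.
- exact: pw.
- by apply: div_fact_le; exact: chM.
- by apply: pw; rewrite ltnW// ltnW// ltnS.
Qed.

Lemma normc_edgeworth_le s e : 0 <= s -> 0 <= e <= 1 ->
  nc (evalc (freq s) (edgeworth_poly ph ch sg r e)) <=
  trunc_const R r * coef_bound s ^+ r.
Proof.
move=> s0' /andP[e0 e1]; rewrite evalc_edgeworth.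
apply: normc_exppoly_trunc_le => [||i /andP[_ ir]].
- exact: coef_bound_ge1.
- by rewrite -rmorphN normcR normrN ger0_norm.
- exact: symbol_coef_le.
Qed.

Lemma coef_boundX s k : coef_bound s ^+ k =
  (2 * M * scale1 ^+ r.+2) ^+ k * (1 + s) ^+ (r.+2 * k).
Proof.
by rewrite /coef_bound [X in 2 * M * X]exprMn mulrA [LHS]exprMn -exprM.
Qed.

Definition edgeworth_const : R :=
  M * (trunc_const R r * (2 * M * scale1 ^+ r.+2) ^+ r * ((r.+2 * r)`!%:R * expR 5)).

Lemma gkernel_edgeworth_le x s e : 0 <= s -> 0 <= e <= 1 ->
  `|gkernel (W0 *: edgeworth_poly ph ch sg r e) x s| <= edgeworth_const * expR (- s).
Proof.
move=> s0' e01; rewrite normrM (ger0_norm (expR_ge0 _)).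
apply: le_trans (_ : M * (trunc_const R r * coef_bound s ^+ r) * gexp s <= _).
  rewrite ler_wpM2r ?expR_ge0// (le_trans (le_Re_normc _))// Normc.normcM.
  rewrite normc_cexp_freq mulr1 evalcZ Normc.normcM normcR ler_pM ?normc_ge0//.
  exact: normc_edgeworth_le.
rewrite coef_boundX; set B := (2 * M * scale1 ^+ r.+2) ^+ r.
have B0 : 0 <= B by rewrite exprn_ge0// mulr_ge0 ?exprn_ge0// mulr_ge0.
have -> : M * (trunc_const R r * (B * (1 + s) ^+ (r.+2 * r))) * gexp s =
  M * (trunc_const R r * B) * ((1 + s) ^+ (r.+2 * r) * gexp s) by ring.
have -> : edgeworth_const * expR (- s) =
  M * (trunc_const R r * B) * ((r.+2 * r)`!%:R * expR 5 * expR (- s)).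
  by rewrite /edgeworth_const -/B; ring.
by rewrite ler_wpM2l ?gexp_le// mulr_ge0// mulr_ge0// trunc_const_ge0.
Qed.

(** For u in this range the Taylor terms of phi of order at least 3 are dominated
    by a fraction of the quadratic one: divided by e^2, they are at most s^2/16. *)
Definition window : R := Num.min 1 (s0 ^+ 2 / (16 * M * r.+1%:R)).

Lemma window_gt0 : 0 < window.
Proof.
rewrite lt_min ltr01 divr_gt0 ?exprn_gt0// !mulr_gt0//.
exact: lt_le_trans M1.
Qed.

(* [X1] stands for W_n(b + h), and [X2] for phi(b + h) minus its Taylor polynomial
   of degree 2. *)
Variables (e s : R) (X1 X2 : R[i]).
Hypotheses (e0 : 0 < e) (e1 : e <= 1) (s_ge0 : 0 <= s).
Let u := s * e / sg.
Let h : R[i] := 0 +i* u.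
Hypothesis u_le : u <= window.
Hypothesis X1_le :
  nc (X1 - W0%:C * \sum_(j < r.+1) ((exppoly (fun i => ch i / i`!%:R) r)`_j)%:C * h ^+ j)
  <= M * (u ^+ r.+1 + e ^+ r.+1).
Hypothesis X2_le :
  nc (X2 - \sum_(3 <= j < r.+3) (ph j / j`!%:R)%:C * h ^+ j) <= M * u ^+ r.+3.

(* In the exponent, [Q] comes from the Taylor polynomial of phi, [R1] from its
   remainder, and [T] from log W. *)
Let Q : R[i] := ((e ^+ 2)^-1)%:C * \sum_(3 <= j < r.+3) (ph j / j`!%:R)%:C * h ^+ j.
Let T : R[i] := \sum_(1 <= i < r.+1) (ch i / i`!%:R)%:C * h ^+ i.
Let R1 : R[i] := ((e ^+ 2)^-1)%:C * X2 - Q.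

Let u0 : 0 <= u. Proof. by rewrite divr_ge0 ?mulr_ge0 ?(ltW e0) ?(ltW sg0). Qed.

Let u1 : u <= 1.
Proof. by apply: le_trans u_le _; rewrite ge_min lexx. Qed.

Let nch : nc h = u.
Proof. by rewrite /h /= expr0n /= add0r sqrtr_sqr ger0_norm. Qed.

Let uS : u <= e * (scale1 * (1 + s)).
Proof.
have -> : u = e * (s / sg) by rewrite /u mulrAC mulrC.
by rewrite ler_wpM2l ?(ltW e0)// div_sg_le.
Qed.

Let S1 : 1 <= scale1 * (1 + s). Proof. by rewrite mulr_ege1// lerDl. Qed.

Let u2E : (e ^+ 2)^-1 * u ^+ 2 = (s / sg) ^+ 2.
Proof. by rewrite /u; field; rewrite !gt_eqF. Qed.

Let nce : nc ((e ^+ 2)^-1)%:C = (e ^+ 2)^-1.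
Proof. by rewrite normcR ger0_norm// invr_ge0 sqr_ge0. Qed.

Let ratio_le : (s / sg) ^+ 2 <= s ^+ 2 / s0 ^+ 2.
Proof.
rewrite expr_div_n ler_wpM2l ?sqr_ge0// lef_pV2 ?posrE ?exprn_gt0//.
by rewrite lerXn2r ?nnegrE ?(ltW sg0) ?(ltW s00).
Qed.

Let window_small : M * r.+1%:R * (window * (s / sg) ^+ 2) <= s ^+ 2 / 16.
Proof.
have Mr : 0 < M * r.+1%:R by rewrite mulr_gt0// (lt_le_trans _ M1).
apply: le_trans (_ : M * r.+1%:R * (s0 ^+ 2 / (16 * M * r.+1%:R) * (s ^+ 2 / s0 ^+ 2)) <= _).
  rewrite ler_wpM2l ?(ltW Mr)// ler_pM ?sqr_ge0 ?(ltW window_gt0)//.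
  by rewrite /window ge_min lexx orbT.
rewrite le_eqVlt; apply/orP; left; apply/eqP; field.
rewrite gt_eqF//=; rewrite -natr1 in Mr.
move: Mr; rewrite lt0r mulf_eq0 negb_or => /andP[/andP[-> +] _].
by rewrite addrC => ->.
Qed.

Let Q_le : nc Q <= M * r%:R * (window * (s / sg) ^+ 2).
Proof.
rewrite Normc.normcM nce.
apply: le_trans (_ : (e ^+ 2)^-1 * (\sum_(3 <= j < r.+3) M * (window * u ^+ 2)) <= _).
  rewrite ler_wpM2l ?invr_ge0 ?sqr_ge0//; apply: le_trans (normc_sum _ _ _) _.
  apply: ler_sum_nat => j /andP[j3 jr].
  rewrite Normc.normcM normcR normcX nch ler_pM ?exprn_ge0//.
    by apply: div_fact_le; apply: phM; rewrite -ltnS.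
  rewrite -(subnK (ltnW j3 : (2 <= j)%N)) exprD ler_wpM2r ?sqr_ge0//.
  apply: le_trans u_le; rewrite -[leRHS]expr1 ler_wiXn2l// subn_gt0.
  exact: j3.
rewrite big_const_nat iter_addr_0 !subSS subn0 -u2E -(mulr_natr (M * _)).
by rewrite le_eqVlt; apply/orP; left; apply/eqP; ring.
Qed.

Let R1_le : nc R1 <= M * (e ^+ r.+1 * (scale1 * (1 + s)) ^+ r.+3).
Proof.
rewrite /R1 /Q -mulrBr Normc.normcM nce.
apply: le_trans (_ : (e ^+ 2)^-1 * (M * u ^+ r.+3) <= _).
  by rewrite ler_wpM2l ?invr_ge0 ?sqr_ge0.
apply: le_trans (_ : (e ^+ 2)^-1 * (M * (e * (scale1 * (1 + s))) ^+ r.+3) <= _).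
  rewrite ler_wpM2l ?invr_ge0 ?sqr_ge0// ler_wpM2l// lerXn2r ?nnegrE//.
  exact: le_trans uS.
rewrite exprMn (_ : e ^+ r.+3 = e ^+ r.+1 * e ^+ 2); last by rewrite -exprD addn2.
rewrite le_eqVlt; apply/orP; left; apply/eqP; field.
by rewrite gt_eqF.
Qed.

Let R1_le2 : nc R1 <= M * (window * (s / sg) ^+ 2).
Proof.
rewrite /R1 /Q -mulrBr Normc.normcM nce.
apply: le_trans (_ : (e ^+ 2)^-1 * (M * u ^+ r.+3) <= _).
  by rewrite ler_wpM2l ?invr_ge0 ?sqr_ge0.
rewrite -u2E (_ : u ^+ r.+3 = u ^+ r.+1 * u ^+ 2); last by rewrite -exprD addn2.
have -> : M * (window * ((e ^+ 2)^-1 * u ^+ 2)) = (e ^+ 2)^-1 * (M * (window * u ^+ 2)) by ring.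
rewrite ler_wpM2l ?invr_ge0 ?sqr_ge0// ler_wpM2l// ler_wpM2r ?sqr_ge0//.
by apply: le_trans u_le; rewrite -[leRHS]expr1 ler_wiXn2l.
Qed.

Let QR1_le : nc Q + nc R1 <= s ^+ 2 / 16.
Proof.
apply: le_trans (lerD Q_le R1_le2) _; apply: le_trans window_small.
by rewrite -natr1 mulrDr mulr1 mulrDl.
Qed.

Let T_le : nc T <= r%:R * M.
Proof.
apply: le_trans (normc_sum _ _ _) _.
rewrite (_ : r%:R * M = \sum_(1 <= i < r.+1) M); last first.
  by rewrite big_const_nat iter_addr_0 subn1 /= mulr_natl.
apply: ler_sum_nat => i /andP[_ ir].
rewrite Normc.normcM normcR normcX nch -[leRHS]mulr1 ler_pM ?exprn_ge0//.
  by apply: div_fact_le; apply: chM; rewrite -ltnS.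
by rewrite exprn_ile1.
Qed.

Definition prefactor_const : R :=
  (M + M * (expansion_const R r * M ^+ r.+1 * expR (r%:R * M))) * scale1 ^+ r.+1 + M.
Definition remainder_const : R := 2 * M * M * expR (r%:R * M) * scale1 ^+ r.+3.
Definition symbol_const : R :=
  M * (expansion_const R r * (2 * M * scale1 ^+ r.+2) ^+ r.+1) * expR (r%:R * M).

Lemma expansion_const_ge0 : 0 <= expansion_const R r.
Proof. by rewrite addr_ge0 ?trunc_const_ge0// exprn_ge0// mulr_ge0. Qed.

Lemma prefactor_const_ge0 : 0 <= prefactor_const.
Proof.
have h1 := mulr_ge0 (mulr_ge0 expansion_const_ge0 (exprn_ge0 r.+1 M0)) (expR_ge0 (r%:R * M)).
exact: addr_ge0 (mulr_ge0 (addr_ge0 M0 (mulr_ge0 M0 h1)) (exprn_ge0 _ scale1_ge0)) M0.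
Qed.

Lemma remainder_const_ge0 : 0 <= remainder_const.
Proof.
have h1 := mulr_ge0 (mulr_ge0 (mulr_ge0 (ler0n R 2) M0) M0) (expR_ge0 (r%:R * M)).
exact: mulr_ge0 h1 (exprn_ge0 _ scale1_ge0).
Qed.

Lemma symbol_const_ge0 : 0 <= symbol_const.
Proof.
have h1 := exprn_ge0 r.+1 (mulr_ge0 (mulr_ge0 (ler0n R 2) M0) (exprn_ge0 r.+2 scale1_ge0)).
exact: mulr_ge0 (mulr_ge0 M0 (mulr_ge0 expansion_const_ge0 h1)) (expR_ge0 _).
Qed.

Let Sm (k : nat) : (k <= r.+3 ^ 2)%N -> (1 + s) ^+ k <= (1 + s) ^+ (r.+3 ^ 2).
Proof. by move=> kr; rewrite ler_weXn2l// lerDl. Qed.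

Let eQ : expR (nc Q + nc R1) <= expR (s ^+ 2 / 16).
Proof. by rewrite ler_expR. Qed.

Let pow_u : u ^+ r.+1 <= e ^+ r.+1 * (scale1 ^+ r.+1 * (1 + s) ^+ r.+1).
Proof.
by rewrite -!exprMn lerXn2r ?nnegrE// (le_trans u0 uS).
Qed.

Let term1 : nc (X1 - W0%:C * cexp T) <= prefactor_const * (e ^+ r.+1 * (1 + s) ^+ r.+1).
Proof.
pose E := \sum_(j < r.+1) ((exppoly (fun i => ch i / i`!%:R) r)`_j)%:C * h ^+ j.
have X1E : nc (X1 - W0%:C * E) <= M * (u ^+ r.+1 + e ^+ r.+1) := X1_le.
have ET : nc (cexp T - E) <= expansion_const R r * M ^+ r.+1 * u ^+ r.+1 * expR (r%:R * M).
  have zM i : (1 <= i <= r)%N -> nc (ch i / i`!%:R)%:C <= M.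
    by move=> /andP[_ ir]; rewrite normcR; apply: div_fact_le; exact: chM.
  have := @cexp_trunc R (fun i => (ch i / i`!%:R)%:C) r M h M1 _ zM.
  rewrite nch => /(_ u1) H.
  have -> : E = \sum_(j < r.+1) (exppoly (fun i => (ch i / i`!%:R)%:C) r)`_j * h ^+ j.
    apply: eq_bigr => j _; congr (_ * _).
    rewrite -(coef_map (real_complex R)); congr (polyseq _)`_ _.
    rewrite /exppoly rmorph_sum; apply: eq_bigr => m _ /=.
    rewrite map_polyZ /= fmorphV rmorph_nat rmorphXn; congr (_ *: _ ^+ _).
    rewrite /lowpoly rmorph_sum; apply: eq_bigr => i _ /=.
    by rewrite rmorphM /= map_polyC map_polyXn.
  apply: le_trans H _; rewrite ler_wpM2l ?ler_expR//.
  by rewrite !mulr_ge0 ?exprn_ge0 ?expansion_const_ge0.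
have -> : X1 - W0%:C * cexp T = (X1 - W0%:C * E) + - (W0%:C * (cexp T - E)) by ring.
apply: le_trans (le_normcD _ _) _; rewrite normcN Normc.normcM normcR.
have e_ge0 : 0 <= e ^+ r.+1 by rewrite exprn_ge0// ltW.
have S_ge1 : 1 <= (1 + s) ^+ r.+1 by rewrite exprn_ege1// lerDl.
set K := expansion_const R r * M ^+ r.+1 * expR (r%:R * M).
have K0 : 0 <= K by rewrite !mulr_ge0 ?exprn_ge0 ?expR_ge0 ?expansion_const_ge0.
apply: le_trans (_ : M * (u ^+ r.+1 + e ^+ r.+1) + M * (K * u ^+ r.+1) <= _).
  apply: lerD => //; apply: ler_pM => //; first exact: normc_ge0.
  by rewrite /K mulrAC.
have -> : M * (u ^+ r.+1 + e ^+ r.+1) + M * (K * u ^+ r.+1) =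
  (M + M * K) * u ^+ r.+1 + M * e ^+ r.+1 by ring.
rewrite /prefactor_const -/K [leRHS]mulrDl; apply: lerD.
  rewrite -mulrA; apply: ler_wpM2l; first by rewrite addr_ge0// (mulr_ge0 M0 K0).
  by rewrite mulrCA.
by rewrite ler_wpM2l// ler_peMr.
Qed.

Let term2 : nc (cexp R1 - 1) <= 2 * nc R1 * expR (nc R1).
Proof. by have := normc_cexp_sub_texp 1 R1; rewrite texp1 expr1. Qed.

Let term3 : nc (cexp (Q + T) - evalc (freq s) (edgeworth_poly ph ch sg r e)) <=
  expansion_const R r * coef_bound s ^+ r.+1 * e ^+ r.+1 * expR (nc Q + r%:R * M).
Proof.
have zM i : (1 <= i <= r)%N -> nc (symbol_coef ph ch sg s i) <= coef_bound s.
  by move=> /andP[_ ir]; exact: symbol_coef_le.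
have ne : nc (- e%:C) = e by rewrite -rmorphN normcR normrN gtr0_norm.
have := @cexp_trunc R _ r _ (- e%:C) (coef_bound_ge1 s_ge0) _ zM.
rewrite ne => /(_ e1); rewrite symbol_sum ?gt_eqF// evalc_edgeworth => H.
have cb0 : 0 <= coef_bound s := le_trans ler01 (coef_bound_ge1 s_ge0).
apply: le_trans H _; apply: ler_wpM2l.
- by rewrite !mulr_ge0 ?exprn_ge0 ?(ltW e0) ?expansion_const_ge0.
- by rewrite ler_expR (le_trans (le_normcD _ _))// lerD.
Qed.

Definition key_const : R := (prefactor_const + remainder_const + symbol_const) * ((r.+3 ^ 2)`!%:R * expR 5).

(** Three replacements, each with an error O(e^(r+1)): X1 by W0 exp T, the
    remainder R1 by 0, and exp (Q + T) by its expansion. The errors are polynomial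
    in s up to a factor e^(s^2/16), and the Gaussian reduces them to e^(-s). *)
Lemma key_estimate :
  nc (X1 * cexp (((e ^+ 2)^-1)%:C * X2)
      - W0%:C * evalc (freq s) (edgeworth_poly ph ch sg r e)) * gexp s
  <= key_const * e ^+ r.+1 * expR (- s).
Proof.
set P := evalc _ _.
have EX : ((e ^+ 2)^-1)%:C * X2 = Q + R1 by rewrite /R1 addrC subrK.
have -> : X1 * cexp (((e ^+ 2)^-1)%:C * X2) - W0%:C * P =
  (X1 - W0%:C * cexp T) * cexp (Q + R1) +
  (W0%:C * cexp (T + Q) * (cexp R1 - 1) + W0%:C * (cexp (Q + T) - P)).
  rewrite EX !cexpD; ring.
set A := e ^+ r.+1; set G := expR (s ^+ 2 / 16).
have A0 : 0 <= A by rewrite exprn_ge0// ltW.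
have G0 : 0 <= G by exact: expR_ge0.
have S0 : 0 <= 1 + s by rewrite addr_ge0.
(* (r + 3)^2 is at least as large as the three powers r + 1, r + 3 and
   (r + 2) (r + 1) of 1 + s that occur. *)
set Z := (1 + s) ^+ (r.+3 ^ 2).
have main : nc ((X1 - W0%:C * cexp T) * cexp (Q + R1) +
  (W0%:C * cexp (T + Q) * (cexp R1 - 1) + W0%:C * (cexp (Q + T) - P))) <=
  (prefactor_const + remainder_const + symbol_const) * (A * Z * G).
  apply: le_trans (le_normcD _ _) _; set x := A * Z * G.
  have -> : (prefactor_const + remainder_const + symbol_const) * x = prefactor_const * x + (remainder_const * x + symbol_const * x) by ring.
  rewrite /x; apply: lerD.
    rewrite Normc.normcM mulrA; apply: ler_pM; rewrite ?normc_ge0//.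
      apply: le_trans term1 _.
      rewrite ler_wpM2l ?prefactor_const_ge0// ler_wpM2l// Sm//.
      by rewrite expnS expn1 (@leq_trans r.+3)// ?leq_pmulr// ltnW.
    apply: le_trans (normc_cexp_le _) _; apply: le_trans eQ; rewrite ler_expR.
    exact: le_normcD.
  apply: le_trans (le_normcD _ _) _; apply: lerD.
    rewrite !Normc.normcM normcR.
    apply: le_trans (_ : M * expR (r%:R * M + nc Q) * (2 * (M * (A *
       (scale1 * (1 + s)) ^+ r.+3)) * expR (nc R1)) <= _).
      rewrite ler_pM ?mulr_ge0 ?normc_ge0//.
        rewrite ler_pM ?normc_ge0// (le_trans (normc_cexp_le _))// ler_expR.
        by rewrite (le_trans (le_normcD _ _))// lerD.
      apply: le_trans term2 _; rewrite ler_wpM2r ?expR_ge0// ler_wpM2l//.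
    rewrite expRD exprMn.
    have -> : M * (expR (r%:R * M) * expR (nc Q)) * (2 * (M * (A * (scale1 ^+ r.+3 *
       (1 + s) ^+ r.+3))) * expR (nc R1)) =
      remainder_const * (A * (1 + s) ^+ r.+3 * expR (nc Q + nc R1)).
      by rewrite expRD /remainder_const; ring.
    rewrite ler_wpM2l ?remainder_const_ge0// ler_pM ?(mulr_ge0 A0 (exprn_ge0 _ S0)) ?expR_ge0//.
    rewrite ler_wpM2l// Sm//.
    by rewrite expnS expn1 (@leq_trans r.+3)// ?leq_pmulr// ltnW.
  rewrite Normc.normcM normcR.
  apply: le_trans (_ : M * (expansion_const R r * coef_bound s ^+ r.+1 * A *
     expR (nc Q + r%:R * M)) <= _).
    by rewrite ler_pM ?normc_ge0.
  rewrite coef_boundX expRD.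
  set B := (2 * M * scale1 ^+ r.+2) ^+ r.+1.
  have -> : M * (expansion_const R r * (B * (1 + s) ^+ (r.+2 * r.+1)) * A *
      (expR (nc Q) * expR (r%:R * M))) =
    symbol_const * (A * (1 + s) ^+ (r.+2 * r.+1) * expR (nc Q)).
    by rewrite /symbol_const -/B; ring.
  rewrite ler_wpM2l ?symbol_const_ge0// ler_pM ?(mulr_ge0 A0 (exprn_ge0 _ S0)) ?expR_ge0//.
    by rewrite ler_wpM2l// Sm// expnS expn1 leq_mul// ltnW.
  by apply: le_trans eQ; rewrite ler_expR lerDl normc_ge0.
have c0 : 0 <= prefactor_const + remainder_const + symbol_const.
  exact: addr_ge0 (addr_ge0 prefactor_const_ge0 remainder_const_ge0) symbol_const_ge0.
apply: le_trans (_ : (prefactor_const + remainder_const + symbol_const) * (A * Z * G) * gexp s <= _).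
  by rewrite ler_wpM2r ?expR_ge0.
have -> : (prefactor_const + remainder_const + symbol_const) * (A * Z * G) * gexp s =
  (prefactor_const + remainder_const + symbol_const) * A * (Z * (G * gexp s)) by ring.
have -> : key_const * A * expR (- s) = (prefactor_const + remainder_const + symbol_const) * A *
   ((r.+3 ^ 2)`!%:R * expR 5 * expR (- s)) by rewrite /key_const; ring.
rewrite ler_wpM2l ?mulr_ge0//; apply: le_trans (gauss_moment_le _ s_ge0).
rewrite ler_wpM2l ?exprn_ge0// -expRD ler_expR.
have := sqr_ge0 s; lra.
Qed.

End pointwise_estimate.

(** * Fourier inversion for the Laplace transform of a profile *)

Section symmetric_sums.
Variable R : realType.
Implicit Types (f g : int -> R) (N n : nat).

(** The partial sums of [zsum]. *)
Definition psum (V : nmodType) (f : int -> V) N : V :=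
  \sum_(i < N.*2.+1) f (i%:Z - N%:Z).

Lemma psumS (V : nmodType) (f : int -> V) N :
  psum f N.+1 = psum f N + (f (- N.+1%:Z) + f N.+1%:Z).
Proof.
rewrite /psum doubleS big_ord_recl big_ord_recr /= sub0r.
rewrite (_ : (bump 0 (N.*2.+1)%N)%:Z - N.+1%:Z = N.+1%:Z); last first.
  by rewrite /bump /= add1n -addnn; lia.
rewrite addrCA; congr (_ + _); apply: eq_bigr => i _; congr f.
by rewrite /bump /= add1n; lia.
Qed.

Lemma psumE (V : nmodType) (f : int -> V) N :
  psum f N = f 0 + \sum_(n < N) (f (- n.+1%:Z) + f n.+1%:Z).
Proof.
elim: N => [|N IH]; first by rewrite /psum big_ord0 addr0 big_ord1 subrr.
by rewrite psumS IH -addrA [in RHS]big_ord_recr.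
Qed.

Lemma psum_delta f k N : (`|k| <= N)%N -> psum (fun m => f m *+ (m == k)) N = f k.
Proof.
move=> kN; have kb : (absz (k + N%:Z)%R < N.*2.+1)%N by rewrite -addnn; lia.
rewrite /psum (bigD1 (Ordinal kb))//= big1 ?addr0.
  have -> : (absz (k + N%:Z)%R)%:Z - N%:Z = k by lia.
  by rewrite eqxx.
move=> i /eqP ik; case: eqP => // E; exfalso; apply: ik; apply: val_inj => /=.
by rewrite -E; lia.
Qed.

Lemma psum_esum_le f : (forall k, 0 <= f k) ->
  (\esum_(k in [set: int]) (f k)%:E < +oo)%E ->
  forall N, psum f N <= fine (\esum_(k in [set: int]) (f k)%:E).
Proof.
move=> f0 foo N.
have e0 : (0 <= \esum_(k in [set: int]) (f k)%:E)%E by apply: esum_ge0 => k _; rewrite lee_fin.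
rewrite -lee_fin fineK ?ge0_fin_numE//.
pose s := [seq i%:Z - N%:Z | i <- iota 0 N.*2.+1].
have us : uniq s by rewrite map_inj_uniq ?iota_uniq// => i j /addIr [].
apply: esum_ge; exists [set` s]; first by split => //; exact: finite_seq.
rewrite fsbig_finite//=.
have E : psum f N = \sum_(k <- s) f k.
  by rewrite /psum /s big_map -[iota _ _]/(index_iota 0 N.*2.+1) big_mkord.
rewrite E -sumEFin; rewrite le_eqVlt; apply/orP; left; apply/eqP.
apply: perm_big; apply: uniq_perm => //; first exact: finmap.fset_uniq.
move=> k; rewrite in_fset_set//.
  by apply/idP/idP => [ks|]; [exact/mem_set|move/set_mem].
exact: finite_seq.
Qed.

(** Grouping the terms of indices n and - n reduces symmetric sums to the partial
    sums of an ordinary series. *)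
Lemma psum_cvg f g : (forall k, `|f k| <= g k) ->
  (\esum_(k in [set: int]) (g k)%:E < +oo)%E -> cvgn (psum f).
Proof.
move=> fg goo.
have g0 k : 0 <= g k by exact: le_trans (fg k).
pose d n := f (- n.+1%:Z) + f n.+1%:Z.
have cd : cvgn (series d).
  apply: normed_cvg.
  rewrite (_ : [normed series d] = fun N => \sum_(0 <= n < N) `|d n|)//.
  apply: nondecreasing_is_cvgn.
    apply/nondecreasing_seqP => n; rewrite big_nat_recr//= lerDl.
    exact: normr_ge0.
  exists (fine (\esum_(k in [set: int]) (g k)%:E)) => _ [N _ <-].
  apply: le_trans (psum_esum_le g0 goo N); rewrite psumE big_mkord.
  apply: le_trans (_ : \sum_(n < N) (g (- n.+1%:Z) + g n.+1%:Z) <= _); last by rewrite lerDr.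
  by apply: ler_sum => n _; rewrite (le_trans (ler_normD _ _))// lerD.
have -> : psum f = cst (f 0) + series d.
  by apply/funext => N; rewrite psumE /series /= fctE /= big_mkord.
by apply: is_cvgD => //; exact: is_cvg_cst.
Qed.

End symmetric_sums.

Section laplace_transform.
Variable R : realType.
Local Notation leb := (@lebesgue_measure R).
Variables (l : int -> R) (b : R).
Hypothesis lb : (\esum_(k in [set: int]) (`|l k| * expR (b * k%:~R))%:E < +oo)%E.

Definition laplace_mass : R :=
  fine (\esum_(k in [set: int]) (`|l k| * expR (b * k%:~R))%:E).

Definition laplace_term (z : R[i]) (k : int) : R[i] := (l k)%:C * cexp (z * k%:~R).

Lemma laplace_termE u k : laplace_term (b +i* u) k =
  (l k * expR (b * k%:~R) * cos (u * k%:~R)) +i* (l k * expR (b * k%:~R) * sin (u * k%:~R)).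
Proof.
have kE : k%:~R = (k%:~R : R)%:C by rewrite rmorph_int.
apply: eq_complexP; rewrite /laplace_term kE [_ * _%:C]mulrC ?cReMr ?cImMr /=.
  by rewrite !mul0r subr0 addr0 mulrA [k%:~R * b]mulrC [k%:~R * u]mulrC.
by rewrite !mul0r subr0 addr0 mulrA [k%:~R * b]mulrC [k%:~R * u]mulrC.
Qed.

Lemma normc_laplace_term u k :
  nc (laplace_term (b +i* u) k) = `|l k| * expR (b * k%:~R).
Proof.
have kE : k%:~R = (k%:~R : R)%:C by rewrite rmorph_int.
rewrite /laplace_term Normc.normcM normcR normc_cexp kE [(_ +i* _) * _]mulrC cReMr /=.
by rewrite [k%:~R * b]mulrC.
Qed.

Lemma cRe_psum (f : int -> R[i]) N :
  complex.Re (psum f N) = psum (fun k => complex.Re (f k)) N.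
Proof. exact: cRe_sum. Qed.

Lemma cIm_psum (f : int -> R[i]) N :
  complex.Im (psum f N) = psum (fun k => complex.Im (f k)) N.
Proof. exact: cIm_sum. Qed.

Lemma zlaplace_cvg u :
  (fun N => complex.Re (psum (laplace_term (b +i* u)) N)) @ \oo
     --> complex.Re (zlaplace l (b +i* u)) /\
  (fun N => complex.Im (psum (laplace_term (b +i* u)) N)) @ \oo
     --> complex.Im (zlaplace l (b +i* u)).
Proof.
pose t := laplace_term (b +i* u).
have cr : cvgn (psum (fun k => complex.Re (t k))).
  by apply: psum_cvg lb => k; rewrite -(normc_laplace_term u); exact: le_Re_normc.
have ci : cvgn (psum (fun k => complex.Im (t k))).
  by apply: psum_cvg lb => k; rewrite -(normc_laplace_term u); exact: le_Im_normc.
pose z := limn (psum (fun k => complex.Re (t k))) +i* limn (psum (fun k => complex.Im (t k))).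
have cz : (psum t : nat -> R[i]^o) @ \oo --> (z : R[i]^o).
  apply/cvg_complexP; split.
    by under eq_fun do rewrite cRe_psum.
  by under eq_fun do rewrite cIm_psum.
have <- : z = zlaplace l (b +i* u) by apply/esym; exact: (cvg_lim _ cz).
by apply/cvg_complexP.
Qed.

Lemma normc_psum_le u N : nc (psum (laplace_term (b +i* u)) N) <= laplace_mass.
Proof.
apply: le_trans (normc_sum _ _ _) _.
rewrite (eq_bigr (fun i : 'I_(N.*2.+1) =>
  `|l (i%:Z - N%:Z)| * expR (b * (i%:Z - N%:Z)%:~R))); last first.
  by move=> i _; rewrite normc_laplace_term.
by apply: (psum_esum_le _ lb N) => k; rewrite mulr_ge0 ?expR_ge0.
Qed.

Lemma cIm_zlaplace_real : complex.Im (zlaplace l b%:C) = 0.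
Proof.
have [_ ci] := zlaplace_cvg 0.
have c0 : (fun N => complex.Im (psum (laplace_term (b +i* 0)) N)) @ \oo --> (0 : R).
  rewrite (_ : (fun _ => _) = fun=> 0); first exact: cvg_cst.
  apply/funext => N; rewrite cIm_psum /psum big1// => i _.
  by rewrite laplace_termE /= mul0r sin0 mulr0.
exact: (cvg_unique _ ci c0).
Qed.

(** As l is real, the real part over [0, pi] does duty for the integral over
    [-pi, pi]. *)
Definition fourier_integrand (k : int) (u : R) : R :=
  complex.Re (zlaplace l (b +i* u) * cexp ((k%:~R)%:C * freq u)).

Definition partial_integrand (k : int) N (u : R) : R :=
  complex.Re (psum (laplace_term (b +i* u)) N * cexp ((k%:~R)%:C * freq u)).

Lemma partial_integrandE k N u : partial_integrand k N u =
  psum (fun m => l m * expR (b * m%:~R) * cos ((m - k)%:~R * u)) N.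
Proof.
rewrite /partial_integrand cexp_freq /psum mulr_suml cRe_sum.
apply: eq_bigr => i _; rewrite laplace_termE cReM /=.
set m := i%:Z - N%:Z; have -> : (m - k)%:~R = m%:~R - k%:~R :> R by rewrite intrB.
by rewrite mulrBl cosB [u * _]mulrC; ring.
Qed.

Lemma partial_integrand_cvg k u :
  partial_integrand k N u @[N --> \oo] --> fourier_integrand k u.
Proof.
have [cr ci] := zlaplace_cvg u.
rewrite /partial_integrand /fourier_integrand cReM.
under eq_fun do rewrite cReM.
by apply: cvgB; apply: cvgM => //; exact: cvg_cst.
Qed.

Lemma partial_integrand_le k N u : `|partial_integrand k N u| <= laplace_mass.
Proof.
apply: le_trans (le_Re_normc _) _.
by rewrite Normc.normcM normc_cexp_freq mulr1 normc_psum_le.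
Qed.

Lemma continuous_partial_integrand k N : continuous (partial_integrand k N).
Proof.
have H : ccontinuous (fun u => psum (laplace_term (b +i* u)) N * cexp ((k%:~R)%:C * freq u)).
  apply: ccontinuousM; last exact: ccontinuous_cexp_freq.
  apply: ccontinuous_sum => i; apply: ccontinuousM; first exact: ccontinuous_cst.
  apply: ccontinuous_cexp; apply: ccontinuousM; last exact: ccontinuous_cst.
  by apply: ccontinuous_Complex => u; [exact: cvg_cst|exact: cvg_id].
by case: H.
Qed.

Lemma measurable_partial_integrand k N : measurable_fun [set: R] (partial_integrand k N).
Proof. by apply: continuous_measurable_fun; exact: continuous_partial_integrand. Qed.

Lemma measurable_fourier_integrand k : measurable_fun [set: R] (fourier_integrand k).
Proof.
apply: (@measurable_fun_cvg _ _ _ _ (partial_integrand k)).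
  exact: measurable_partial_integrand.
by move=> u _; exact: partial_integrand_cvg.
Qed.

Lemma normc_zlaplace_le u : nc (zlaplace l (b +i* u)) <= 2 * laplace_mass.
Proof.
have [cr ci] := zlaplace_cvg u; apply: le_trans (normc_le_ReIm _) _.
rewrite mulr_natl mulr2n; apply: lerD.
  have cn : (fun N => `|complex.Re (psum (laplace_term (b +i* u)) N)|) @ \oo
      --> `|complex.Re (zlaplace l (b +i* u))| by exact: cvg_norm cr.
  apply: (ler_cvg_to cn (cvg_cst _)); apply: nearW => N.
  exact: le_trans (le_Re_normc _) (normc_psum_le u N).
have cn : (fun N => `|complex.Im (psum (laplace_term (b +i* u)) N)|) @ \oo
    --> `|complex.Im (zlaplace l (b +i* u))| by exact: cvg_norm ci.
apply: (ler_cvg_to cn (cvg_cst _)); apply: nearW => N.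
exact: le_trans (le_Im_normc _) (normc_psum_le u N).
Qed.

Lemma measurable_normc_zlaplace : measurable_fun [set: R] (fun u => nc (zlaplace l (b +i* u))).
Proof.
rewrite (_ : (fun _ => _) = fun u => Num.sqrt (complex.Re (zlaplace l (b +i* u)) ^+ 2
    + complex.Im (zlaplace l (b +i* u)) ^+ 2)); last first.
  by apply/funext => u; case: (zlaplace _ _).
have cc N : ccontinuous (fun u => psum (laplace_term (b +i* u)) N).
  apply: ccontinuous_sum => i; apply: ccontinuousM; first exact: ccontinuous_cst.
  apply: ccontinuous_cexp; apply: ccontinuousM; last exact: ccontinuous_cst.
  by apply: ccontinuous_Complex => u; [exact: cvg_cst|exact: cvg_id].
apply: (@measurableT_comp _ _ _ _ _ _ (@Num.sqrt R)).
  by apply: continuous_measurable_fun; exact: sqrt_continuous.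
apply: measurable_funD; apply: measurable_funX.
  apply: (@measurable_fun_cvg _ _ _ _ (fun N u => complex.Re (psum (laplace_term (b +i* u)) N))).
    by move=> N; apply: continuous_measurable_fun; case: (cc N).
  by move=> u _; case: (zlaplace_cvg u).
apply: (@measurable_fun_cvg _ _ _ _ (fun N u => complex.Im (psum (laplace_term (b +i* u)) N))).
  by move=> N; apply: continuous_measurable_fun; case: (cc N).
by move=> u _; case: (zlaplace_cvg u).
Qed.

Lemma integral_cos (j : int) :
  \int[leb]_(u in `[0, pi]) cos (j%:~R * u) = pi *+ (j == 0).
Proof.
have [->|j0] := eqVneq j 0.
  under eq_Rintegral do rewrite mul0r cos0.
  by rewrite Rintegral_cst//= lebesgue_measure_itv/= lte_fin pi_gt0 mul1r/= subr0.
have jR : j%:~R != 0 :> R by rewrite intr_eq0.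
have dS (u : R) : is_derive u 1 (fun u : R => j%:~R^-1 * sin (j%:~R * u)) (cos (j%:~R * u)).
  have d1 : is_derive u 1 (fun u : R => j%:~R * u) j%:~R.
    by apply: is_derive_eq; rewrite /GRing.scale /=; ring.
  have d2 : is_derive u 1 (fun u : R => sin (j%:~R * u)) (j%:~R * cos (j%:~R * u)).
    by rewrite mulrC; apply: is_derive1_comp.
  rewrite (_ : cos _ = j%:~R^-1 *: (j%:~R * cos (j%:~R * u))).
    exact: is_deriveZ.
  by rewrite /GRing.scale /= mulrA mulVf// mul1r.
have cS : continuous (fun u : R => j%:~R^-1 * sin (j%:~R * u)).
  move=> u; apply: differentiable_continuous; apply/derivable1_diffP.
  by have := dS u => ?; exact: ex_derive.
rewrite /Rintegral (@continuous_FTC2 _ _ (fun u => j%:~R^-1 * sin (j%:~R * u)))//.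
- rewrite mulr0 sin0 mulr0 sube0 /=.
  have -> : sin (j%:~R * pi) = 0 :> R.
    have sn (n : nat) : sin (n%:R * pi) = 0 :> R.
      elim: n => [|n IH]; first by rewrite mul0r sin0.
      by rewrite -natr1 mulrDl mul1r sinD IH sinpi mul0r mulr0 addr0.
    case: j {j0 jR dS cS} => n; first exact: sn.
    by rewrite NegzE intrN mulNr sinN (sn n.+1) oppr0.
  by rewrite mulr0.
- exact: pi_gt0.
- apply: continuous_subspaceT => u.
  apply: (@continuous_comp _ _ _ (fun u : R => j%:~R * u) (@cos R)).
    by apply: cvgM; [exact: cvg_cst|exact: cvg_id].
  exact: continuous_cos.
- split.
  + by move=> u _; have := dS u => ?; exact: ex_derive.
  + by apply: cvg_at_right_filter; exact: cS.
  + by apply: cvg_at_left_filter; exact: cS.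
- by move=> u _; rewrite derive1E; have := dS u => ?; exact: derive_val.
Qed.

Lemma integrable_itv_continuous (f : R -> R) (x y : R) : continuous f ->
  leb.-integrable `[x, y] (EFin \o f).
Proof.
move=> cf; apply: continuous_compact_integrable; first exact: segment_compact.
exact: continuous_subspaceT.
Qed.

Lemma continuous_ord_sum n (f : nat -> R -> R) : (forall i, continuous (f i)) ->
  continuous (fun u => \sum_(i < n) f i u).
Proof.
move=> cf; elim: n => [|n IH].
  rewrite (_ : (fun _ => _) = fun=> 0); first by move=> u; exact: cvg_cst.
  by apply/funext => u; rewrite big_ord0.
rewrite (_ : (fun _ => _) = fun u => \sum_(i < n) f i u + f n u).
  by move=> u; apply: cvgD; [exact: IH|exact: cf].
by apply/funext => u; rewrite big_ord_recr.
Qed.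

Lemma Rintegral_ord_sum n (f : nat -> R -> R) (x y : R) :
  (forall i, continuous (f i)) ->
  \int[leb]_(u in `[x, y]) (\sum_(i < n) f i u) =
  \sum_(i < n) \int[leb]_(u in `[x, y]) f i u.
Proof.
move=> cf; elim: n => [|n IH].
  under eq_Rintegral do rewrite big_ord0.
  by rewrite big_ord0 Rintegral_cst// mul0r.
under eq_Rintegral do rewrite big_ord_recr /=.
rewrite RintegralD//=; last 2 first.
- by apply: integrable_itv_continuous; exact: continuous_ord_sum.
- exact: integrable_itv_continuous.
by rewrite IH big_ord_recr.
Qed.

Lemma integral_partial k N : (`|k| <= N)%N ->
  \int[leb]_(u in `[0, pi]) partial_integrand k N u = pi * (l k * expR (b * k%:~R)).
Proof.
move=> kN; under eq_Rintegral do rewrite partial_integrandE /psum.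
pose c m : R := l m * expR (b * m%:~R).
have cosc (j : int) : continuous (fun u : R => cos (j%:~R * u)).
  move=> u; apply: (@continuous_comp _ _ _ (fun u : R => j%:~R * u) (@cos R)).
    by apply: cvgM; [exact: cvg_cst|exact: cvg_id].
  exact: continuous_cos.
rewrite (@Rintegral_ord_sum N.*2.+1
  (fun i u => c (i%:Z - N%:Z) * cos ((i%:Z - N%:Z - k)%:~R * u))); last first.
  by move=> i u; apply: cvgM; [exact: cvg_cst|exact: cosc].
transitivity (psum (fun m => (pi * c m) *+ (m == k)) N); last by rewrite psum_delta.
apply: eq_bigr => i _; rewrite RintegralZl//; last exact: integrable_itv_continuous.
by rewrite integral_cos subr_eq0 mulrC; case: eqP => _; rewrite ?mul0r.
Qed.

Lemma integrable_fourier_integrand k (x y : R) :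
  leb.-integrable `[x, y] (EFin \o fourier_integrand k).
Proof.
apply: measurable_bounded_integrable => //.
- by apply: compact_finite_measure; exact: segment_compact.
- exact: measurable_funTS (measurable_fourier_integrand k).
- exists (2 * laplace_mass); split; first exact: num_real.
  move=> B MB u _; apply: le_trans (ltW MB); apply: le_trans (le_Re_normc _) _.
  by rewrite Normc.normcM normc_cexp_freq mulr1 normc_zlaplace_le.
Qed.

(** For the partial sums this is orthogonality ([integral_cos]); they are bounded
    by [laplace_mass], so that dominated convergence applies. *)
Theorem fourier_inversion k :
  \int[leb]_(u in `[0, pi]) fourier_integrand k u = pi * (l k * expR (b * k%:~R)).
Proof.
have ic : leb.-integrable `[0, pi] (EFin \o cst laplace_mass).
  by apply: integrable_itv_continuous => u; exact: cvg_cst.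
have mp N : measurable_fun (`[0, (pi : R)] : set R) (fun u => (partial_integrand k N u)%:E).
  by apply/measurable_EFinP; exact: measurable_funTS (measurable_partial_integrand k N).
have mf : measurable_fun (`[0, (pi : R)] : set R) (EFin \o fourier_integrand k).
  by apply/measurable_EFinP; exact: measurable_funTS (measurable_fourier_integrand k).
have [||_ _] := @dominated_convergence _ (measurableTypeR R) R leb _ (measurable_itv `[0, pi])
  _ _ (EFin \o cst laplace_mass) mp mf _ ic.
- apply: aeW => u _; apply: cvg_EFin; first by apply: nearW.
  exact: partial_integrand_cvg.
- by apply: aeW => u N _; rewrite lee_fin; exact: partial_integrand_le.
move=> cv; rewrite /Rintegral.
have cc : (\int[leb]_(u in `[0%R, pi]) (partial_integrand k N u)%:E)%E @[N --> \oo] -->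
   (pi * (l k * expR (b * k%:~R)))%:E.
  apply: cvg_near_cst; exists `|k|%N => // N /= kN.
  rewrite -(integral_partial kN) /Rintegral fineK//.
  apply: integrable_fin_num => //; apply: integrable_itv_continuous.
  exact: continuous_partial_integrand.
by rewrite (cvg_unique _ cv cc).
Qed.

End laplace_transform.

(** * The expansion of a single profile *)

Section polynomiality.
Variable R : realType.

(** The usual Hermite polynomials multiplied by (-1)^i, so that the derivatives of
    e^(-x^2/2) carry no sign. *)
Fixpoint hermite i : {poly R} :=
  if i is i'.+1 then (hermite i')^`() - 'X * hermite i' else 1.

Lemma size_hermite i : (size (hermite i) <= i.+1)%N.
Proof.
elim: i => [|i IH] /=; first by rewrite size_poly1.
apply: leq_trans (size_polyD _ _) _; rewrite geq_max size_polyN; apply/andP; split.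
  apply: (@leq_trans (size (hermite i)).-1); first exact: size_poly.
  by apply: leq_trans (leq_pred _) _; rewrite ltnW.
apply: leq_trans (size_polyMleq _ _) _; rewrite size_polyX add2n /=.
by rewrite ltnS.
Qed.

Lemma derive1n_gexp_hermite i (x : R) :
  derive1n i (@gexp R) x = (hermite i).[x] * gexp x.
Proof.
elim: i x => [|i IH] x; first by rewrite derive1n0 /= hornerC mul1r.
rewrite derive1nS derive1E (_ : derive1n i (@gexp R) = (horner (hermite i)) * (@gexp R)).
  have dG := is_derive_gexp x.
  have dP := is_derive_poly (hermite i) x.
  rewrite (@derive_val _ _ _ _ _ _ _ (@is_deriveM _ _ _ _ _ _ _ _ dP dG)).
  rewrite [hermite i.+1]/= hornerD hornerN hornerM hornerX /GRing.scale /=; ring.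
by apply/funext => y; rewrite IH.
Qed.

(** This growth of the degrees is stable under products; it holds for the
    operators because i + 2 <= 3 i for i >= 1. *)
Definition weight3 (p : {poly {poly R}}) := forall i : nat, (size (p`_i)%R <= (3 * i).+1)%N.

Lemma weight3_1 : weight3 1.
Proof. by move=> i; rewrite coef1; case: i => [|i]; rewrite ?size_poly1// size_poly0. Qed.

Lemma weight3M p q : weight3 p -> weight3 q -> weight3 (p * q).
Proof.
move=> pw qw i; rewrite coefM; apply: leq_trans (size_sum _ _ _) _.
apply/bigmax_leqP => k _; apply: leq_trans (size_polyMleq _ _) _.
have ki : (k <= i)%N by rewrite -ltnS.
have := pw k; have := qw (i - k)%N; lia.
Qed.

Lemma weight3X p n : weight3 p -> weight3 (p ^+ n).
Proof.
move=> pw; elim: n => [|n IH]; first by rewrite expr0; exact: weight3_1.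
by rewrite exprS; exact: weight3M.
Qed.

Lemma size_Dpoly ph ch sg (i : nat) : (0 < i)%N ->
  (size (Dpoly ph ch sg i : {poly R}) <= (3 * i).+1)%N.
Proof.
move=> i0; have sz k c : (k <= 3 * i)%N -> (size (c *: (sg^-1 *: 'X : {poly R}) ^+ k) <= (3 * i).+1)%N.
  move=> ki; apply: leq_trans (size_scale_leq _ _) _; rewrite exprZn.
  by apply: leq_trans (size_scale_leq _ _) _; rewrite size_polyXn.
apply: leq_trans (size_polyD _ _) _; rewrite geq_max !sz//; lia.
Qed.

Lemma size_complete_bell ph ch sg j :
  (size (complete_bell j (Dpoly ph ch sg) : {poly R}) <= (3 * j).+1)%N.
Proof.
apply: leq_trans (size_scale_leq _ _) _; apply: leq_trans (size_sum _ _ _) _.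
apply/bigmax_leqP => m _; apply: leq_trans (size_scale_leq _ _) _.
apply: weight3X => i; rewrite coef_sum; apply: leq_trans (size_sum _ _ _) _.
rewrite big_nat_cond; elim/big_ind: _ => // [x y|k /andP[/andP[k0 _] _]].
  by rewrite geq_max => -> ->.
rewrite mul_polyC coefZ coefXn; case: eqP => [->|_]; last by rewrite mulr0 size_poly0.
by rewrite mulr1 (leq_trans (size_scale_leq _ _))// size_Dpoly.
Qed.

Lemma Gpoly_polynomial (phi W : R[i] -> R[i]) j b :
  exists2 p : {poly R}, (size p <= (3 * j).+1)%N & forall x, Gpoly phi W j b x = p.[x].
Proof.
pose B := complete_bell j (Dop phi W b).
have sB : (size B <= (3 * j).+1)%N.
  exact: (size_complete_bell (fun j => derive1n j (on_real phi) b) (fun j => chi W j b)).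
exists (((-1) ^+ j / j`!%:R) *: \sum_(i < size B) B`_i *: hermite i).
  apply: leq_trans (size_scale_leq _ _) _; apply: leq_trans (size_sum _ _ _) _.
  apply/bigmax_leqP => i _; apply: leq_trans (size_scale_leq _ _) _.
  apply: leq_trans (size_hermite i) _; exact: leq_trans sB.
move=> x; rewrite hornerZ horner_sum /Gpoly -mulrA; congr (_ * _).
rewrite /diffop -/(@gexp R) mulr_sumr; apply: eq_bigr => i _.
rewrite hornerZ derive1n_gexp_hermite mulrCA; congr (_ * _).
by rewrite mulrCA /gexp -expRD subrr expR0 mulr1.
Qed.

End polynomiality.

Section linear_substitution.
Variable R : realType.
Local Notation leb := (@lebesgue_measure R).

Lemma Rintegral_scale (G : R -> R) (c a : R) : 0 < c -> 0 <= a -> continuous G ->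
  \int[leb]_(u in `[0, a]) G (u * c) = c^-1 * \int[leb]_(s in `[0, a * c]) G s.
Proof.
move=> c0 a0 cG; pose F u : R := u * c.
have dF (u : R) : is_derive u 1 F c.
  by apply: is_derive_eq; rewrite /GRing.scale /=; ring.
have F'E : derive1 F = cst c.
  by apply/funext => u; rewrite derive1E; have := dF u => ?; exact: derive_val.
have cF : continuous F.
  by move=> u; apply: cvgM; [exact: cvg_id|exact: cvg_cst].
have E : (\int[leb]_(s in `[F 0%R, F a]) (G s)%:E = \int[leb]_(u in `[0%R, a]) (((G \o F) * derive1 F) u)%:E)%E.
  apply: integration_by_substitution_increasing => //.
  - by move=> x y _ _ xy; rewrite /F ltr_pM2r.
  - by rewrite F'E => x _; exact: cvg_cst.
  - by rewrite F'E; exact: is_cvg_cst.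
  - by rewrite F'E; exact: is_cvg_cst.
  - split.
    + by move=> u _; have := dF u => ?; exact: ex_derive.
    + by apply: cvg_at_right_filter; exact: cF.
    + by apply: cvg_at_left_filter; exact: cF.
  - exact: continuous_subspaceT.
have -> : \int[leb]_(s in `[0, a * c]) G s = \int[leb]_(u in `[0, a]) (G (u * c) * c).
  rewrite /Rintegral; congr fine.
  have F0 : F 0 = 0 by rewrite /F mul0r.
  rewrite F0 in E; rewrite [LHS]E.
  by apply: eq_integral => u _; rewrite F'E.
rewrite RintegralZr//; first by rewrite mulrC mulfK// gt_eqF.
apply: integrable_itv_continuous => u.
by apply: (@continuous_comp _ _ _ F G); [exact: cF|exact: cG].
Qed.

Lemma Rintegral_expN_le (a : R) : 0 <= a ->
  \int[leb]_(s in `[0, a]) expR (- s) <= 1.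
Proof.
move=> a0.
have H : \int[leb]_(s in `[0, +oo[) expR (- s) = 1.
  by rewrite /Rintegral integral_expRN oppr0 expR0.
rewrite -[leRHS]H -subr_ge0 Rintegral_itvB ?bnd_simp//.
  by apply: Rintegral_ge0 => s _; exact: expR_ge0.
exact: integrable_expRN.
Qed.

End linear_substitution.

Section profile_error.
Variables (R : realType) (r : nat) (M s0 a : R).
Local Notation leb := (@lebesgue_measure R).
Hypotheses (M1 : 1 <= M) (s00 : 0 < s0).
Hypotheses (a0 : 0 < a) (a_window : a <= window r M s0) (a_pi : a <= pi).

Variables (phi W : R[i] -> R[i]) (w : R) (l : int -> R) (b : R).
Hypothesis w1 : 1 <= w.
Hypothesis lb : (\esum_(k in [set: int]) (`|l k| * expR (b * k%:~R))%:E < +oo)%E.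

Let e : R := (Num.sqrt w)^-1.
Let sg := sigma phi b.
Let ph j := derive1n j (on_real phi) b.
Let ch j := chi W j b.
Let W0 := on_real W b.

Hypothesis sgs0 : s0 <= sg.
Hypothesis ph2 : 0 <= ph 2.
Hypothesis phM : forall j, (j <= r.+2)%N -> `|ph j| <= M.
Hypothesis chM : forall j, (j <= r)%N -> `|ch j| <= M.
Hypothesis W0M : `|W0| <= M.

Hypothesis X1_le : forall u, 0 <= u <= a ->
  nc (Wnorm phi w l (b +i* u)
    - W0%:C * \sum_(j < r.+1) ((exppoly (fun i => ch i / i`!%:R) r)`_j)%:C * (0 +i* u) ^+ j)
  <= M * (u ^+ r.+1 + e ^+ r.+1).

Hypothesis X2_le : forall u, 0 <= u <= a ->
  nc (phi (b +i* u) - \sum_(j < r.+3) (ph j / j`!%:R)%:C * (0 +i* u) ^+ j)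
  <= M * u ^+ r.+3.

Variable delta : R.
Hypothesis tail_le :
  \int[leb]_(u in `[a, pi]) (expR (- (on_real phi b * w)) * nc (zlaplace l (b +i* u))) <= delta.

Variable k : int.
Let x := xnorm phi w k b.

Let w0 : 0 < w. Proof. exact: lt_le_trans w1. Qed.
Let sqw0 : 0 < Num.sqrt w. Proof. by rewrite sqrtr_gt0. Qed.
Let e0 : 0 < e. Proof. by rewrite invr_gt0. Qed.
Let e1 : e <= 1.
Proof.
rewrite invf_le1//; have := ler_wsqrtr w1.
by rewrite sqrtr1.
Qed.
Let sg0 : 0 < sg. Proof. exact: lt_le_trans sgs0. Qed.
Let M0 : 0 <= M. Proof. exact: le_trans M1. Qed.

Let e2 : (e ^+ 2)^-1 = w.
Proof. by rewrite /e exprVn invrK sqr_sqrtr// ltW. Qed.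

Let powR_half (j : nat) : w `^ (j%:R / 2) = (e ^+ j)^-1.
Proof.
by rewrite mulrC powRrM powR12_sqrt ?(ltW w0)// powR_mulrn ?sqrtr_ge0// /e exprVn invrK.
Qed.

Let sg2 : sg ^+ 2 = ph 2.
Proof. by rewrite /sg /sigma sqr_sqrtr. Qed.

Let p := W0 *: edgeworth_poly ph ch sg r e.

(** The claimed approximation is the integral of the Gaussian kernel over the
    whole half line. *)
Let main_term : on_real W b * expR (- (xnorm phi w k b ^+ 2 / 2))
    / (sigma phi b * Num.sqrt (2 * pi * w))
    * \sum_(j < r.+1) Gpoly phi W j b (xnorm phi w k b) / w `^ (j%:R / 2)
  = pi^-1 * (e / sg * gtransform p x).
Proof.
rewrite -/x -/sg -/W0.
have lin (q1 q2 : {poly R}) c : diffop (q1 + c *: q2) (@gexp R) x =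
    diffop q1 (@gexp R) x + c * diffop q2 (@gexp R) x.
  by rewrite !diffop_gexp gtransformD gtransformZ; ring.
have d0 : diffop 0 (@gexp R) x = 0 by rewrite /diffop size_poly0 big_ord0.
have E n : \sum_(j < n) Gpoly phi W j b x / w `^ (j%:R / 2) =
    expR (x ^+ 2 / 2) * diffop (\sum_(j < n)
      ((- e) ^+ j / j`!%:R) *: complete_bell j (Dpoly ph ch sg)) (@gexp R) x.
  elim: n => [|n IH]; first by rewrite !big_ord0 d0 mulr0.
  rewrite !big_ord_recr /= IH lin mulrDr; congr (_ + _).
  rewrite powR_half invrK (_ : Gpoly phi W n b x = (-1) ^+ n / n`!%:R * expR (x ^+ 2 / 2) *
    diffop (complete_bell n (Dpoly ph ch sg)) (@gexp R) x)// (exprNn e); ring.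
rewrite E -/(edgeworth_poly ph ch sg r e) /p gtransformZ diffop_gexp.
have -> : W0 * expR (- (x ^+ 2 / 2)) / (sg * Num.sqrt (2 * pi * w)) *
  (expR (x ^+ 2 / 2) * ((half_gauss R)^-1 * gtransform (edgeworth_poly ph ch sg r e) x)) =
  W0 * (expR (- (x ^+ 2 / 2)) * expR (x ^+ 2 / 2)) / (sg * Num.sqrt (2 * pi * w)) *
  ((half_gauss R)^-1 * gtransform (edgeworth_poly ph ch sg r e) x) by ring.
rewrite -expRD addNr expR0 mulr1.
have hp : 0 <= 2 * pi :> R by rewrite mulr_ge0// pi_ge0.
rewrite sqrtrM// /half_gauss /e.
have pE : pi = Num.sqrt (2 * pi) * Num.sqrt (2 * pi) / 2 :> R.
  by rewrite -expr2 sqr_sqrtr//; field.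
have q0 : 0 < Num.sqrt (2 * pi) :> R by rewrite sqrtr_gt0 mulr_gt0// pi_gt0.
have piV : pi^-1 = 2 / (Num.sqrt (2 * pi) * Num.sqrt (2 * pi)) :> R.
  by rewrite [in LHS]pE invf_div.
rewrite piV; move: (Num.sqrt (2 * pi)) q0 => q q0; field.
by rewrite !gt_eqF.
Qed.

Let integrand u : R := expR (- (on_real phi b * w)) * fourier_integrand l b k u.

Let lhs_integral : expR (b * k%:~R - on_real phi b * w) * l k =
  pi^-1 * \int[leb]_(u in `[0, pi]) integrand u.
Proof.
rewrite RintegralZl//; last exact: integrable_fourier_integrand.
rewrite fourier_inversion// expRD.
have p0 : pi != 0 :> R by rewrite gt_eqF// pi_gt0.
by rewrite [expR _ * (pi * _)]mulrCA mulKf//; ring.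
Qed.

Let integrand_le u : `|integrand u| <=
  expR (- (on_real phi b * w)) * nc (zlaplace l (b +i* u)).
Proof.
rewrite normrM (ger0_norm (expR_ge0 _)) ler_wpM2l ?expR_ge0//.
by rewrite (le_trans (le_Re_normc _))// Normc.normcM normc_cexp_freq mulr1.
Qed.

(** Change of variables: of the Taylor terms of phi, the one of degree 2 gives
    the Gaussian, while the one of degree 1 merges with e^(-iku) into the
    frequency x. *)
Let integrandE u : integrand u =
  complex.Re (Wnorm phi w l (b +i* u) *
    cexp (((e ^+ 2)^-1)%:C * (phi (b +i* u) - \sum_(j < 3) (ph j / j`!%:R)%:C * (0 +i* u) ^+ j))
    * cexp (x%:C * freq (u * (sg / e)))) * gexp (u * (sg / e)).
Proof.
have zE : zlaplace l (b +i* u) = cexp (phi (b +i* u) * w%:C) * Wnorm phi w l (b +i* u).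
  by rewrite /Wnorm mulrA -cexpD subrr cexp0 mul1r.
rewrite /integrand /fourier_integrand -cReMr zE.
have -> : (expR (- (on_real phi b * w)))%:C = cexp (- (on_real phi b * w))%:C by rewrite cexpR.
have -> : complex.Re (Wnorm phi w l (b +i* u) *
    cexp (((e ^+ 2)^-1)%:C * (phi (b +i* u) - \sum_(j < 3) (ph j / j`!%:R)%:C * (0 +i* u) ^+ j))
    * cexp (x%:C * freq (u * (sg / e)))) * gexp (u * (sg / e)) =
  complex.Re ((cexp (- ((u * (sg / e)) ^+ 2 / 2))%:C) * (Wnorm phi w l (b +i* u) *
    cexp (((e ^+ 2)^-1)%:C * (phi (b +i* u) - \sum_(j < 3) (ph j / j`!%:R)%:C * (0 +i* u) ^+ j))
    * cexp (x%:C * freq (u * (sg / e))))).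
  by rewrite cexpR cReMr mulrC.
congr (complex.Re _).
set Z := Wnorm _ _ _ _; set f := phi (b +i* u).
have -> : cexp (- (on_real phi b * w))%:C * (cexp (f * w%:C) * Z * cexp ((k%:~R)%:C * freq u))
  = Z * cexp ((- (on_real phi b * w))%:C + f * w%:C + (k%:~R)%:C * freq u).
  by rewrite !cexpD; ring.
set S := \sum_(j < 3) _.
have -> : cexp (- ((u * (sg / e)) ^+ 2 / 2))%:C * (Z * cexp (((e ^+ 2)^-1)%:C * (f - S)) *
   cexp (x%:C * freq (u * (sg / e)))) =
  Z * cexp ((- ((u * (sg / e)) ^+ 2 / 2))%:C + ((e ^+ 2)^-1)%:C * (f - S) +
    x%:C * freq (u * (sg / e))).
  by rewrite !cexpD; ring.
congr (_ * cexp _); rewrite e2.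
have SE : S = (on_real phi b - ph 2 / 2 * u ^+ 2) +i* (ph 1 * u).
  rewrite /S !big_ord_recr big_ord0 /= add0r expr0 expr1 fact0 expr2.
  apply: eq_complexP; rewrite !(cReD, cImD, cReM, cImM) /=.
    by rewrite /ph derive1n0 (_ : 2`! = 2)//; field.
  by rewrite (_ : 1`! = 1)//; field.
have xE : x * (u * (sg / e)) = (k%:~R - ph 1 * w) * u.
  rewrite /x /xnorm -/sg /mu -derive1n1 -/(ph 1) /e; field.
  by rewrite !gt_eqF.
have sE : (u * (sg / e)) ^+ 2 = u ^+ 2 * ph 2 * w.
  rewrite !exprMn -e2 -sg2 exprVn; ring.
rewrite SE sE.
have -> : x%:C * freq (u * (sg / e)) = freq ((k%:~R - ph 1 * w) * u).
  by rewrite -xE; apply: eq_complexP; rewrite ?cReMr ?cImMr /= ?mulr0// mulrN.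
apply: eq_complexP; case: f => f1 f2; rewrite !(cReD, cImD, cReM, cImM, cReN, cImN) /=; field.
all: by [].
Qed.

Let near_le u : 0 <= u <= a ->
  `|integrand u - gkernel p x (u * (sg / e))| <=
  key_const r M s0 * e ^+ r.+1 * expR (- (u * (sg / e))).
Proof.
move=> /andP[u0 ua]; set s := u * (sg / e).
have s_ge0 : 0 <= s by rewrite mulr_ge0// divr_ge0// ltW.
have us : s * e / sg = u by rewrite /s; field; rewrite !gt_eqF.
rewrite integrandE /gkernel -/s -mulrBl normrM (ger0_norm (expR_ge0 _)).
rewrite -cReN -cReD -mulNr -mulrDl.
set X2 := phi _ - _.
have ua' : s * e / sg <= window r M s0 by rewrite us (le_trans ua).
have H1 := X1_le (introT andP (conj u0 ua)).
have H2 : nc (X2 - \sum_(3 <= j < r.+3) (ph j / j`!%:R)%:C * (0 +i* (s * e / sg)) ^+ j)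
    <= M * (s * e / sg) ^+ r.+3.
  rewrite us; apply: le_trans (X2_le (introT andP (conj u0 ua))).
  rewrite /X2 -[in leRHS](big_mkord xpredT (fun j => (ph j / j`!%:R)%:C * (0 +i* u) ^+ j)).
  rewrite -[in leLHS](big_mkord xpredT (fun j => (ph j / j`!%:R)%:C * (0 +i* u) ^+ j)).
  by rewrite [in leRHS](@big_cat_nat _ _ _ 3)//= opprD addrA.
rewrite -us in H1.
have := key_estimate M1 s00 sgs0 phM chM W0M e0 e1 s_ge0 ua' H1 H2.
apply: le_trans; rewrite ler_wpM2r ?expR_ge0// (le_trans (le_Re_normc _))//.
by rewrite Normc.normcM normc_cexp_freq mulr1 us evalcZ.
Qed.

(** The first summand integrates the local error. The second one bounds the
    Gaussian integral beyond s = a sg / e, where e^(-y) <= (r+1)! / y^(r+1). *)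
Definition error_const : R := s0^-1 * (key_const r M s0
  + edgeworth_const r M s0 * (r.+1`!%:R / (a * s0) ^+ r.+1)).

Let e01 : 0 <= e <= 1. Proof. by rewrite (ltW e0) e1. Qed.

Let ec0 : 0 <= edgeworth_const r M s0.
Proof.
have := gkernel_edgeworth_le M1 s00 sgs0 phM chM W0M 0 (lexx 0) e01.
by move/(le_trans (normr_ge0 _)); rewrite oppr0 expR0 mulr1.
Qed.

Let kc0 : 0 <= key_const r M s0.
Proof.
have := @near_le 0; rewrite lexx (ltW a0) => /(_ isT)/(le_trans (normr_ge0 _)).
by rewrite mul0r oppr0 expR0 mulr1 pmulr_lge0// exprn_gt0.
Qed.

(** The difference of the two integrals consists of the tail of the first one, of
    the local error on [0, a], and of the tail of the Gaussian integral. The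
    factor e / sg of the substitution raises the order of the local error from
    r + 1 to r + 2. *)
Lemma profile_error :
  `|expR (b * k%:~R - on_real phi b * w) * l k
    - on_real W b * expR (- (xnorm phi w k b ^+ 2 / 2))
      / (sigma phi b * Num.sqrt (2 * pi * w))
      * \sum_(j < r.+1) Gpoly phi W j b (xnorm phi w k b) / w `^ (j%:R / 2)|
  <= error_const * e ^+ r.+2 + delta.
Proof.
rewrite main_term lhs_integral -mulrBr normrM.
have pi1 : `|pi^-1| <= 1 :> R.
  rewrite ger0_norm ?invr_ge0 ?pi_ge0// invf_le1 ?pi_gt0//.
  by apply: le_trans (pi_ge2 R); rewrite ler1n.
rewrite -[leRHS]mul1r ler_pM//.
pose m u := gkernel p x (u * (sg / e)).
have c0 : 0 < sg / e by rewrite divr_gt0.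
have cm : continuous m.
  move=> u; apply: (@continuous_comp _ _ _ (fun u : R => u * (sg / e)) (gkernel p x)).
    by apply: cvgM; [exact: cvg_id|exact: cvg_cst].
  exact: continuous_gkernel.
have ii (y z : R) : leb.-integrable `[y, z] (EFin \o integrand).
  rewrite (_ : EFin \o integrand = (fun u => (expR (- (on_real phi b * w)))%:E *
    (fourier_integrand l b k u)%:E)%E)//.
  by apply: integrableZl => //; exact: integrable_fourier_integrand.
have im (y z : R) : leb.-integrable `[y, z] (EFin \o m) by exact: integrable_itv_continuous.
have split1 : \int[leb]_(u in `[0, pi]) integrand u - e / sg * gtransform p x =
  (\int[leb]_(u in `[0, pi]) integrand u - \int[leb]_(u in `[0, a]) integrand u)
  + (\int[leb]_(u in `[0, a]) (integrand u - m u))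
  + - (e / sg * (gtransform p x - \int[leb]_(s in `[0, a * (sg / e)]) gkernel p x s)).
  rewrite RintegralB//= /m Rintegral_scale ?(ltW a0)//; last exact: continuous_gkernel.
  by rewrite invf_div; ring.
rewrite split1.
have b1 : `|\int[leb]_(u in `[0, pi]) integrand u - \int[leb]_(u in `[0, a]) integrand u| <= delta.
  rewrite Rintegral_itvB ?bnd_simp ?(ltW a0)//.
  have iap : leb.-integrable `]a, pi] (EFin \o integrand).
    by apply: integrableS (ii a pi) => // u; rewrite /= !in_itv /= => /andP[/ltW -> ->].
  apply: le_trans (le_normr_Rintegral _ iap) _ => //.
  apply: le_trans tail_le; rewrite Rintegral_itv_obnd_cbnd; last exact: integrable_norm.
  apply: le_Rintegral => //.
  - exact: integrable_norm.
  - apply: measurable_bounded_integrable => //.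
    + by apply: compact_finite_measure; exact: segment_compact.
    + apply: measurable_funM => //.
      exact: measurable_funTS (measurable_normc_zlaplace lb).
    + exists (expR (- (on_real phi b * w)) * (2 * laplace_mass l b)); split; first exact: num_real.
      move=> B MB u _; apply: le_trans (ltW MB).
      rewrite normrM (ger0_norm (expR_ge0 _)) ler_wpM2l ?expR_ge0//.
      by rewrite ger0_norm ?normc_ge0// normc_zlaplace_le.
have b2 : `|\int[leb]_(u in `[0, a]) (integrand u - m u)| <=
    key_const r M s0 * e ^+ r.+1 * (e / sg).
  have id : leb.-integrable `[0, a] (EFin \o (fun u => integrand u - m u)).
    rewrite (_ : _ \o _ = (fun u => (integrand u)%:E - (m u)%:E)%E)//.
    exact: integrableB.
  apply: le_trans (le_normr_Rintegral _ id) _ => //.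
  have cx : continuous (fun u : R => expR (- (u * (sg / e)))).
    move=> u; apply: (@continuous_comp _ _ _ (fun u : R => u * (sg / e)) (fun s => expR (- s))).
      by apply: cvgM; [exact: cvg_id|exact: cvg_cst].
    exact: continuous_expRN.
  apply: le_trans (_ : \int[leb]_(u in `[0, a]) (key_const r M s0 * e ^+ r.+1 *
      expR (- (u * (sg / e)))) <= _).
    apply: le_Rintegral => //.
    - exact: integrable_norm.
    - apply: integrable_itv_continuous => u; apply: cvgM; first exact: cvg_cst.
      exact: cx.
  rewrite RintegralZl//; last exact: integrable_itv_continuous.
  rewrite ler_wpM2l ?(mulr_ge0 kc0 (exprn_ge0 _ (ltW e0)))//.
  have -> : \int[leb]_(u in `[0, a]) expR (- (u * (sg / e))) =
      (sg / e)^-1 * \int[leb]_(s in `[0, a * (sg / e)]) expR (- s).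
    exact: (@Rintegral_scale _ (fun s => expR (- s)) _ _ c0 (ltW a0) (@continuous_expRN R)).
  rewrite invf_div -[leRHS]mulr1 ler_wpM2l ?divr_ge0 ?(ltW e0) ?(ltW sg0)//.
  by rewrite Rintegral_expN_le// mulr_ge0// ltW.
have A0 : 0 < a * (sg / e) by rewrite mulr_gt0.
have b3 : `|- (e / sg * (gtransform p x - \int[leb]_(s in `[0, a * (sg / e)]) gkernel p x s))|
   <= e / sg * (edgeworth_const r M s0 * (r.+1`!%:R / (a * s0) ^+ r.+1 * e ^+ r.+1)).
  rewrite normrN normrM ger0_norm; last by rewrite divr_ge0// ltW.
  apply: ler_wpM2l; first by rewrite divr_ge0// ltW.
  apply: le_trans (Rintegral_expdom_tail (@measurable_gkernel _ _ _)
    (fun s s_ge0 => gkernel_edgeworth_le M1 s00 sgs0 phM chM W0M x s_ge0 e01) (ltW A0)) _.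
  rewrite ler_wpM2l// expRN.
  have := exprn_fact_le r.+1 (ltW A0) => H.
  apply: le_trans (_ : r.+1`!%:R / (a * (sg / e)) ^+ r.+1 <= _).
    rewrite -div1r ler_pdivrMr ?expR_gt0// mulrAC ler_pdivlMr ?exprn_gt0//.
    by rewrite mul1r.
  rewrite (mulrA a) expr_div_n invf_div -mulrA ler_wpM2l// mulrC.
  rewrite ler_wpM2r ?exprn_ge0 ?(ltW e0)// lef_pV2 ?posrE ?exprn_gt0 ?mulr_gt0//.
  by rewrite lerXn2r ?nnegrE ?mulr_ge0 ?(ltW a0) ?(ltW s00) ?(ltW sg0)// ler_wpM2l// ltW.
apply: le_trans (ler_normD _ _) _; apply: le_trans (lerD (ler_normD _ _) (lexx _)) _.
apply: le_trans (lerD (lerD b1 b2) b3) _.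
rewrite -addrA addrC lerD2r.
have es : e / sg <= e / s0 by rewrite ler_wpM2l ?(ltW e0)// lef_pV2.
have -> : error_const * e ^+ r.+2 = key_const r M s0 * e ^+ r.+1 * (e / s0) +
  e / s0 * (edgeworth_const r M s0 * (r.+1`!%:R / (a * s0) ^+ r.+1 * e ^+ r.+1)).
  by rewrite /error_const (exprS e r.+1); ring.
apply: lerD.
  by rewrite ler_wpM2l// (mulr_ge0 kc0 (exprn_ge0 _ (ltW e0))).
have q0 : 0 <= r.+1`!%:R / (a * s0) ^+ r.+1 by rewrite divr_ge0// exprn_ge0// mulr_ge0// ltW.
by rewrite ler_wpM2r// (mulr_ge0 ec0 (mulr_ge0 q0 (exprn_ge0 _ (ltW e0)))).
Qed.

End profile_error.

(** * Uniformity on compact sets *)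

(** A compact set is covered by finitely many neighbourhoods with a local bound;
    the largest of these bounds works everywhere. *)
Lemma compact_uniform (R : realType) (K : set R) (Q : R -> R -> Prop) :
  compact K -> (forall x M M', M <= M' -> Q x M -> Q x M') ->
  (forall x, K x -> exists M, \forall y \near x, Q y M) ->
  exists2 M, 1 <= M & forall x, K x -> Q x M.
Proof.
move=> /compact_near_coveringP cK Q_mono Q_loc.
have /(pinfty_ex_ge (num_real 1)) : \forall M \near +oo, K `<=` (fun x => Q x M).
  apply: cK => x /Q_loc[M QM].
  exists ([set y | Q y M], [set M' | M <= M']) => /=.
    by split=> //; exact: nbhs_pinfty_ge (num_real M).
  by move=> [y M'] /= [Qy MM']; exact: Q_mono MM' Qy.
by case=> M [M1 KQ]; exists M.
Qed.

Section uniform_bounds.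
Variables (R : realType) (J K : set R).
Hypotheses (J_open : open J) (K_compact : compact K) (KJ : K `<=` J).

(** The inverse of M serves as the radius of validity, so that a single monotone
    parameter makes [compact_uniform] applicable. *)
Lemma taylor_uniform (f : R[i] -> R[i]) N :
  (forall b : R, J b -> analytic_at f b%:C) ->
  (forall b : R, J b -> complex.Im (f b%:C) = 0) ->
  exists2 M, 1 <= M & forall b, K b ->
    (forall j, (j <= N)%N -> `|derive1n j (on_real f) b| <= M) /\
    (forall h, nc h <= M^-1 ->
       nc (f (b%:C + h) - \sum_(j < N) (derive1n j (on_real f) b / j`!%:R)%:C * h ^+ j)
       <= M * nc h ^+ N).
Proof.
move=> f_an f_real.
pose Q b M := 0 < M /\ (forall j, (j <= N)%N -> `|derive1n j (on_real f) b| <= M) /\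
    (forall h, nc h <= M^-1 ->
       nc (f (b%:C + h) - \sum_(j < N) (derive1n j (on_real f) b / j`!%:R)%:C * h ^+ j)
       <= M * nc h ^+ N).
suff: exists2 M, 1 <= M & forall b, K b -> Q b M.
  by case=> M M1 H; exists M => // b /H[].
apply: compact_uniform => // [b M M' MM' [M0 [dM tM]]|b0 Kb0].
  have M'0 : 0 < M' := lt_le_trans M0 MM'.
  split=> //; split=> [j jN|h hM']; first exact: le_trans (dM j jN) MM'.
  apply: le_trans (tM h _) _; last by rewrite ler_wpM2r// exprn_ge0// normc_ge0.
  by apply: le_trans hM' _; rewrite lef_pV2.
have Jb0 := KJ Kb0.
have re : \forall b \near b0, complex.Im (f b%:C) = 0.
  by have := open_nbhs_nbhs (conj J_open Jb0); apply: filterS => b; exact: f_real.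
have [rho rho0 [_ /(_ N)[M HM]]] := analytic_taylor (f_an _ Jb0) re.
exists (Num.max M rho^-1).
have /near_dist_lt : `|b0 - b0| < rho by rewrite subrr normr0.
apply: filterS => b brho; have [dM tM] := HM b brho.
have M0 : 0 < Num.max M rho^-1 by rewrite lt_max invr_gt0 rho0 orbT.
split=> //; split=> [j jN|h hM]; first by rewrite le_max dM.
apply: le_trans (tM h _) _; last by rewrite ler_wpM2r ?exprn_ge0 ?normc_ge0// le_max lexx.
by apply: le_trans hM _; rewrite invf_ple ?posrE// le_max lexx orbT.
Qed.

Lemma sigma_uniform (phi : R[i] -> R[i]) :
  (forall b : R, J b -> analytic_at phi b%:C) ->
  (forall b : R, J b -> complex.Im (phi b%:C) = 0) ->
  (forall b : R, J b -> 0 < derive1n 2 (on_real phi) b) ->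
  exists2 s0, 0 < s0 & forall b, K b -> s0 <= sigma phi b.
Proof.
move=> phi_an phi_real phi_convex.
pose Q b M := 0 < M /\ M^-1 <= derive1n 2 (on_real phi) b.
suff [M M1 H]: exists2 M, 1 <= M & forall b, K b -> Q b M.
  exists (Num.sqrt M^-1); first by rewrite sqrtr_gt0 invr_gt0 (lt_le_trans _ M1).
  by move=> b /H[_]; exact: ler_wsqrtr.
apply: compact_uniform => // [b M M' MM' [M0 QM]|b0 Kb0].
  split; first exact: lt_le_trans MM'.
  by apply: le_trans QM; rewrite lef_pV2// posrE (lt_le_trans M0).
have Jb0 := KJ Kb0.
have re : \forall b \near b0, complex.Im (phi b%:C) = 0.
  by have := open_nbhs_nbhs (conj J_open Jb0); apply: filterS => b; exact: phi_real.
have [rho rho0 [dphi _]] := analytic_taylor (phi_an _ Jb0) re.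
have c0 := phi_convex _ Jb0.
have cont : {for b0, continuous (derive1n 2 (on_real phi))}.
  have b0rho : `|b0 - b0| < rho by rewrite subrr normr0.
  have := dphi 2%N b0 b0rho => -[/derivable1_diffP/differentiable_continuous] //.
exists (derive1n 2 (on_real phi) b0 / 2)^-1.
have half : derive1n 2 (on_real phi) b0 / 2 < derive1n 2 (on_real phi) b0.
  by rewrite ltr_pdivrMr// ltr_pMr// ltr1n.
have : \forall b \near b0, derive1n 2 (on_real phi) b0 / 2 < derive1n 2 (on_real phi) b.
  exact: cont (lt_nbhsr half).
apply: filterS => b hb; split; last by rewrite invrK; exact: ltW hb.
by rewrite invr_gt0; apply: mulr_gt0 c0 _; rewrite invr_gt0.
Qed.

(** The derivatives of ln |W| are continuous, hence locally bounded. The second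
    part rests on V' = V (ln |V|)' for V = [on_real W]. *)
Lemma chi_uniform (W : R[i] -> R[i]) r :
  (forall b : R, J b -> analytic_at W b%:C) ->
  (forall b : R, J b -> complex.Im (W b%:C) = 0) ->
  (forall b : R, J b -> W b%:C != 0) ->
  (exists2 M, 1 <= M & forall b, K b -> forall j, (j <= r)%N -> `|chi W j b| <= M) /\
  (forall b, K b -> forall j, (j <= r)%N ->
     derive1n j (on_real W) b / j`!%:R =
     on_real W b * (exppoly (fun i => chi W i b / i`!%:R) r)`_j).
Proof.
move=> W_an W_real W_neq0.
have V_neq0 b : J b -> on_real W b != 0.
  move=> Jb; apply: contra (W_neq0 _ Jb) => /eqP; rewrite /on_real => re0.
  by apply/eqP/eq_complexP; [exact: re0|exact: W_real].
have loc b0 : K b0 -> exists2 rho, 0 < rho &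
    (forall j, deriv_on b0 rho (derive1n j (on_real W)) (derive1n j.+1 (on_real W))) /\
    (forall x, `|x - b0| < rho -> on_real W x != 0).
  move=> Kb0; have Jb0 := KJ Kb0.
  have re : \forall b \near b0, complex.Im (W b%:C) = 0.
    by have := open_nbhs_nbhs (conj J_open Jb0); apply: filterS => b; exact: W_real.
  have [rho1 rho10 [dW _]] := analytic_taylor (W_an _ Jb0) re.
  have /nbhs_ballP[rho2 /= rho20 rho2J] := open_nbhs_nbhs (conj J_open Jb0).
  exists (Num.min rho1 rho2); first by rewrite lt_min rho10.
  split=> [j x|x]; rewrite lt_min => /andP[x1 x2]; first exact: dW.
  by apply/V_neq0/rho2J; rewrite /ball/= distrC.
split; last first.
  move=> b Kb j jr; have [rho rho0 [dW neq0]] := loc _ Kb.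
  have brho : `|b - b| < rho by rewrite subrr normr0.
  rewrite (@exppoly_unique _ (fun j => derive1n j (on_real W) b / j`!%:R)
    (fun i => chi W i b / i`!%:R) r _ j jr) /= ?fact0 ?divr1//.
  move=> i ir.
  have := lnabs_recurrence dW neq0 i brho.
  have fct m (y : R) : m.+1%:R * (y / m.+1`!%:R) = y / m`!%:R.
    by rewrite factS natrM invfM mulrCA mulVKf// pnatr_eq0.
  rewrite fct => ->; apply: eq_bigr => k _.
  by rewrite fct /chi.
pose Q b M := forall j, (j <= r)%N -> `|chi W j b| <= M.
apply: (@compact_uniform _ _ Q) => // [b M M' MM' QM j jr|b0 Kb0].
  exact: le_trans (QM j jr) MM'.
have [rho rho0 [dW neq0]] := loc _ Kb0.
have b0rho : `|b0 - b0| < rho by rewrite subrr normr0.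
exists (\sum_(j < r.+1) (`|chi W j b0| + 1)).
have nb (j : 'I_r.+1) : \forall b \near b0, `|chi W j b| <= `|chi W j b0| + 1.
  have [/derivable1_diffP/differentiable_continuous cont _] :=
    deriv_lnabs dW neq0 j b0rho.
  have /cvgrPdist_le/(_ 1 ltr01) := cont.
  apply: filterS => b /= hb.
  have := ler_normB (chi W j b0) (chi W j b0 - chi W j b).
  by rewrite subKr => /le_trans; apply; rewrite lerD2l.
have : \forall b \near b0, forall j : 'I_r.+1, `|chi W j b| <= `|chi W j b0| + 1.
  exact: (@filter_forall R 'I_r.+1 (fun j b => `|chi W j b| <= `|chi W j b0| + 1)
    (nbhs b0) (nbhs_filter b0) nb).
apply: filterS => b hb j jr.
have jr1 : (j < r.+1)%N by rewrite ltnS.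
apply: le_trans (hb (Ordinal jr1)) _ => /=.
rewrite (bigD1 (Ordinal jr1))//= lerDl; apply: sumr_ge0 => i _.
by rewrite addr_ge0.
Qed.

Lemma limit_uniform (W : R[i] -> R[i]) r :
  (forall b : R, J b -> analytic_at W b%:C) ->
  (forall b : R, J b -> complex.Im (W b%:C) = 0) ->
  (forall b : R, J b -> W b%:C != 0) ->
  exists2 M, 1 <= M & forall b, K b ->
    [/\ (forall j, (j <= r)%N -> `|chi W j b| <= M), `|on_real W b| <= M &
    forall h, nc h <= M^-1 -> nc (W (b%:C + h) - (on_real W b)%:C *
        \sum_(j < r.+1) ((exppoly (fun i => chi W i b / i`!%:R) r)`_j)%:C * h ^+ j)
      <= M * nc h ^+ r.+1].
Proof.
move=> W_an W_real W_neq0.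
have [M1 M11 H1] := @taylor_uniform W r.+1 W_an W_real.
have [[M2 M21 H2] HE] := @chi_uniform W r W_an W_real W_neq0.
exists (Num.max M1 M2); first by rewrite le_max M11.
move=> b Kb; have [dM tM] := H1 b Kb; split.
- by move=> j jr; rewrite le_max H2// orbT.
- by rewrite le_max (dM 0%N).
move=> h hM; rewrite mulr_sumr.
rewrite (eq_bigr (fun j : 'I_r.+1 => (derive1n j (on_real W) b / j`!%:R)%:C * h ^+ j)).
  apply: le_trans (tM h _) _.
    by apply: le_trans hM _; rewrite lef_pV2 ?posrE ?lt_max ?(lt_le_trans _ M11)// le_max lexx.
  by rewrite ler_wpM2r ?exprn_ge0 ?normc_ge0// le_max lexx.
move=> j _; rewrite (HE _ Kb) ?mulrA -?rmorphM//.
by rewrite -ltnS.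
Qed.

End uniform_bounds.

Section nnsup_lemmas.
Variables (R : realType) (I : Type) (A : set I) (f : I -> \bar R).
Local Open Scope ereal_scope.

Lemma nnsup_ge0 : 0 <= nnsup A f.
Proof. by apply: ereal_sup_ubound; left. Qed.

Lemma nnsup_ge i : A i -> f i <= nnsup A f.
Proof. by move=> Ai; apply: ereal_sup_ubound; right; exists i. Qed.

Lemma nnsup_le B : 0 <= B -> (forall i, A i -> f i <= B) -> nnsup A f <= B.
Proof.
by move=> B0 fB; apply: ge_ereal_sup => _ [->//|[i Ai <-]]; exact: fB.
Qed.

End nnsup_lemmas.

Section pathwise.
Variables (R : realType) (phi W : R[i] -> R[i]) (w : nat -> R) (l : nat -> int -> R).
Variables (J K : set R) (r : nat) (C a0 : R).
Hypotheses (J_open : open J) (K_compact : compact K) (KJ : K `<=` J).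
Hypothesis w_cvg : w @ \oo --> +oo.
Hypothesis phi_an : forall b : R, J b -> analytic_at phi b%:C.
Hypothesis phi_real : forall b : R, J b -> complex.Im (phi b%:C) = 0.
Hypothesis phi_convex : forall b : R, J b -> 0 < derive1n 2 (on_real phi) b.
Hypothesis W_an : forall b : R, J b -> analytic_at W b%:C.
Hypothesis W_neq0 : forall b : R, J b -> W b%:C != 0.
Hypothesis l_summable : forall n (b : R), J b ->
  (\esum_(k in [set: int]) (`|l n k| * expR (b * k%:~R))%:E < +oo)%E.
Hypothesis a0_gt0 : 0 < a0.
Hypothesis C_ge0 : 0 <= C.
Hypothesis W_rate : forall n (b u : R), J b -> 0 <= u <= a0 -> 1 <= w n ->
  nc (Wnorm phi (w n) (l n) (b +i* u) - W (b +i* u)) <= C * (w n ^+ r.+1)^-1.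
Local Notation tail n a := (nnsup K (fun b => (expR (- (on_real phi b * w n)))%:E *
   \int[lebesgue_measure]_(u in `[a, pi]) (nc (zlaplace (l n) (b +i* u)))%:E)%E).
Hypothesis tail_cvg : forall m : nat,
  ((w n ^+ r.+1)%:E * tail n (m.+1%:R^-1)%R)%E @[n --> \oo] --> 0%E.

Let w_near1 : \forall n \near \oo, 1 <= w n.
Proof. by move/cvgryPge: w_cvg; exact. Qed.

Let rsqrt_cvg : (Num.sqrt (w n))^-1 @[n --> \oo] --> 0.
Proof.
apply/cvgrPdist_lt => eps eps0.
have : \forall n \near \oo, (eps ^+ 2)^-1 < w n by move/cvgryPgt: w_cvg; exact.
apply: filterS => n wn; rewrite sub0r normrN ger0_norm ?invr_ge0 ?sqrtr_ge0//.
have e2 : 0 < (eps ^+ 2)^-1 by rewrite invr_gt0 exprn_gt0.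
have w0 : 0 < w n := lt_trans e2 wn.
rewrite invf_plt ?posrE ?sqrtr_gt0//.
by rewrite -(ger0_norm (ltW eps0)) -sqrtr_sqr -sqrtrV ?exprn_ge0 ?ltW// ltr_sqrt.
Qed.

(** It is the limit of the numbers W_n(b), which are real. *)
Lemma limit_real (b : R) : J b -> complex.Im (W b%:C) = 0.
Proof.
move=> Jb; apply/eqP; rewrite -normr_eq0 eq_le normr_ge0 andbT.
have ImWn n : complex.Im (Wnorm phi (w n) (l n) b%:C) = 0.
  have -> : Wnorm phi (w n) (l n) b%:C =
      (expR (- (on_real phi b * w n)))%:C * zlaplace (l n) b%:C.
    rewrite /Wnorm -cexpR; congr (cexp _ * _).
    rewrite (_ : phi b%:C = (on_real phi b)%:C) -?rmorphM -?rmorphN//.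
    by apply: eq_complexP => //=; exact: phi_real.
  by rewrite cImMr cIm_zlaplace_real ?mulr0//; exact: l_summable.
have cvg0 : (C * (Num.sqrt (w n))^-1) @[n --> \oo] --> 0.
  by rewrite -[X in _ --> X](mulr0 C); apply: cvgM rsqrt_cvg; exact: cvg_cst.
have -> : 0 = lim ((C * (Num.sqrt (w n))^-1) @[n --> \oo]) by rewrite (cvg_lim _ cvg0).
apply: limr_ge; first by apply/cvg_ex; exists 0.
apply: filterS w_near1 => n wn.
have a00 : (0 : R) <= 0 <= a0 by rewrite lexx ltW.
have := W_rate Jb a00 wn.
rewrite (_ : b +i* 0 = b%:C)// => /(le_trans (le_Im_normc _)).
rewrite cImD cImN ImWn sub0r normrN => /le_trans; apply.
rewrite ler_wpM2l// lef_pV2 ?posrE ?exprn_gt0 ?sqrtr_gt0 ?(lt_le_trans _ wn)//.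
apply: (@le_trans _ _ (w n)); last by rewrite exprS ler_peMr ?exprn_ege1// (le_trans _ wn).
by rewrite -[leRHS]sqr_sqrtr ?(le_trans _ wn)// expr2 ler_peMr ?sqrtr_ge0// -[leLHS]sqrtr1 ler_wsqrtr.
Qed.

Let main_error n k b := `|expR (b * k%:~R - on_real phi b * w n) * l n k
  - on_real W b * expR (- (xnorm phi (w n) k b ^+ 2 / 2))
      / (sigma phi b * Num.sqrt (2 * pi * w n))
    * \sum_(j < r.+1) Gpoly phi W j b (xnorm phi (w n) k b) / w n `^ (j%:R / 2)|.

(** The start of the tail is the inverse of a positive integer, so that countably
    many tails cover all the cases. *)
Lemma uniform_error : exists m : nat, exists E : R, forall n, 1 <= w n ->
  forall delta k b, K b ->
  ((expR (- (on_real phi b * w n)))%:E * \int[lebesgue_measure]_(u in `[(m.+1%:R^-1)%R, pi])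
     (nc (zlaplace (l n) (b +i* u)))%:E <= delta%:E)%E ->
  main_error n k b <= E * (Num.sqrt (w n))^-1 ^+ r.+2 + delta.
Proof.
have W_real := limit_real.
have [M1 M11 H1] := @taylor_uniform _ J K J_open K_compact KJ phi r.+3 phi_an phi_real.
have [s0 s00 Hs] := @sigma_uniform _ J K J_open K_compact KJ phi phi_an phi_real phi_convex.
have [M2 M21 H2] := @limit_uniform _ J K J_open K_compact KJ W r W_an W_real W_neq0.
pose M := M1 + M2 + C.
have M1M : M1 <= M by rewrite /M -addrA lerDl addr_ge0// (le_trans _ M21).
have M2M : M2 <= M by rewrite /M addrAC lerDr addr_ge0// (le_trans _ M11).
have M2CM : M2 + C <= M by rewrite /M -addrA lerDr (le_trans _ M11).
have CM : C <= M by rewrite /M lerDr addr_ge0// (le_trans _ M11, le_trans _ M21).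
have M_ge1 : 1 <= M := le_trans M11 M1M.
pose amax := Num.min (Num.min a0 M^-1) (Num.min (window r M s0) pi).
have amax0 : 0 < amax.
  rewrite lt_min; apply/andP; split; rewrite lt_min; apply/andP; split => //.
  - by rewrite invr_gt0 (lt_le_trans _ M_ge1).
  - exact: window_gt0.
  - exact: pi_gt0.
pose m := Num.truncn amax^-1.
have ma : m.+1%:R^-1 <= amax.
  rewrite invf_ple ?posrE// ltW//.
  by have /andP[] := truncn_itv (ltW (etrans (invr_gt0 amax) amax0)).
pose a : R := m.+1%:R^-1.
have a_gt0 : 0 < a by rewrite invr_gt0.
move: ma; rewrite -/a le_min => /andP[]; rewrite le_min => /andP[aa0 aM].
rewrite le_min => /andP[awin api].
exists m, (error_const r M s0 a) => n wn delta k b Kb tail_le.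
have [dM tM] := H1 b Kb; have [chM WM WT] := H2 b Kb.
have w0 : 0 < w n := lt_le_trans ltr01 wn.
have Jb := KJ Kb.
have bu u : b +i* u = b%:C + (0 +i* u) by apply: eq_complexP; rewrite /= ?addr0 ?add0r.
have ncu (u : R) : 0 <= u -> nc (0 +i* u) = u.
  by move=> u0; rewrite /= expr0n add0r sqrtr_sqr ger0_norm.
apply: (profile_error M_ge1 s00 a_gt0 awin api wn (l_summable n Jb) (Hs b Kb)
  (ltW (phi_convex Jb))).
- by move=> j jr; apply: le_trans M1M; apply: dM; exact: leq_trans jr _.
- by move=> j jr; apply: le_trans M2M; exact: chM.
- exact: le_trans WM M2M.
- move=> u /andP[u0 ua].
  have uM2 : nc (0 +i* u) <= M2^-1.
    rewrite ncu// (le_trans ua)// (le_trans aM)// lef_pV2 ?posrE ?(lt_le_trans ltr01)//.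
  have := WT _ uM2; rewrite -bu ncu// => WTu.
  have ua0 : 0 <= u <= a0 by rewrite u0 (le_trans ua).
  have Wr := W_rate Jb ua0 wn.
  rewrite -[X in nc X](subrKA (W (b +i* u))).
  apply: le_trans (le_normcD _ _) _; rewrite mulrDr addrC; apply: lerD.
    by apply: le_trans WTu _; rewrite ler_wpM2r ?exprn_ge0.
  apply: le_trans Wr _; apply: ler_pM => //.
    by rewrite invr_ge0 exprn_ge0// ltW.
  rewrite -exprVn; apply: lerXn2r; rewrite ?nnegrE ?invr_ge0 ?sqrtr_ge0 ?(ltW w0)//.
  rewrite lef_pV2 ?posrE ?sqrtr_gt0//.
  rewrite -[leRHS](@sqr_sqrtr _ (w n)) ?(ltW w0)// expr2 ler_peMr ?sqrtr_ge0//.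
  by rewrite -[leLHS]sqrtr1 ler_wsqrtr.
- move=> u /andP[u0 ua]; rewrite bu.
  have -> : M * u ^+ r.+3 = M * nc (0 +i* u) ^+ r.+3 by rewrite ncu.
  have uM1 : nc (0 +i* u) <= M1^-1.
    by rewrite ncu// (le_trans ua)// (le_trans aM)// lef_pV2 ?posrE ?(lt_le_trans ltr01).
  apply: le_trans (tM _ uM1) _.
  by rewrite ler_wpM2r ?exprn_ge0 ?normc_ge0.
- have mz : measurable_fun `[a, pi] (fun u => (nc (zlaplace (l n) (b +i* u)))%:E).
    apply/measurable_EFinP; apply: (@measurable_funS _ _ _ _ setT) => //.
    exact: measurable_normc_zlaplace (l_summable n Jb).
  rewrite /Rintegral -lee_fin.
  under eq_integral do rewrite EFinM.
  rewrite ge0_integralZl_EFin ?expR_ge0//; last first.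
    by move=> u _; rewrite lee_fin normc_ge0.
  rewrite fineK// ge0_fin_numE; first exact: le_lt_trans tail_le (ltry _).
  apply: mule_ge0; first by rewrite lee_fin expR_ge0.
  by apply: integral_ge0 => u _; rewrite lee_fin normc_ge0.
Qed.

(** The factor w^((r+1)/2) = e^-(r+1) leaves an error of order e, plus the tail
    multiplied by at most w^(r+1). *)
Lemma uniform_expansion_cvg :
  ((w n `^ (r.+1%:R / 2))%:E *
   nnsup [set: int] (fun k => nnsup K (fun b => (main_error n k b)%:E)))%E
  @[n --> \oo] --> 0%E.
Proof.
have [m [E HE]] := uniform_error.
pose B n : \bar R := ((`|E| * (Num.sqrt (w n))^-1)%:E +
  (w n ^+ r.+1)%:E * tail n (m.+1%:R^-1)%R)%E.
apply: (@squeeze_cvge _ _ _ _ (fun=> 0%E) _ B); first last.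
- have c1 : (`|E| * (Num.sqrt (w n))^-1)%:E @[n --> \oo] --> 0%E.
    apply: cvg_EFin; first exact: nearW.
    have : (`|E| * (Num.sqrt (w n))^-1) @[n --> \oo] --> `|E| * 0.
      by apply: cvgM rsqrt_cvg; exact: cvg_cst.
    by rewrite mulr0.
  have := cvgeD (isT : (0%R%:E +? 0%R%:E)%E) c1 (tail_cvg m).
  by rewrite adde0 => /(_ eventually_filter).
- exact: cvg_cst.
apply: filterS w_near1 => n wn.
have w0 : 0 < w n := lt_le_trans ltr01 wn.
apply/andP; split.
  by rewrite mule_ge0 ?lee_fin ?powR_ge0// nnsup_ge0.
have wE : w n `^ (r.+1%:R / 2) = Num.sqrt (w n) ^+ r.+1.
  by rewrite mulrC powRrM powR12_sqrt ?(ltW w0)// powR_mulrn ?sqrtr_ge0.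
have sw1 : 1 <= Num.sqrt (w n) by rewrite -[leLHS]sqrtr1 ler_wsqrtr.
have sw0 : 0 < Num.sqrt (w n) := lt_le_trans ltr01 sw1.
rewrite /B; have := nnsup_ge0 K (fun b => (expR (- (on_real phi b * w n)))%:E *
   \int[lebesgue_measure]_(u in `[(m.+1%:R^-1)%R, pi]) (nc (zlaplace (l n) (b +i* u)))%:E)%E.
have := @nnsup_ge _ _ K (fun b => (expR (- (on_real phi b * w n)))%:E *
   \int[lebesgue_measure]_(u in `[(m.+1%:R^-1)%R, pi]) (nc (zlaplace (l n) (b +i* u)))%:E)%E.
case: (nnsup _ _) => [delta||]// tail_le; rewrite ?lee_fin => delta0; last first.
  by rewrite gt0_muley ?lte_fin ?exprn_gt0// addey// leey.
have e0 : 0 <= (Num.sqrt (w n))^-1 by rewrite invr_ge0 sqrtr_ge0.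
have bound0 : 0 <= `|E| * (Num.sqrt (w n))^-1 ^+ r.+2 + delta.
  by rewrite addr_ge0// mulr_ge0// exprn_ge0.
apply: (@le_trans _ _ ((w n `^ (r.+1%:R / 2))%:E *
    (`|E| * (Num.sqrt (w n))^-1 ^+ r.+2 + delta)%:E)%E).
  apply: lee_wpmul2l; first by rewrite lee_fin powR_ge0.
  apply: nnsup_le => [|k _]; first by rewrite lee_fin.
  apply: nnsup_le => [|b Kb]; first by rewrite lee_fin.
  rewrite lee_fin; apply: le_trans (HE n wn delta k b Kb (tail_le _ Kb)) _.
  by rewrite lerD2r ler_wpM2r ?exprn_ge0// ler_norm.
rewrite -EFinM -EFinM -EFinD lee_fin wE mulrDr; apply: lerD.
  rewrite mulrCA ler_wpM2l// [_ ^+ r.+2]exprS mulrCA exprVn divff ?mulr1//.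
  by rewrite expf_neq0// gt_eqF.
rewrite ler_wpM2r//; apply: lerXn2r; rewrite ?nnegrE ?sqrtr_ge0 ?(ltW w0)//.
by rewrite -[leRHS](@sqr_sqrtr _ (w n)) ?(ltW w0)// expr2 ler_peMr ?sqrtr_ge0.
Qed.

End pathwise.

(** * Intervals and rectangles *)

Lemma ointerval_open (R : realType) (bm bp : \bar R) : open (ointerval bm bp).
Proof.
rewrite (_ : ointerval bm bp = [set b | (bm < b%:E)%E] `&` [set b | (b%:E < bp)%E]).
  by apply: openI; [exact: open_ereal_gt|exact: open_ereal_lt].
by apply/seteqP; split=> b /andP.
Qed.

Lemma ointerval_itv (R : realType) (bm bp : \bar R) (b1 b2 b : R) :
  ointerval bm bp b1 -> ointerval bm bp b2 -> b1 <= b <= b2 -> ointerval bm bp b.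
Proof.
move=> /andP[b1m _] /andP[_ b2p] /andP[b1b bb2].
by apply/andP; split; [apply: lt_le_trans b1m _|apply: le_lt_trans b2p]; rewrite lee_fin.
Qed.

Lemma ointerval_hull (R : realType) (bm bp : \bar R) (K : set R) :
  ointerval bm bp 0 -> compact K -> K `<=` ointerval bm bp ->
  exists b1 b2, [/\ ointerval bm bp b1, ointerval bm bp b2 & K `<=` `]b1, b2[].
Proof.
move=> I0 cK KI.
have [K0|/set0P K_neq0] := eqVneq K set0.
  by exists 0, 0; split => // x; rewrite K0.
have cid : {within K, continuous (id : R -> R)}.
  by apply: continuous_subspaceT => x; exact: cvg_id.
have [c1 /set_mem Kc1 c1P] := compact_EVT_min K_neq0 cK cid.
have [c2 /set_mem Kc2 c2P] := compact_EVT_max K_neq0 cK cid.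
have near_in c : K c -> exists2 e : R, 0 < e & ointerval bm bp (c - e) /\ ointerval bm bp (c + e).
  move=> Kc.
  have /nbhs_ballP[e /= e0 eI] := open_nbhs_nbhs (conj (@ointerval_open _ bm bp) (KI c Kc)).
  have he : `|e / 2| < e by rewrite ger0_norm ?ltW ?divr_gt0// ltr_pdivrMr// ltr_pMr// ltr1n.
  exists (e / 2); first by rewrite divr_gt0.
  by split; apply: eI; rewrite /ball/=; [rewrite subKr|rewrite opprD addNKr normrN].
have [e1 e10 [I1 _]] := near_in _ Kc1; have [e2 e20 [_ I2]] := near_in _ Kc2.
exists (c1 - e1), (c2 + e2); split => // x Kx.
rewrite /= in_itv /=; apply/andP; split.
  by rewrite ltrBlDr (le_lt_trans (c1P x (mem_set Kx)))// ltrDl.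
by rewrite (le_lt_trans (c2P x (mem_set Kx)))// ltrDl.
Qed.

(** Because e^(bk) <= e^(b1 k) + e^(b2 k). In this way one almost sure event
    covers all the exponents in an interval. *)
Lemma esum_laplace_itv (R : realType) (l : int -> R) (b1 b2 b : R) : b1 <= b <= b2 ->
  (\esum_(k in [set: int]) (`|l k| * expR (b1 * k%:~R))%:E < +oo)%E ->
  (\esum_(k in [set: int]) (`|l k| * expR (b2 * k%:~R))%:E < +oo)%E ->
  (\esum_(k in [set: int]) (`|l k| * expR (b * k%:~R))%:E < +oo)%E.
Proof.
move=> /andP[b1b bb2] s1 s2.
apply: (@le_lt_trans _ _ (\esum_(k in [set: int]) (`|l k| * expR (b1 * k%:~R))%:E
  + \esum_(k in [set: int]) (`|l k| * expR (b2 * k%:~R))%:E)%E); last first.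
  by rewrite lte_add_pinfty.
rewrite -esumD; last 2 first.
- by move=> k _; rewrite lee_fin mulr_ge0 ?expR_ge0.
- by move=> k _; rewrite lee_fin mulr_ge0 ?expR_ge0.
apply: le_esum => k _; rewrite -EFinD lee_fin -mulrDr ler_wpM2l//.
have [k0|k0] := leP 0 k.
  rewrite (le_trans (_ : _ <= expR (b2 * k%:~R)))// ?lerDr ?expR_ge0//.
  by rewrite ler_expR ler_wpM2r// ler0z.
rewrite (le_trans (_ : _ <= expR (b1 * k%:~R)))// ?lerDl ?expR_ge0//.
by rewrite ler_expR ler_wnM2r// lerz0 ltW.
Qed.

Section rectangle.
Variable R : realType.

Lemma continuous_rectangular :
  continuous (fun p : R * R => (p.1 +i* p.2 : R[i]^o)).
Proof.
move=> p; apply: (proj2 (@cvg_complexP _ _ _ _ (fun q : R * R => q.1 +i* q.2) _)).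
by split=> /=; [exact: cvg_fst|exact: cvg_snd].
Qed.

Lemma rectangle_compact (b1 b2 a : R) :
  compact ([set z | b1 <= complex.Re z <= b2 /\ 0 <= complex.Im z <= a] : set R[i]^o).
Proof.
rewrite (_ : [set z | _] = (fun p : R * R => (p.1 +i* p.2 : R[i]^o)) @`
    (`[b1, b2] `*` `[0, a])).
  apply: continuous_compact; last by apply: compact_setX; exact: segment_compact.
  by apply: continuous_subspaceT; exact: continuous_rectangular.
apply/seteqP; split=> [[x y] /= [xb ya]|z [[x y] /= [xb ya] <-]].
  by exists (x, y) => //=; rewrite !in_itv /=.
by move: xb ya; rewrite !in_itv.
Qed.

(** The width a does not depend on chance: one deterministic compact rectangle
    will serve for almost every realisation. *)
Lemma rectangle_in_open (D : set R[i]^o) (b1 b2 : R) : open D ->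
  (forall b : R, b1 <= b <= b2 -> D b%:C) ->
  exists2 a : R, 0 < a & forall b u, b1 <= b <= b2 -> 0 <= u <= a -> D (b +i* u).
Proof.
move=> D_open segD.
pose Q (b M : R) := 0 < M /\ forall u : R, `|u| <= M^-1 -> D (b +i* u).
have [|b M M'|b0|M M1 QM] := @compact_uniform R `[b1, b2] Q.
- exact: segment_compact.
- move=> MM' [M0 QM]; have M'0 : 0 < M' := lt_le_trans M0 MM'.
  by split=> // u uM; apply: QM; apply: le_trans uM _; rewrite lef_pV2.
- rewrite /= in_itv /= => b0_in.
  have /(@continuous_rectangular (b0, 0)) : nbhs (b0 +i* 0 : R[i]^o) D.
    by apply: open_nbhs_nbhs; split => //; exact: segD.
  case=> -[A B] /= [b0A /nbhs_ballP[e /= e0 eB]] AB.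
  exists (e / 2)^-1; apply: filterS b0A => b Ab.
  split=> [|u]; first by rewrite invr_gt0 divr_gt0.
  rewrite invrK => ue; apply: (AB (b, u)); split => //=; apply: eB.
  rewrite /ball /= sub0r normrN (le_lt_trans ue)//.
  by rewrite ltr_pdivrMr// ltr_pMr// ltr1n.
exists M^-1; first by rewrite invr_gt0 (lt_le_trans _ M1).
move=> b u bI /andP[u0 uM]; have [|_] := QM b; first by rewrite /= in_itv.
by apply; rewrite ger0_norm.
Qed.

End rectangle.

(** * Random profiles *)

Theorem theorem2p1 (R : realType) (d : measure_display) (T : measurableType d)
  (P : probability T R)
  (L : nat -> int -> {RV P >-> R})
  (bm bp : \bar R) (w : nat -> R) (D : set R[i]^o)
  (phi : R[i] -> R[i]) (Winf : T -> R[i] -> R[i])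
  (I0 : ointerval bm bp 0)
  (w_cvg : w @ \oo --> +oo)
  (D_open : open D)
  (D_connected : connected D)
  (D_strip : forall z : R[i], D z -> ointerval bm bp (complex.Re z))
  (D_real : forall b : R, D (b%:C) <-> ointerval bm bp b)
  (phi_analytic : analytic_on D phi)
  (phi_real : forall b : R, ointerval bm bp b -> complex.Im (phi b%:C) = 0)
  (phi_convex : forall b : R, ointerval bm bp b -> 0 < derive1n 2 (on_real phi) b)
  (A1 : forall (n : nat) (b : R), ointerval bm bp b ->
     {ae P, forall t,
       (\esum_(k in [set: int]) (`|L n k t| * expR (b * k%:~R))%:E < +oo)%E})
  (Winf_measurable : forall z : R[i], D z ->
     measurable_fun [set: T] (fun t => complex.Re (Winf t z)) /\
     measurable_fun [set: T] (fun t => complex.Im (Winf t z)))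
  (Winf_analytic : {ae P, forall t, analytic_on D (Winf t)})
  (A2_cvg : {ae P, forall t,
     locally_uniform_cvg D (fun n => Wnorm phi (w n) (fun k => L n k t)) (Winf t)})
  (A2_neq0 : {ae P, forall t, forall b : R, ointerval bm bp b -> Winf t b%:C != 0})
  (A3 : forall (K : set R[i]^o) (r : nat), compact K -> K `<=` D -> (0 < r)%N ->
     exists2 C : T -> \bar R, measurable_fun [set: T] C &
       {ae P, forall t, (C t \is a fin_num) /\
         forall n : nat,
           (nnsup K (fun z =>
               (Normc.normc (Wnorm phi (w n) (fun k => L n k t) z - Winf t z))%:E)
              < C t * inve ((w n) ^+ r)%:E)%E})
  (A4 : forall (K : set R) (a : R) (r : nat), compact K -> K `<=` ointerval bm bp -> 0 < a ->
     {ae P, forall t,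
       (((w n) ^+ r)%:E *
        nnsup K (fun b => (expR (- (on_real phi b * w n)))%:E *
          \int[lebesgue_measure]_(u in `[a, pi])
            (Normc.normc (zlaplace (fun k => L n k t) (b +i* u)))%:E))%E
       @[n --> \oo] --> 0%E})
  (r : nat) (K : set R) (K_compact : compact K) (K_sub : K `<=` ointerval bm bp) :
  {ae P, forall t,
    (forall (j : nat) (b : R), ointerval bm bp b ->
       exists2 p : {poly R}, (size p <= (3 * j).+1)%N &
         forall x : R, Gpoly phi (Winf t) j b x = p.[x]) /\
    ((((w n) `^ (r.+1%:R / 2))%:E *
      nnsup [set: int] (fun k => nnsup K (fun b =>
        `|expR (b * k%:~R - on_real phi b * w n) * L n k t
          - on_real (Winf t) b * expR (- (xnorm phi (w n) k b ^+ 2 / 2))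
              / (sigma phi b * Num.sqrt (2 * pi * w n))
            * \sum_(j < r.+1)
                Gpoly phi (Winf t) j b (xnorm phi (w n) k b) / (w n) `^ (j%:R / 2)
         |%:E)))%E
     @[n --> \oo] --> 0%E)}.
Proof.
have [b1 [b2 [Ib1 Ib2 Kb]]] := ointerval_hull I0 K_compact K_sub.
have J_sub b : b1 <= b <= b2 -> ointerval bm bp b by exact: ointerval_itv.
have [a0 a00 rect] : exists2 a0 : R, 0 < a0 &
    forall b u, b1 <= b <= b2 -> 0 <= u <= a0 -> D (b +i* u).
  by apply: rectangle_in_open => // b bI; apply/D_real/J_sub.
have rate := A3 _ r.+1 (@rectangle_compact R b1 b2 a0) _ isT.
have {rate}[|C _ rate] := rate; first by move=> [x y] [/= xI yI]; exact: rect.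
(* Countably many almost sure events: all n at the two end points, and the tails
   from 1 / (m + 1) for all m. *)
have sum1 := ae_foralln (fun n => A1 n b1 Ib1).
have sum2 := ae_foralln (fun n => A1 n b2 Ib2).
have tail := ae_foralln (fun m : nat => A4 K (m.+1%:R^-1) r.+1 K_compact K_sub
  (etrans (invr_gt0 _) (ltr0Sn R m))).
apply: filter_app Winf_analytic; apply: filter_app A2_neq0.
apply: filter_app rate; apply: filter_app sum1; apply: filter_app sum2.
apply: filterS tail => t tail sum2 sum1 [C_fin rate] W_neq0 W_an.
have J_itv (b : R) : (`]b1, b2[)%classic b -> b1 <= b <= b2.
  by rewrite /= in_itv /= => /andP[/ltW -> /ltW ->].
split=> [j b _|]; first exact: Gpoly_polynomial.
apply: (@uniform_expansion_cvg R phi (Winf t) w (fun n k => L n k t) `]b1, b2[ K r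
  `|fine (C t)| a0) => //.
- by move=> b /J_itv bI; apply/phi_analytic/D_real/J_sub.
- by move=> b /J_itv bI; apply/phi_real/J_sub.
- by move=> b /J_itv bI; apply/phi_convex/J_sub.
- by move=> b /J_itv bI; apply/W_an/D_real/J_sub.
- by move=> b /J_itv bI; apply/W_neq0/J_sub.
- by move=> n b /J_itv bI; exact: esum_laplace_itv bI (sum1 n) (sum2 n).
- move=> n b u /J_itv bI uI wn.
  have Wn0 : w n ^+ r.+1 != 0 by rewrite expf_neq0// gt_eqF// (lt_le_trans ltr01).
  have := rate n; rewrite inver (negbTE Wn0) -(fineK C_fin) => /ltW.
  have := @nnsup_ge _ _ [set z : R[i] | b1 <= complex.Re z <= b2 /\ 0 <= complex.Im z <= a0]
    (fun z => (nc (Wnorm phi (w n) (fun k => L n k t) z - Winf t z))%:E) (b +i* u) (conj bI uI).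
  move=> /le_trans /[apply]; rewrite -EFinM lee_fin => /le_trans; apply.
  by rewrite ler_wpM2r ?ler_norm// invr_ge0 exprn_ge0// (le_trans ler01).
Qed.
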